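(* Consider the Gibbs sampler for the linear latent non-Gaussian model described in the context, and assume that $\pi(M\mid V,Y)$ is everywhere positive and continuous in $V$. Then the marginal chain $(V^{(t)})_{t\ge 0}$ on $(0,\infty)^n$ is geometrically ergodic in each of the following parameter regimes: (i) $a>0$, $b>0$, $p\in\mathbb{R}$; (ii) $a>0$, $b=0$, $p>\tfrac12$; (iii) $a>0$, $b=0$, $0<p\le\tfrac12$, provided the null-smallness assumption holds; (iv) $a=0$, $b>0$, $p<0$, $\mu=0$; (v) $a=0$, $b>0$, $p<0$, $\mu\neq 0$, provided the null-smallness assumption holds.
   Context: GIG distribution: $\mathrm{GIG}(p,a,b)$ is the law on $(0,\infty)$ with density proportional to $x^{p-1}\exp\{-\tfrac12(ax+b/x)\}$, for parameters with ($a>0,b>0,p\in\mathbb{R}$) or ($a=0,b>0,p<0$) or ($a>0,b=0,p>0$). Model: fix $A\in\mathbb{R}^{m\times n}$, an invertible $K\in\mathbb{R}^{n\times n}$, a design matrix $X$ with coefficients $\beta$, $h\in\mathbb{R}^n$, $\mu\in\mathbb{R}$, $\sigma>0$, $\sigma_\epsilon>0$, GIG parameters $(p,a,b)$; put $B=AK^{-1}$. $Y\mid M,V\sim N(X\beta+B(M-\mu h),\sigma_\epsilon^2 I)$, $M\mid V\sim N(\mu V,\mathrm{diag}(\sigma^2V))$, $V_1,\dots,V_n$ independent $\mathrm{GIG}(p,a,b)$. The data $Y\in\mathbb{R}^m$ are fixed. Gibbs sampler: with $D_V=\mathrm{diag}(V)$, $\rho=\sigma^2\sigma_\epsilon^{-2}$,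 $\bar Q(V)=\rho B^\top B+D_V^{-1}$, $\bar m=\rho B^\top(Y-X\beta+\mu Bh)+\mu\mathbf 1$ ($\mathbf 1$ the all-ones vector), one step from $V$ draws $M\mid V,Y\sim N(\bar Q(V)^{-1}\bar m,\sigma^2\bar Q(V)^{-1})$ and then, independently over $i$, $\tilde V_i\mid M_i\sim\mathrm{GIG}(p-\tfrac12,\ a+\mu^2/\sigma^2,\ b+M_i^2/\sigma^2)$ (defined for almost every $M$). The chain $V\to\tilde V$ has invariant probability measure $\pi$ with density $\pi(V\mid Y)$. Null-smallness assumption: with $r=\dim\mathrm{Null}(A)$, either $r=0$, or, for $U_A\in\mathbb{R}^{n\times r}$ an orthonormal basis of $\mathrm{Null}(A)$, $G=U_A^\top K^\top KU_A$ and $z=U_A^\top K^\top\mathbf 1$, one has $\frac{|\mu|}{\sqrt{\sigma^2a+\mu^2}}\sqrt{z^\top G^{-1}z}<1$ (automatically satisfied when $\mu=0$). Geometric ergodicity: a chain with transition operator $P$ and stationary distribution $\pi$ is geometrically ergodic if there is $\gamma\in(0,1)$ such that for every probability measure $\nu\ll\pi$ with $d\nu/d\pi\in L_2(\pi)$ there is $C=C(\nu)<\infty$ with $\|\nu P^t-\pi\|_{\mathrm{TV}}\le C\gamma^t$ for all $t\in\mathbb{N}$. *)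

(* Defs.v *)
From HB Require Import structures.
From mathcomp Require Import all_boot all_order all_algebra.
From mathcomp Require Import all_classical all_reals all_analysis.
From mathcomp Require Import measurable_realfun.

Set Implicit Arguments.
Unset Strict Implicit.
Unset Printing Implicit Defensive.

Import Order.TTheory GRing.Theory Num.Theory.
Import numFieldNormedType.Exports.

Local Open Scope classical_set_scope.
Local Open Scope ring_scope.

Section real_measurability.
Context d (T : measurableType d) (R : realType).
Implicit Types f g : T -> R.

Lemma measurable_invr : measurable_fun [set: R] (fun x : R => x^-1).
Proof.
rewrite (_ : (fun x : R => x^-1) = fun x => x * (x ^+ 2) `^ (-1)).
  apply: measurable_funM => //.
  by apply: (measurableT_comp (measurable_powR _)); exact: measurable_funX.
apply/funext => x; have [->|x0] := eqVneq x 0; first by rewrite invr0 mul0r.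
by rewrite powR_inv1 ?sqr_ge0// expr2 invfM mulrA divff// mul1r.
Qed.

Lemma measurable_sqrtr : measurable_fun [set: R] (@Num.sqrt R).
Proof. by apply: continuous_measurable_fun; exact: sqrt_continuous. Qed.

Lemma measurable_funV f : measurable_fun setT f ->
  measurable_fun setT (fun x => (f x)^-1).
Proof. by move=> mf; apply: (measurableT_comp measurable_invr). Qed.

End real_measurability.

Section matrix_measurability.
Context d (T : measurableType d) (R : realType).

Definition mx_measurable m n (F : T -> 'M[R]_(m, n)) :=
  forall i j, measurable_fun setT (fun z => F z i j).

Lemma mx_measurable_cst m n (A : 'M[R]_(m, n)) : mx_measurable (fun=> A).
Proof. by move=> i j; exact: measurable_cst. Qed.

Lemma mx_measurableT m n (F : T -> 'M[R]_(m, n)) :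
  mx_measurable F -> mx_measurable (fun z => (F z)^T).
Proof. by move=> mF i j; under eq_fun do rewrite mxE; exact: mF. Qed.

Lemma mx_measurableD m n (F G : T -> 'M[R]_(m, n)) :
  mx_measurable F -> mx_measurable G -> mx_measurable (fun z => F z + G z).
Proof.
move=> mF mG i j; under eq_fun do rewrite mxE.
by apply: measurable_funD; [exact: mF|exact: mG].
Qed.

Lemma mx_measurableN m n (F : T -> 'M[R]_(m, n)) :
  mx_measurable F -> mx_measurable (fun z => - F z).
Proof.
move=> mF i j; under eq_fun do rewrite mxE.
by apply: measurable_funN; exact: mF.
Qed.

Lemma mx_measurableZ m n (a : T -> R) (F : T -> 'M[R]_(m, n)) :
  measurable_fun setT a -> mx_measurable F ->
  mx_measurable (fun z => a z *: F z).
Proof.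
move=> ma mF i j; under eq_fun do rewrite mxE.
by apply: measurable_funM => //; exact: mF.
Qed.

Lemma mx_measurableM m n p (F : T -> 'M[R]_(m, n)) (G : T -> 'M[R]_(n, p)) :
  mx_measurable F -> mx_measurable G -> mx_measurable (fun z => F z *m G z).
Proof.
move=> mF mG i j; under eq_fun do rewrite mxE.
apply: measurable_sum => k.
by apply: measurable_funM; [exact: mF|exact: mG].
Qed.

Lemma mx_measurable_diag n (F : T -> 'rV[R]_n) :
  mx_measurable F -> mx_measurable (fun z => diag_mx (F z)).
Proof.
move=> mF i j; under eq_fun do rewrite mxE.
by case: eqVneq => _; rewrite ?mulr1n ?mulr0n; [exact: mF|exact: measurable_cst].
Qed.

Lemma measurable_det n (F : T -> 'M[R]_n) :
  mx_measurable F -> measurable_fun setT (fun z => \det (F z)).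
Proof.
move=> mF; apply: measurable_sum => s; apply: measurable_funM => //.
by apply: measurable_prod => i _; exact: mF.
Qed.

Lemma mx_measurable_inv n (F : T -> 'M[R]_n) :
  mx_measurable F -> mx_measurable (fun z => invmx (F z)).
Proof.
move=> mF i j.
rewrite (_ : (fun z => _) = fun z => if \det (F z) == 0 then F z i j
    else (\det (F z))^-1 * (\adj (F z)) i j); last first.
  apply/funext => z; rewrite /invmx unitmxE unitfE.
  by case: eqVneq => //= _; rewrite mxE.
have mdet := measurable_det mF.
apply: measurable_fun_ifT.
- by apply: measurable_fun_eqr.
- exact: mF.
- apply: measurable_funM; first exact: measurable_funV.
  under eq_fun do rewrite mxE.
  apply: measurable_funM => //; apply: measurable_det => k l.
  by under eq_fun do rewrite !mxE; exact: mF.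
Qed.

End matrix_measurability.

Section sigma_finite_pack.
Context d (T : measurableType d) (R : realType).
Variable m : {measure set T -> \bar R}.
Hypothesis sfm : sigma_finite setT m.

Let m' : set T -> \bar R := m.

HB.instance Definition _ := Measure.on m'.
HB.instance Definition _ := Measure_isSigmaFinite.Build _ _ _ m' sfm.

Lemma sigma_finite_pack :
  exists q : {sigma_finite_measure set T -> \bar R}, q = m :> (set T -> \bar R).
Proof. by exists m'. Qed.

End sigma_finite_pack.

Section lebesgue_tuple.
Context (R : realType).
Local Open Scope ereal_scope.

Definition cons_tuple_pair n (z : measurableTypeR R * n.-tuple R) :
  n.+1.-tuple R := [tuple of z.1 :: z.2].

(* Lebesgue measure on R^n, as an iterated product measure *)
Fixpoint lebesgue_tuple n : set (n.-tuple R) -> \bar R :=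
  match n with
  | 0 => \d_([tuple] : 0.-tuple R)
  | n'.+1 => pushforward
      (product_measure1 lebesgue_measure (lebesgue_tuple (n := n')))
      (@cons_tuple_pair n')
  end.

Let mcons n : measurable_fun setT (@cons_tuple_pair n).
Proof. exact: measurable_cons. Qed.

Let uncons n (t : n.+1.-tuple R) : measurableTypeR R * n.-tuple R :=
  (thead t, [tuple of behead t]).

Let muncons n : measurable_fun setT (@uncons n).
Proof.
apply: measurable_fun_pair; last exact: measurable_behead.
exact: measurable_tnth.
Qed.

Let unconsK n : cancel (@cons_tuple_pair n) (@uncons n).
Proof.
by move=> [x t]; rewrite /uncons theadE; congr pair; exact/val_inj.
Qed.

Lemma lebesgue_tuple_sigma_finite n :
  exists m : {sigma_finite_measure set (n.-tuple R) -> \bar R},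
    lebesgue_tuple (n := n) = m.
Proof.
elim: n => [|n [m mE]].
  by exists [the {sigma_finite_measure set _ -> \bar R} of
    \d_([tuple] : 0.-tuple R)].
have : exists p : {measure set (n.+1.-tuple R) -> \bar R},
    p = pushforward (lebesgue_measure \x m) (@cons_tuple_pair n) :> (set _ -> _).
  by unshelve eexists; [apply: [the {measure set _ -> \bar R} of
    pushforward (lebesgue_measure \x m) (@cons_tuple_pair n)]; exact: mcons|].
move=> [p pE].
pose l : {sigma_finite_measure set (measurableTypeR R) -> \bar R} :=
  lebesgue_measure.
have [F FT mF] : sigma_finite setT (l \x m).
  have /sigma_finiteP[F [TF ndF Foo]] := sigma_finiteT l.
  have /sigma_finiteP[G [TG ndG Goo]] := sigma_finiteT m.
  exists (fun k => F k `*` G k).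
    rewrite -setXTT TF TG predeqE => -[x y]; split.
      move=> [/= [i _ Fix] [j _ Gjy]]; exists (maxn i j) => //; split.
      - by move: x Fix; exact/subsetPset/ndF/leq_maxl.
      - by move: y Gjy; exact/subsetPset/ndG/leq_maxr.
    by move=> [i _ []/= ? ?]; split; exists i.
  move=> k; have [? ?] := Foo k; have [? ?] := Goo k.
  split; first exact: measurableX.
  by rewrite product_measure1E// lte_mul_pinfty// ge0_fin_numE.
have sp : sigma_finite setT p.
  exists (fun k => @uncons n @^-1` F k).
    by rewrite -preimage_bigcup -FT preimage_setT.
  move=> k; have [mFk Fk] := mF k; split.
    by rewrite -[X in measurable X]setTI; exact: muncons.
  rewrite pE /pushforward -comp_preimage.
  by rewrite (_ : _ \o _ = id) ?preimage_id//; apply/funext; exact: unconsK.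
have [q qp] := sigma_finite_pack sp.
by exists q; rewrite qp pE /= mE.
Qed.

Section measure.
Variable n : nat.

Let lebesgue_tuple0 : @lebesgue_tuple n set0 = 0.
Proof. by have [m ->] := lebesgue_tuple_sigma_finite n; exact: measure0. Qed.

Let lebesgue_tuple_ge0 A : 0 <= @lebesgue_tuple n A.
Proof. by have [m ->] := lebesgue_tuple_sigma_finite n; exact: measure_ge0. Qed.

Let lebesgue_tuple_sigma_additive : semi_sigma_additive (@lebesgue_tuple n).
Proof.
have [m ->] := lebesgue_tuple_sigma_finite n.
exact: measure_semi_sigma_additive.
Qed.

HB.instance Definition _ := isMeasure.Build _ _ _ (@lebesgue_tuple n)
  lebesgue_tuple0 lebesgue_tuple_ge0 lebesgue_tuple_sigma_additive.

Let sigma_finite_lebesgue_tuple : sigma_finite setT (@lebesgue_tuple n).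
Proof.
have [m ->] := lebesgue_tuple_sigma_finite n; exact: sigma_finiteT.
Qed.

HB.instance Definition _ := Measure_isSigmaFinite.Build _ _ _
  (@lebesgue_tuple n) sigma_finite_lebesgue_tuple.

End measure.
End lebesgue_tuple.
Arguments lebesgue_tuple {R n}.

Section densities.
Local Open Scope ereal_scope.
Context d d' (X : measurableType d) (Y : measurableType d') (R : realType).

Definition mdensity (mu : {measure set Y -> \bar R}) (f : Y -> \bar R)
    (f0 : forall y, 0 <= f y) (mf : measurable_fun setT f) (A : set Y) :=
  \int[mu]_(y in A) f y.

Section mdensity.
Variables (mu : {measure set Y -> \bar R}) (f : Y -> \bar R).
Hypotheses (f0 : forall y, 0 <= f y) (mf : measurable_fun setT f).

Let mdensity0 : mdensity mu f0 mf set0 = 0.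
Proof. exact: integral_set0. Qed.

Let mdensity_ge0 A : 0 <= mdensity mu f0 mf A.
Proof. exact: integral_ge0. Qed.

Let mdensity_sigma_additive : semi_sigma_additive (mdensity mu f0 mf).
Proof. exact: semi_sigma_additive_nng_induced. Qed.

HB.instance Definition _ := isMeasure.Build _ _ _ (mdensity mu f0 mf)
  mdensity0 mdensity_ge0 mdensity_sigma_additive.

End mdensity.

Section kdensity.
Variables (mu : {sigma_finite_measure set Y -> \bar R}) (f : X * Y -> \bar R).

Definition kdensity (f0 : forall z, 0 <= f z) (mf : measurable_fun setT f)
    (x : X) : {measure set Y -> \bar R} :=
  mdensity mu (fun y => f0 (x, y)) (measurableT_comp mf (pair1_measurable x)).

Hypotheses (f0 : forall z, 0 <= f z) (mf : measurable_fun setT f).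

Let measurable_kdensity U : measurable U ->
  measurable_fun setT (kdensity f0 mf ^~ U).
Proof.
move=> mU; rewrite /kdensity/= /mdensity.
rewrite (_ : (fun x => _) = fubini_F mu (f \_ (setT `*` U))).
  apply: measurable_fun_fubini_tonelli_F; last first.
    by move=> z; rewrite patchE; case: ifP.
  apply/(measurable_restrictT _ _).1; first exact: measurableX.
  exact: measurable_funTS.
apply/funext => x; rewrite integral_mkcond; apply: eq_integral => y _.
rewrite /patch; congr (if _ then _ else _).
by apply/idP/idP; rewrite !inE//= => -[].
Qed.

HB.instance Definition _ :=
  isKernel.Build _ _ _ _ R (kdensity f0 mf) measurable_kdensity.

End kdensity.
End densities.

Section distributions.
Context (R : realType).

(* the unnormalized density of GIG(p, a, b) *)
Definition gig_fun (p a b x : R) : R :=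
  if 0 < x then x `^ (p - 1) * expR (- ((a * x + b / x) / 2)) else 0.

(* Where the parameters are inadmissible, the integral is infinite and this
   is the zero function. *)
Definition gig_pdf (p a b x : R) : R :=
  gig_fun p a b x / fine (\int[lebesgue_measure]_y (gig_fun p a b y)%:E).

(* density of the normal law N(c, S), S being the covariance matrix *)
Definition mvnormal_pdf n (c : 'cV[R]_n) (S : 'M[R]_n) (x : 'cV[R]_n) : R :=
  expR (- (((x - c)^T *m invmx S *m (x - c)) ord0 ord0 / 2)) /
  Num.sqrt ((2 * pi) ^+ n * \det S).

Lemma gig_fun_ge0 p a b x : 0 <= gig_fun p a b x.
Proof.
by rewrite /gig_fun; case: ifP => // _; rewrite mulr_ge0 ?powR_ge0 ?expR_ge0.
Qed.

Lemma gig_pdf_ge0 p a b x : 0 <= gig_pdf p a b x.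
Proof.
rewrite divr_ge0 ?gig_fun_ge0// fine_ge0// integral_ge0// => y _.
by rewrite lee_fin gig_fun_ge0.
Qed.

Lemma mvnormal_pdf_ge0 n c S (x : 'cV[R]_n) : 0 <= mvnormal_pdf c S x.
Proof. by rewrite divr_ge0 ?expR_ge0. Qed.

Section measurability.
Context d (T : measurableType d).

Lemma measurable_gig_fun p a (b x : T -> R) :
  measurable_fun setT b -> measurable_fun setT x ->
  measurable_fun setT (fun z => gig_fun p a (b z) (x z)).
Proof.
move=> mb mx; apply: measurable_fun_ifT => //.
  exact: measurable_fun_ltr.
apply: measurable_funM; first exact: (measurableT_comp (measurable_powR _)).
apply: measurableT_comp => //; apply: measurable_funN.
apply: measurable_funM => //; apply: measurable_funD.
  exact: measurable_funM.
by apply: measurable_funM => //; exact: measurable_funV.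
Qed.

End measurability.

Lemma measurable_gig_norm p a : measurable_fun [set: R]
  (fun b => \int[lebesgue_measure]_y (gig_fun p a b y)%:E)%E.
Proof.
apply: (measurable_fun_fubini_tonelli_F (m2 := lebesgue_measure)
  (fun z : R * measurableTypeR R => (gig_fun p a z.1 z.2)%:E)).
  apply/measurable_EFinP; apply: measurable_gig_fun; first exact: measurable_fst.
  exact: measurable_snd.
by move=> z; rewrite lee_fin gig_fun_ge0.
Qed.

Lemma measurable_gig_pdf d (T : measurableType d) p a (b x : T -> R) :
  measurable_fun setT b -> measurable_fun setT x ->
  measurable_fun setT (fun z => gig_pdf p a (b z) (x z)).
Proof.
move=> mb mx; apply: measurable_funM; first exact: measurable_gig_fun.
apply: measurable_funV; apply: measurableT_comp => //.
by apply: (measurableT_comp (measurable_gig_norm p a)).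
Qed.

Lemma measurable_mvnormal_pdf d (T : measurableType d) n
    (c x : T -> 'cV[R]_n) (S : T -> 'M[R]_n) :
  mx_measurable c -> mx_measurable S -> mx_measurable x ->
  measurable_fun setT (fun z => mvnormal_pdf (c z) (S z) (x z)).
Proof.
move=> mc mS mx.
have mxc : mx_measurable (fun z => x z - c z).
  by apply: mx_measurableD => //; exact: mx_measurableN.
apply: measurable_funM.
  apply: measurableT_comp => //; apply: measurable_funN.
  apply: measurable_funM => //; apply: mx_measurableM => //.
  by apply: mx_measurableM; [exact: mx_measurableT|exact: mx_measurable_inv].
apply: measurable_funV; apply: (measurableT_comp (@measurable_sqrtr R)).
by apply: measurable_funM => //; exact: measurable_det.
Qed.

End distributions.

(* parameters of the linear latent non-Gaussian model *)
Record llnGm (R : realType) (m n k : nat) := LLnGm {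
  mdlA : 'M[R]_(m, n);
  mdlK : 'M[R]_n;
  mdlX : 'M[R]_(m, k);
  mdl_beta : 'cV[R]_k;
  mdl_h : 'cV[R]_n;
  mdl_mu : R;
  mdl_sigma : R;
  mdl_sigma_eps : R;
  mdl_p : R;
  mdl_a : R;
  mdl_b : R }.

Definition orthant (R : realType) n : set 'cV[R]_n :=
  [set V | forall i, 0 < V i ord0].

Definition tuple_col (R : realType) n (t : n.-tuple R) : 'cV[R]_n :=
  \col_i tnth t i.

Lemma mx_measurable_tuple_col (R : realType) d (T : measurableType d) n
    (f : T -> n.-tuple R) :
  measurable_fun setT f -> mx_measurable (fun z => tuple_col (f z)).
Proof.
move=> mf i j; under eq_fun do rewrite mxE.
exact: (measurableT_comp (measurable_tnth i)).
Qed.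

Section model.
Context (R : realType) (m n k : nat) (md : llnGm R m n k) (Y : 'cV[R]_m).

Local Notation A := (mdlA md).
Local Notation K := (mdlK md).
Local Notation X := (mdlX md).
Local Notation beta := (mdl_beta md).
Local Notation h := (mdl_h md).
Local Notation mu := (mdl_mu md).
Local Notation sigma := (mdl_sigma md).
Local Notation sigma_eps := (mdl_sigma_eps md).
Local Notation p := (mdl_p md).
Local Notation a := (mdl_a md).
Local Notation b := (mdl_b md).

Definition mdlB : 'M[R]_(m, n) := A *m invmx K.

(* pi(Y | M) pi(M | V) pi(V) *)
Definition joint_pdf (V M : 'cV[R]_n) : R :=
  mvnormal_pdf (X *m beta + mdlB *m (M - mu *: h)) (sigma_eps ^+ 2)%:M Y *
  mvnormal_pdf (mu *: V) (diag_mx (sigma ^+ 2 *: V^T)) M *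
  \prod_(i < n) gig_pdf p a b (V i ord0).

(* pi(V | Y) up to a multiplicative constant *)
Definition marginal_fun (V : n.-tuple R) : \bar R :=
  (\int[lebesgue_tuple]_(M in [set: n.-tuple R])
    (joint_pdf (tuple_col V) (tuple_col M))%:E)%E.

Definition rho : R := sigma ^+ 2 * sigma_eps ^- 2.

Definition barQ (V : 'cV[R]_n) : 'M[R]_n :=
  rho *: (mdlB^T *m mdlB) + invmx (diag_mx V^T).

Definition barm : 'cV[R]_n :=
  rho *: (mdlB^T *m (Y - X *m beta + mu *: (mdlB *m h))) + mu *: const_mx 1.

(* pi(M | V, Y) *)
Definition condM_pdf (V M : 'cV[R]_n) : R :=
  mvnormal_pdf (invmx (barQ V) *m barm) (sigma ^+ 2 *: invmx (barQ V)) M.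

(* density at V of the independent GIG draws given M *)
Definition condV_pdf (M V : 'cV[R]_n) : R :=
  \prod_(i < n) gig_pdf (p - 2^-1) (a + mu ^+ 2 / sigma ^+ 2)
    (b + M i ord0 ^+ 2 / sigma ^+ 2) (V i ord0).

Let prod_gig_ge0 (P A' : R) (B' v : 'I_n -> R) :
  0 <= \prod_(i < n) gig_pdf P A' (B' i) (v i).
Proof. by apply: prodr_ge0 => i _; exact: gig_pdf_ge0. Qed.

Lemma joint_pdf_ge0 V M : 0 <= joint_pdf V M.
Proof. by rewrite !mulr_ge0 ?mvnormal_pdf_ge0. Qed.

Lemma marginal_fun_ge0 V : (0 <= marginal_fun V)%E.
Proof. by apply: integral_ge0 => M _; rewrite lee_fin joint_pdf_ge0. Qed.

Lemma measurable_joint_pdf : measurable_fun [set: n.-tuple R * n.-tuple R]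
  (fun z => joint_pdf (tuple_col z.1) (tuple_col z.2)).
Proof.
have m1 := mx_measurable_tuple_col (@measurable_fst _ _ (n.-tuple R) (n.-tuple R)).
have m2 := mx_measurable_tuple_col (@measurable_snd _ _ (n.-tuple R) (n.-tuple R)).
apply: measurable_funM; first apply: measurable_funM.
- apply: measurable_mvnormal_pdf; [|exact: mx_measurable_cst..].
  apply: mx_measurableD; first exact: mx_measurable_cst.
  apply: mx_measurableM; first exact: mx_measurable_cst.
  by apply: mx_measurableD => //; exact: mx_measurable_cst.
- apply: measurable_mvnormal_pdf => //; first exact: mx_measurableZ.
  by apply: mx_measurable_diag; apply: mx_measurableZ => //; exact: mx_measurableT.
- apply: measurable_prod => i _; apply: measurable_gig_pdf => //; exact: m1.
Qed.

Lemma measurable_marginal_fun : measurable_fun setT marginal_fun.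
Proof.
apply: (measurable_fun_fubini_tonelli_F (m2 := @lebesgue_tuple R n)
  (fun z : n.-tuple R * n.-tuple R =>
    (joint_pdf (tuple_col z.1) (tuple_col z.2))%:E)).
  by apply/measurable_EFinP; exact: measurable_joint_pdf.
by move=> z; rewrite lee_fin joint_pdf_ge0.
Qed.

Let condM (z : n.-tuple R * n.-tuple R) : \bar R :=
  (condM_pdf (tuple_col z.1) (tuple_col z.2))%:E.

Let condV (z : n.-tuple R * n.-tuple R) : \bar R :=
  (condV_pdf (tuple_col z.1) (tuple_col z.2))%:E.

Lemma condM_ge0 z : (0 <= condM z)%E.
Proof. by rewrite lee_fin mvnormal_pdf_ge0. Qed.

Lemma condV_ge0 z : (0 <= condV z)%E.
Proof. by rewrite lee_fin prod_gig_ge0. Qed.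

Lemma measurable_condM : measurable_fun setT condM.
Proof.
have m1 := mx_measurable_tuple_col (@measurable_fst _ _ (n.-tuple R) (n.-tuple R)).
have m2 := mx_measurable_tuple_col (@measurable_snd _ _ (n.-tuple R) (n.-tuple R)).
have mQ : mx_measurable (fun z : n.-tuple R * n.-tuple R =>
    invmx (barQ (tuple_col z.1))).
  apply: mx_measurable_inv; apply: mx_measurableD.
    exact: mx_measurable_cst.
  by apply: mx_measurable_inv; apply: mx_measurable_diag; exact: mx_measurableT.
apply/measurable_EFinP; apply: measurable_mvnormal_pdf => //.
  by apply: mx_measurableM => //; exact: mx_measurable_cst.
exact: mx_measurableZ.
Qed.

Lemma measurable_condV : measurable_fun setT condV.
Proof.
have m1 := mx_measurable_tuple_col (@measurable_fst _ _ (n.-tuple R) (n.-tuple R)).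
have m2 := mx_measurable_tuple_col (@measurable_snd _ _ (n.-tuple R) (n.-tuple R)).
apply/measurable_EFinP; apply: measurable_prod => i _.
apply: measurable_gig_pdf; last exact: m2.
apply: measurable_funD => //; apply: measurable_funM => //.
by apply: measurable_funX; exact: m1.
Qed.

(* The normalizations below use this default where the total mass is 0 or
   infinite. *)
Let default : probability (n.-tuple R) R :=
  [the probability _ _ of \d_(nseq_tuple n (1 : R))].

(* The posterior distribution pi(V | Y), as a measure on R^n that does not
   charge the complement of the orthant. *)
Definition posterior : set (n.-tuple R) -> \bar R :=
  mnormalize (mdensity lebesgue_tuple marginal_fun_ge0 measurable_marginal_fun)
    default.

HB.instance Definition _ := Probability.on posterior.

(* M given V, for V in the orthant: there condM_pdf already integrates to 1,
   so that the normalization has no effect. *)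
Definition drawM : n.-tuple R -> {measure set (n.-tuple R) -> \bar R} :=
  knormalize (kdensity lebesgue_tuple condM_ge0 measurable_condM) default.

HB.instance Definition _ := ProbabilityKernel.on drawM.

(* V given M: here the normalization only acts on the null set of those M for
   which some GIG parameters are inadmissible. *)
Definition drawV : n.-tuple R -> {measure set (n.-tuple R) -> \bar R} :=
  knormalize (kdensity lebesgue_tuple condV_ge0 measurable_condV) default.

HB.instance Definition _ := ProbabilityKernel.on drawV.

(* the transition kernel of the marginal chain on V *)
Definition gibbs : n.-tuple R -> {measure set (n.-tuple R) -> \bar R} :=
  mkcomp_noparam drawM drawV.

HB.instance Definition _ := Kernel.on gibbs.

Let gibbs1 V : gibbs V setT = 1%E.
Proof.
rewrite /gibbs /mkcomp_noparam /= /kcomp_noparam.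
under eq_integral do rewrite prob_kernel.
by rewrite integral_cst// mul1e prob_kernel.
Qed.

HB.instance Definition _ := Kernel_isProbability.Build _ _ _ _ _ gibbs gibbs1.

(* The rows of kermx A^T span Null(A), so that the columns of U form an
   orthonormal basis of Null(A). *)
Definition null_small : Prop :=
  \rank (kermx A^T) = 0%N \/
  exists U : 'M[R]_(n, \rank (kermx A^T)),
    let G := U^T *m K^T *m K *m U in
    let z := U^T *m K^T *m const_mx 1 : 'cV[R]__ in
    [/\ U^T *m U = 1%:M, (U^T == kermx A^T)%MS &
      `|mu| / Num.sqrt (sigma ^+ 2 * a + mu ^+ 2) *
        Num.sqrt ((z^T *m invmx G *m z) ord0 ord0) < 1].

End model.

Section geometric_ergodicity.
Context d (T : measurableType d) (R : realType).
Local Open Scope ereal_scope.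

(* total variation distance, with the sup normalization (half of the total
   mass of the variation of the difference) *)
Definition tv_dist (m1 m2 : set T -> \bar R) : \bar R :=
  ereal_sup [set `|m1 A - m2 A| | A in measurable].

Fixpoint kiter (P : T -> {measure set T -> \bar R}) (t : nat) (x : T)
    (A : set T) : \bar R :=
  if t is t'.+1 then \int[P x]_y kiter P t' y A else \d_x A.

(* the distribution nu P^t of the chain at time t *)
Definition law_at (P : T -> {measure set T -> \bar R})
    (nu : {measure set T -> \bar R}) (t : nat) (A : set T) : \bar R :=
  \int[nu]_x kiter P t x A.

Local Open Scope charge_scope.

Definition geometrically_ergodic (P : R.-pker T ~> T) (pi : probability T R) :=
  exists2 gamma : R, (0 < gamma < 1)%R &
    forall nu : probability T R, nu `<< pi ->
      Lnorm pi 2%:E ('d (charge_of_finite_measure nu) '/d pi) < +oo ->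
      exists C : R, forall t : nat,
        tv_dist (law_at P nu t) pi <= (C * gamma ^+ t)%:E.

End geometric_ergodicity.

(* Main.v *)
(** The chain V -> M -> V is studied through the two Gibbs kernels.  With
    g(M) = sum_i f(M_i) for a suitable f : R -> [0, +oo], the two steps together
    satisfy a drift condition E[g(M') | M] <= lam g(M) + L, and the draws of V
    from {g <= S} have a common minorizing measure.  A Hairer-Mattingly
    contraction turns this into a geometric rate, and a Radon-Nikodym estimate
    transfers it to starting laws with square integrable density.

    Given V, each M_i is Gaussian with variance at most sigma^2 V_i, while the
    mean (barQ V)^-1 barm is, up to a bounded vector, mu (barQ V)^-1 1, whose
    l^1 norm is at most |mu| sum_i V_i.  Given M, V_i is GIG with b-parameter
    d = b + M_i^2 / sigma^2, whose moments are asymptotically explicit in d.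
    The choices are f(t) = |t| if a > 0 and either b > 0 or p > 1/2,
    f(t) = |t| + |t|^-p if b = 0 and p <= 1/2, f(t) = |t|^(2u) with
    u = min(1/2, -p/2) if a = mu = 0, and f(t) = t^2 if a = 0 and mu <> 0.  In the
    second and third case lam < 1 is the strict log-convexity of the moments of
    the inverse gamma laws; in the last one it is the null-smallness assumption,
    which bounds the l^2 norm of (barQ V)^-1 1. *)
Require Import Defs.
From HB Require Import structures.
From mathcomp Require Import all_boot all_order all_algebra.
From mathcomp Require Import all_classical all_reals all_analysis.
From mathcomp Require Import measurable_realfun ring lra.

Set Implicit Arguments.
Unset Strict Implicit.
Unset Printing Implicit Defensive.

Import Order.TTheory GRing.Theory Num.Theory.
Import numFieldNormedType.Exports.

Local Open Scope classical_set_scope.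
Local Open Scope ring_scope.

(** * Contraction of a two-stage Markov chain *)

(** The function [f] answers to two demands: its sublevel sets must keep the GIG parameters given M
    in one admissible range, and the two steps must multiply [f] by less than 1. Write c = a + mu^2
    / sigma^2. If c > 0, a draw of V_i has size about sqrt(d/c), that is |M_i| / sqrt(sigma^2 c),
    and the next mean is at most |mu| times the sum of these. As sigma^2 c = sigma^2 a + mu^2, the
    l^1 ratio is below 1 when a > 0 and equals 1 when a = 0 and mu <> 0, whence the l^2 refinement
    there. If a = mu = 0, then c = 0: inverse gamma moments exist only below order 1/2 - p, so a
    fractional power is taken. If b = 0 and p <= 1/2, the parameter d = 0 is inadmissible: [f] must
    blow up at 0 and is +oo there, so the ergodic argument allows infinite values. No Gamma or
    Bessel value, nor the determinant of the precision matrix, is computed: laws are found up to a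
    factor, fixed by testing against 1, and z = x^(-1/2) turns Gaussian moments into inverse gamma
    masses, so that the sharp rates compare values of one function. *)

Lemma pairwise_center {R : realType} {T : Type} (D : set T) (F G : T -> R) :
  (forall x, D x -> 0 <= F x) -> (forall x, D x -> 0 <= G x) ->
  (forall x y, D x -> D y -> F x - F y <= G x + G y) ->
  exists2 c, 0 <= c & forall x, D x -> `|F x - c| <= G x.
Proof.
move=> F0 G0 FG; have [D0|/set0P[x0 Dx0]] := eqVneq D set0.
  by exists 0 => // x; rewrite D0.
(* The hypothesis puts every [F x - G x] below every [F y + G y]; the center separates the two
   families. Taking the positive part keeps [c] nonnegative, as [minorized_gap] requires, and does
   no harm since [F + G >= 0]. *)
pose S := [set F x - G x | x in D].
have ubS y : D y -> ubound S (F y + G y).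
  by move=> Dy _ [x Dx <-]; have := FG x y Dx Dy; lra.
have supS : has_sup S.
  by split; [exists (F x0 - G x0), x0|exists (F x0 + G x0); exact: ubS].
have supge x : D x -> F x - G x <= sup S.
  by move=> Dx; apply: ub_le_sup; [exact: supS.2|exists x].
have suple x : D x -> sup S <= F x + G x.
  by move=> Dx; apply: ge_sup; [exact: supS.1|exact: ubS].
exists (Num.max (sup S) 0); first by rewrite le_max lexx orbT.
move=> x Dx; rewrite ler_norml; apply/andP; split.
  have : Num.max (sup S) 0 <= F x + G x.
    by rewrite ge_max suple//= addr_ge0 ?F0 ?G0.
  by lra.
have : F x - G x <= Num.max (sup S) 0 by rewrite le_max supge.
by lra.
Qed.

Lemma integral_prob_cst d (T : measurableType d) (R : realType)
  (P : {measure set T -> \bar R}) (r : \bar R) : P setT = 1%E -> (\int[P]_x r = r)%E.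
Proof. by move=> P1; rewrite (integral_cst P measurableT r) P1 mule1. Qed.

Section harris_step.
Context d (T : measurableType d) (R : realType).
Local Open Scope ereal_scope.

(* Both sides are kept additive: [K u - (phi - c)] and [K u + (phi - c)] are
   nonnegative, so the minorization applies to them directly and no residual
   measure has to be formed. *)
Lemma minorized_gap (P Q eta : {measure set T -> \bar R}) (eps K c : R)
    (u : T -> \bar R) (phi : T -> R) :
  P setT = 1 -> Q setT = 1 -> eta setT = 1 ->
  (0 <= eps)%R -> (0 <= K)%R -> (0 <= c)%R ->
  (forall A, measurable A -> eps%:E * eta A <= P A) ->
  (forall A, measurable A -> eps%:E * eta A <= Q A) ->
  (forall x, 1 <= u x) -> measurable_fun setT u ->
  \int[P]_x u x < +oo -> \int[Q]_x u x < +oo ->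
  (forall x, 0 <= phi x)%R -> measurable_fun setT phi ->
  (forall x, `|phi x - c|%:E <= K%:E * u x) ->
  (2 * eps * K)%:E + \int[P]_x (phi x)%:E <=
  \int[Q]_x (phi x)%:E + K%:E * (\int[P]_x u x + \int[Q]_x u x).
Proof.
move=> P1 Q1 eta1 eps0 K0 c0 etaP etaQ u1 mu uPoo uQoo phi0 mphi phic.
have u0 x : 0 <= u x by exact: le_trans (u1 x).
have Ku0 x : 0 <= K%:E * u x by rewrite mule_ge0 ?lee_fin.
have mKu : measurable_fun setT (fun x => K%:E * u x) by exact: measurable_funeM.
have mphiE : measurable_fun setT (EFin \o phi) by exact/measurable_EFinP.
pose f1 x := K%:E * u x + (c - phi x)%:E.
pose f2 x := K%:E * u x + (phi x - c)%:E.
have f10 x : 0 <= f1 x.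
  have := phic x; rewrite /f1; move: (K%:E * u x) (Ku0 x) => [r| |]//= _.
  by rewrite !lee_fin ler_norml; lra.
have f20 x : 0 <= f2 x.
  have := phic x; rewrite /f2; move: (K%:E * u x) (Ku0 x) => [r| |]//= _.
  by rewrite !lee_fin ler_norml; lra.
have mf1 : measurable_fun setT f1.
  apply: emeasurable_funD => //; apply/measurable_EFinP.
  exact: measurable_funB.
have mf2 : measurable_fun setT f2.
  apply: emeasurable_funD => //; apply/measurable_EFinP.
  exact: measurable_funB.
have dom (S : {measure set T -> \bar R}) f : (forall A, measurable A -> eps%:E * eta A <= S A) ->
    (forall x, 0 <= f x) -> measurable_fun setT f ->
    eps%:E * \int[eta]_x f x <= \int[S]_x f x.
  move=> etaS f0 mf; rewrite -(ge0_integral_mscale eta measurableT (NngNum eps0))//.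
  exact: ge0_le_measure_integral.
have Ef1 : \int[P]_x f1 x + \int[P]_x (phi x)%:E = K%:E * \int[P]_x u x + c%:E.
  rewrite -ge0_integralD//; last by move=> x _; rewrite lee_fin.
  under eq_integral do rewrite /f1 -addeA -EFinD subrK.
  rewrite ge0_integralD//.
  by rewrite ge0_integralZl// integral_prob_cst.
have Ef2 : \int[Q]_x f2 x + c%:E = K%:E * \int[Q]_x u x + \int[Q]_x (phi x)%:E.
  rewrite -(integral_prob_cst c%:E Q1).
  rewrite -ge0_integralD//.
  under eq_integral do rewrite /f2 -addeA -EFinD subrK.
  rewrite ge0_integralD//; last by move=> x _; rewrite lee_fin.
  by rewrite ge0_integralZl.
(* Against the common part [eta] the deviations [phi - c] cancel in [f1 + f2], which equals [2 K u]
   and hence is at least [2 K]. *)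
have low : (2 * eps * K)%:E <= \int[P]_x f1 x + \int[Q]_x f2 x.
  apply: (le_trans _ (leeD (dom P f1 etaP f10 mf1) (dom Q f2 etaQ f20 mf2))).
  rewrite -ge0_muleDr ?integral_ge0// -ge0_integralD//.
  under eq_integral => x _.
    rewrite (_ : f1 x + f2 x = K%:E * u x + K%:E * u x); last first.
      rewrite /f1 /f2; move: (K%:E * u x) (Ku0 x) => [r| |]//= _.
      by rewrite -!EFinD; congr EFin; lra.
    over.
  rewrite -mulrA mulrCA EFinM lee_wpmul2l ?lee_fin//.
  rewrite -(integral_prob_cst (2 * K)%:E eta1).
  apply: ge0_le_integral => //.
  - by move=> x _ /=; rewrite lee_fin mulr_ge0.
  - exact: emeasurable_funD.
  move=> x _; rewrite (_ : (2 * K)%:E = K%:E + K%:E); last by rewrite -EFinD mulr_natl.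
  have Ku1 : K%:E <= K%:E * u x by rewrite -[leLHS]mule1 lee_wpmul2l ?lee_fin.
  exact: leeD.
have fphi (S : {measure set T -> \bar R}) : S setT = 1 -> \int[S]_x u x < +oo -> \int[S]_x (phi x)%:E < +oo.
  move=> S1 Soo; apply: (@le_lt_trans _ _ (\int[S]_x (K%:E * u x + c%:E))).
    apply: ge0_le_integral => //.
    - by move=> x _; rewrite lee_fin.
    - exact: emeasurable_funD.
    move=> x _; have := phic x; move: (K%:E * u x) (Ku0 x) => [r| |]//= _.
      by rewrite !lee_fin ler_norml; lra.
    by move=> _; rewrite addye// leey.
  rewrite ge0_integralD// ge0_integralZl// integral_prob_cst//.
  by rewrite lte_add_pinfty ?ltry// lte_mul_pinfty// lee_fin.
have fint (m : {measure set T -> \bar R}) f : (forall x, 0 <= f x) -> \int[m]_x f x < +oo ->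
    \int[m]_x f x \is a fin_num.
  by move=> f0 foo; rewrite ge0_fin_numE// integral_ge0.
move: low Ef1 Ef2 (fint P _ u0 uPoo) (fint Q _ u0 uQoo).
move: (fint P (EFin \o phi) phi0 (fphi _ P1 uPoo)) (fint Q (EFin \o phi) phi0 (fphi _ Q1 uQoo)) => /=.
case: (\int[P]_x u x) => [uP| |]//; case: (\int[Q]_x u x) => [uQ| |]//.
case: (\int[P]_x (phi x)%:E) => [a| |]//; case: (\int[Q]_x (phi x)%:E) => [b| |]//.
case: (\int[P]_x f1 x) => [i1| |]//; case: (\int[Q]_x f2 x) => [i2| |]// _ _.
rewrite -!(EFinD, EFinM) !lee_fin => low [E1] [E2] _ _; lra.
Qed.
End harris_step.

(** * Contraction of the iterated kernel in a weighted seminorm *)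

Section harris.
Context d (T : measurableType d) (R : realType) (P : R.-pker T ~> T).
Local Open Scope ereal_scope.

Lemma kiter_ge0 t x A : 0 <= kiter P t x A.
Proof. by elim: t x => [|t IH] x //=; exact: integral_ge0. Qed.

Lemma measurable_kiter t A : measurable A -> measurable_fun setT (kiter P t ^~ A).
Proof.
move=> mA; elim: t => [|t IH] /=.
  by apply/measurable_EFinP; exact: measurable_indic.
apply: measurable_fun_integral_kernel => //.
- by move=> U mU; exact: measurable_kernel.
- by move=> x; exact: kiter_ge0.
Qed.

Lemma kiter_le1 t x A : measurable A -> kiter P t x A <= 1.
Proof.
move=> mA; elim: t x => [|t IH] x /=.
  by rewrite /dirac lee_fin indicE; case: (_ \in _).
rewrite -(integral_prob_cst 1 (prob_kernel (s := P) x)).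
apply: ge0_le_integral => //; first by move=> y _; exact: kiter_ge0.
by move=> _; exact: measurable_kiter.
Qed.

Lemma kiter_fin t x A : measurable A -> kiter P t x A \is a fin_num.
Proof.
move=> mA; rewrite ge0_fin_numE ?kiter_ge0//.
by rewrite (le_lt_trans (kiter_le1 t x mA))// ltry.
Qed.

Variables (W : T -> \bar R) (lam L : R).
Hypotheses (W0 : forall x, 0 <= W x) (mW : measurable_fun setT W).
Hypotheses (lam0 : (0 <= lam)%R) (lam1 : (lam < 1)%R) (L0 : (0 <= L)%R).
Hypothesis drift : forall x, \int[P x]_y W y <= lam%:E * W x + L%:E.
Hypothesis minor : forall S : R, (0 <= S)%R -> exists (eps : R)
  (eta : {measure set T -> \bar R}), [/\ (0 < eps)%R, eta setT = 1 &
  forall x A, measurable A -> W x <= S%:E -> eps%:E * eta A <= P x A].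

(** The Hairer-Mattingly argument for the functions [kiter P t ^~ A]: if [W x + W y] exceeds a level
    [S], the drift alone shrinks the weighted gap between the values at [x] and [y]; below that
    level the minorization does. The pairwise bound is turned back into a centered one by
    [pairwise_center], so the induction carries a center [c] rather than a stationary value. *)
Lemma harris_contraction : exists gam beta : R,
  [/\ (0 < gam < 1)%R, (0 <= beta)%R & forall t A, measurable A -> exists2 c : R, (0 <= c)%R &
    forall x, `|fine (kiter P t x A) - c|%:E <=
              (gam ^+ t)%:E * (1 + beta%:E * W x)].
Proof.
(* Above this level, half of the factor [1 - lam] already gains [beta (2 L + 1)], which is [beta]
   more than the loss [2 beta L]. *)
pose S := ((2 * L + 1) * 2 / (1 - lam))%R.
have [l0 l1 L0'] := And3 lam0 lam1 L0.
have S0 : (0 <= S)%R by apply: divr_ge0; lra.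
have SE : (S * (1 - lam) = (2 * L + 1) * 2)%R by rewrite /S divfK//; lra.
have [eps [eta [eps0 eta1 etaP]]] := minor S0.
(* Small enough that the loss [2 beta L] uses at most half of the gain [2 eps] from the
   minorization. *)
pose beta : R := (Num.min eps 1 / (2 * (L + 1)))%R.
have beta0 : (0 < beta)%R.
  by rewrite divr_gt0 ?lt_min ?eps0 ?ltr01 ?mulr_gt0//; lra.
have betaL : (beta * L <= eps / 2)%R.
  have : (beta * (2 * (L + 1)) <= eps)%R.
    by rewrite /beta divfK ?ge_min ?lexx//; lra.
  by nra.
(* [2 del] fits in the surplus [beta] of the drift case and in the surplus [eps] of the minorization
   case; by the third bound, the other half of [1 - lam] absorbs [del] times the terms in [W]. *)
pose del : R := Num.min (Num.min (beta / 2) (eps / 2))%R ((1 - lam) / 2)%R.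
have [d0 d1 d2 d3] : [/\ 0 < del, del <= beta / 2, del <= eps / 2
    & del <= (1 - lam) / 2]%R.
  rewrite /del !lt_min !ge_min !lexx !orbT /=; split => //.
  by apply/andP; split; [apply/andP; split|]; lra.
pose gam : R := (1 - del)%R.
have gam01 : (0 < gam < 1)%R by rewrite /gam; lra.
exists gam, beta; split => //; first exact: ltW.
move=> t A mA; elim: t => [|t [c c0 IH]].
  exists 0%R => // x; rewrite subr0 expr0 mul1e.
  apply: (@le_trans _ _ 1).
    rewrite lee_fin /= /dirac/= indicE.
    by case: (_ \in _); rewrite ?normr1 ?normr0.
  by rewrite leeDl// mule_ge0// lee_fin ltW.
pose u x := 1 + beta%:E * W x.
have bW0 x : 0 <= beta%:E * W x by rewrite mule_ge0// lee_fin ltW.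
have u1 x : 1 <= u x by rewrite leeDl.
have mu : measurable_fun setT u.
  by apply: emeasurable_funD => //; exact: measurable_funeM.
pose D := [set x | W x < +oo].
pose K : R := (gam ^+ t)%R.
have K0 : (0 < K)%R by rewrite exprn_gt0//; case/andP: gam01.
pose phi x := fine (kiter P t x A).
have phiE x : (phi x)%:E = kiter P t x A by rewrite /phi fineK// kiter_fin.
have phi0 x : (0 <= phi x)%R by rewrite -lee_fin phiE kiter_ge0.
have mphi : measurable_fun setT phi.
  apply/measurable_EFinP; rewrite (_ : _ \o _ = kiter P t ^~ A).
    exact: measurable_kiter.
  by apply/funext => x /=; rewrite phiE.
have Pphi x : \int[P x]_y (phi y)%:E = (fine (kiter P t.+1 x A))%:E.
  rewrite fineK ?kiter_fin//=; apply: eq_integral => y _; exact: phiE.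
have Pu x : \int[P x]_y u y = 1 + beta%:E * \int[P x]_y W y.
  rewrite ge0_integralD//; last exact: measurable_funeM.
  by rewrite integral_prob_cst ?prob_kernel// ge0_integralZl// lee_fin ltW.
have Wfin x : D x -> W x \is a fin_num by move=> Dx; rewrite ge0_fin_numE.
have PWfin x : D x -> \int[P x]_y W y \is a fin_num.
  move=> Dx; rewrite ge0_fin_numE ?integral_ge0// (le_lt_trans (drift x))//.
  by rewrite lte_add_pinfty ?ltry// lte_mul_pinfty// lee_fin.
have Pufin x : D x -> \int[P x]_y u y < +oo.
  move=> Dx; rewrite Pu lte_add_pinfty ?ltry// lte_mul_pinfty//.
    by rewrite lee_fin ltW.
  by rewrite -ge0_fin_numE ?PWfin// integral_ge0.
have gap x y : D x -> D y ->
    (fine (kiter P t.+1 x A) - fine (kiter P t.+1 y A) <=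
    gam * K * (1 + beta * fine (W x)) + gam * K * (1 + beta * fine (W y)))%R.
  move=> Dx Dy.
  (* [e = eps] serves the minorized case and [e = 0] the pure drift case. *)
  have base e : (0 <= e)%R ->
      (forall A, measurable A -> e%:E * eta A <= P x A) ->
      (forall A, measurable A -> e%:E * eta A <= P y A) ->
      (2 * e * K + fine (kiter P t.+1 x A) <= fine (kiter P t.+1 y A) +
      K * (2 + beta * (lam * (fine (W x) + fine (W y)) + 2 * L)))%R.
    move=> e0 ex ey.
    have := minorized_gap (prob_kernel x) (prob_kernel y) eta1 e0 (ltW K0) c0
      ex ey u1 mu (Pufin x Dx) (Pufin y Dy) phi0 mphi IH.
    rewrite !Pphi !Pu; move: (drift x) (drift y).
    move: (Wfin x Dx) (Wfin y Dy) (PWfin x Dx) (PWfin y Dy).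
    case: (W x) => [wx| |]//; case: (W y) => [wy| |]//.
    case: (\int[P x]_y W y) => [px| |]//; case: (\int[P y]_y W y) => [py| |]//.
    move=> _ _ _ _; rewrite -!(EFinD, EFinM) !lee_fin /= => hx hy h.
    apply: (le_trans h); rewrite lerD2l; apply: ler_wpM2l; first exact: ltW.
    have : (beta * (px + py) <= beta * (lam * (wx + wy) + 2 * L))%R.
      by apply: ler_wpM2l; [exact: ltW|lra].
    by lra.
  set wx := fine (W x); set wy := fine (W y).
  have wx0 : (0 <= wx)%R by rewrite fine_ge0.
  have wy0 : (0 <= wy)%R by rewrite fine_ge0.
  have [sS|Ss] := leP (wx + wy)%R S.
    have Wle z : D z -> (fine (W z) <= S)%R -> W z <= S%:E.
      by move=> Dz; rewrite -lee_fin fineK ?Wfin.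
    have := base eps (ltW eps0) (fun A mA => etaP x A mA (Wle x Dx _))
      (fun A mA => etaP y A mA (Wle y Dy _)).
    rewrite -/wx -/wy => /(_ ltac:(lra) ltac:(lra)) h.
    suff : (2 + beta * (lam * (wx + wy) + 2 * L) - 2 * eps <=
        gam * (2 + beta * (wx + wy)))%R.
      by move=> /(ler_wpM2l (ltW K0)); lra.
    have bs : (0 <= beta * (wx + wy))%R by rewrite mulr_ge0 ?addr_ge0// (ltW beta0).
    have : (lam * (beta * (wx + wy)) <= gam * (beta * (wx + wy)))%R.
      by rewrite ler_wpM2r// /gam; lra.
    by rewrite /gam; lra.
  have dom0 z B : measurable B -> 0%:E * eta B <= P z B by rewrite mul0e.
  have := base 0%R (lexx _) (dom0 x) (dom0 y).
  rewrite -/wx -/wy mulr0 mul0r add0r => h.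
  suff : (2 + beta * (lam * (wx + wy) + 2 * L) <=
      gam * (2 + beta * (wx + wy)))%R.
    by move=> /(ler_wpM2l (ltW K0)); lra.
  have : (beta * (S * (1 - lam) / 2) <= beta * ((wx + wy) * (1 - lam) / 2))%R.
    by rewrite ler_wpM2l ?(ltW beta0)// ler_wpM2r// ler_wpM2r ?(ltW Ss)//; lra.
  have bs : (0 <= beta * (wx + wy))%R by rewrite mulr_ge0 ?addr_ge0// (ltW beta0).
  have : ((1 + lam) / 2 * (beta * (wx + wy)) <= gam * (beta * (wx + wy)))%R.
    by rewrite ler_wpM2r// /gam; lra.
  by rewrite SE /gam; lra.
have [||c' c'0 c'P] := pairwise_center _ _ gap.
- by move=> x _; rewrite fine_ge0// kiter_ge0.
- move=> x _; case/andP: gam01 => g0 _.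
  by rewrite !mulr_ge0 ?(ltW g0) ?(ltW K0)// addr_ge0// mulr_ge0 ?(ltW beta0)// fine_ge0.
exists c' => // x; have [Dx|] := pselect (D x).
  apply: le_trans (_ : _ <= (gam * K * (1 + beta * fine (W x)))%:E) _.
    by rewrite lee_fin c'P.
  by rewrite exprS EFinM EFinD (EFinM beta) fineK ?Wfin.
(* Where [W] is infinite, so is the right-hand side. *)
move=> /negP; rewrite -leNgt leye_eq => /eqP ->.
rewrite gt0_muley ?lte_fin// addey// gt0_muley ?leey// lte_fin.
by rewrite exprn_gt0//; case/andP: gam01.
Qed.
End harris.

Section kernel_integrals.
Context d d' d'' (X : measurableType d) (Y : measurableType d')
  (Z : measurableType d'') (R : realType).
Local Open Scope ereal_scope.

Lemma integral_mkcomp_noparam (k1 : R.-pker X ~> Y) (k2 : R.-pker Y ~> Z) x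
    (f : Z -> \bar R) : (forall z, 0 <= f z) -> measurable_fun setT f ->
  \int[mkcomp_noparam k1 k2 x]_z f z = \int[k1 x]_y \int[k2 y]_z f z.
Proof.
move=> f0 mf.
rewrite -(integral_kcomp k1 (kernel.kernel_snd k2 : R.-sfker (X * Y) ~> Z) x f0 mf).
exact: eq_measure_integral.
Qed.

Lemma integral_mixture (m : probability Y R) (k : R.-pker Y ~> Z)
    (nu : {measure set Z -> \bar R}) :
  (forall A, measurable A -> \int[m]_y k y A = nu A) ->
  forall f : Z -> \bar R, (forall z, 0 <= f z) -> measurable_fun setT f ->
  \int[m]_y \int[k y]_z f z = \int[nu]_z f z.
Proof.
move=> mk f f0 mf.
(* [m] becomes a constant kernel from [unit], so that the mixture is a composition of kernels. *)
pose l := kprobability (measurable_cst (m : pprobability Y R) : measurable_fun [set: unit] _).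
rewrite (eq_measure_integral (kcomp l (kernel.kernel_snd k : R.-sfker (unit * Y) ~> Z) tt)).
  by rewrite (integral_kcomp l).
by move=> A mA _; rewrite -mk.
Qed.

End kernel_integrals.

(** * Integrability of the drift function under the stationary law *)

Section stationary.
Context d (T : measurableType d) (R : realType) (P : R.-pker T ~> T)
  (pi : probability T R).
Local Open Scope ereal_scope.
Hypothesis inv : forall A, measurable A -> \int[pi]_x P x A = pi A.

Lemma stationary_kiter t A : measurable A -> \int[pi]_x kiter P t x A = pi A.
Proof.
move=> mA; elim: t => [|t IH] /=.
  by rewrite integral_indic// setIT.
rewrite (integral_mixture (nu := pi) inv (f := fun y => kiter P t y A))//.
  by move=> y; exact: kiter_ge0.
exact: measurable_kiter.
Qed.

(** Integrating the drift inequality bounds [1 - lam] times the integral of [W] by [L], but only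
    once that integral is known to be finite. The inequality is therefore truncated: [D N] bounds
    the image under [P] of [tr N = min(W, N)], invariance compares the integrals of [tr N] and
    [D N], and the latter, being finite, cancels. What remains bounds [V N], which increases to [W]
    where [W] is finite. *)
Lemma stationary_drift_lty (W : T -> \bar R) (lam L : R) :
  (forall x, 0 <= W x) -> measurable_fun setT W ->
  (0 <= lam)%R -> (lam < 1)%R -> (0 <= L)%R ->
  (forall x, \int[P x]_y W y <= lam%:E * W x + L%:E) ->
  {ae pi, forall x, W x < +oo} -> \int[pi]_x W x < +oo.
Proof.
move=> W0 mW l0 l1 L0 drift Wfin.
pose tr (N : nat) x := mine (W x) N%:R%:E.
pose V (N : nat) x := if W x <= N%:R%:E then W x else 0.
have N0 N : 0 <= (N%:R : R)%:E by rewrite lee_fin.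
have tr0 N x : 0 <= tr N x by rewrite /tr le_min W0 N0.
have V0 N x : 0 <= V N x by rewrite /V; case: ifP.
have mtr N : measurable_fun setT (tr N) by exact: measurable_mine.
have mV N : measurable_fun setT (V N).
  apply: measurable_fun_ifT => //.
  by apply: measurable_fun_lee => //; exact: measurable_cst.
pose D N x := mine (lam%:E * W x + L%:E) N%:R%:E.
have D0 N x : 0 <= D N x.
  by rewrite /D le_min N0 andbT adde_ge0 ?mule_ge0// lee_fin.
have mD N : measurable_fun setT (D N).
  by apply: measurable_mine => //; apply: emeasurable_funD => //; exact: measurable_funeM.
have Ptr N x : \int[P x]_y tr N y <= D N x.
  rewrite /D le_min; apply/andP; split.
    apply: le_trans (drift x); apply: ge0_le_integral => //.
    by move=> y _; rewrite /tr ge_min lexx.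
  rewrite -(integral_prob_cst (N%:R%:E) (prob_kernel (s := P) x)).
  by apply: ge0_le_integral => // y _; rewrite /tr ge_min lexx orbT.
(* If [W x > N], then [tr N x = N] and [V N x = 0]; otherwise [lam W + L] and [(1 - lam) W] add up
   to [W + L]. *)
have pt N x : D N x + (1 - lam)%:E * V N x <= tr N x + L%:E.
  rewrite /D /V /tr; case: ifPn => WN.
    rewrite (min_l WN); apply: (@le_trans _ _ (lam%:E * W x + L%:E + (1 - lam)%:E * W x)).
      by apply: leeD => //; rewrite ge_min lexx.
    have : W x \is a fin_num by rewrite ge0_fin_numE// (le_lt_trans WN)// ltry.
    by case: (W x) => [w| |]// _; rewrite -!(EFinD, EFinM) lee_fin; lra.
  have NW : N%:R%:E <= W x by rewrite ltW// ltNge.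
  rewrite mule0 adde0 (min_r NW).
  by rewrite (@le_trans _ _ N%:R%:E) ?ge_min ?lexx ?orbT// leeDl// lee_fin.
have VL N : (1 - lam)%:E * \int[pi]_x V N x <= L%:E.
  have fin g : (forall x, 0 <= g x) -> (forall x, g x <= N%:R%:E) ->
      measurable_fun setT g -> \int[pi]_x g x \is a fin_num.
    move=> g0 gN mg; rewrite ge0_fin_numE ?integral_ge0//.
    apply: (@le_lt_trans _ _ (\int[pi]_x N%:R%:E)); last first.
      by rewrite (integral_prob_cst _ (probability_setT pi)) ltry.
    by apply: ge0_le_integral => //; exact: measurable_cst.
  have Dfin : \int[pi]_x D N x \is a fin_num.
    by apply: fin => // x; rewrite /D ge_min lexx orbT.
  rewrite -(leeD2lE _ _ Dfin) -ge0_integralZl//; last by rewrite lee_fin; lra.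
  rewrite -ge0_integralD//; last 2 first.
  - by move=> x _; rewrite mule_ge0// lee_fin; lra.
  - exact: measurable_funeM.
  apply: (@le_trans _ _ (\int[pi]_x (tr N x + L%:E))).
    apply: ge0_le_integral => //.
    - by move=> x _; rewrite adde_ge0// mule_ge0// lee_fin; lra.
    - by apply: emeasurable_funD => //; exact: measurable_funeM.
    - exact: emeasurable_funD.
  rewrite ge0_integralD// (integral_prob_cst _ (probability_setT pi)).
  rewrite leeD2r// -(integral_mixture inv)//; apply: ge0_le_integral => //.
  - by move=> x _; apply: integral_ge0.
  - apply: measurable_fun_integral_kernel => //.
    by move=> U mU; exact: measurable_kernel.
have lim1 : {ae pi, forall x, setT x -> W x = limn (V ^~ x)}.
  case: Wfin => S [mS S0 Ssub]; exists S; split => // x /= Wx; apply: Ssub => /= Wxoo; apply: Wx => _.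
  apply/esym/cvg_lim => //; apply: cvg_near_cst.
  have [w Ww] : exists w, W x = w%:E.
    by exists (fine (W x)); rewrite fineK// ge0_fin_numE.
  near=> j; rewrite /V Ww lee_fin ifT//.
  by near: j; exact: nbhs_infty_ger.
have ndV x : {homo V ^~ x : n m / (n <= m)%N >-> n <= m}.
  move=> i j ij; rewrite /V; case: ifPn => [Wi|_]; last exact: V0.
  by rewrite ifT// (le_trans Wi)// lee_fin ler_nat.
have cvV x : cvgn (V ^~ x) by exact: ereal_nondecreasing_is_cvgn.
have -> : \int[pi]_x W x = \int[pi]_x limn (V ^~ x).
  apply: ge0_ae_eq_integral => //.
  - by apply: (emeasurable_fun_cvg V) => // x _; exact: cvV.
  - by move=> x _; apply: lime_ge => //; exact: nearW.
rewrite monotone_convergence//.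
apply: (@le_lt_trans _ _ (L / (1 - lam))%:E); last exact: ltry.
apply: lime_le.
  apply: ereal_nondecreasing_is_cvgn => i j ij; apply: ge0_le_integral => // x _.
  exact: ndV.
near=> j; rewrite -(@lee_pmul2l _ (1 - lam)%:E)//; last by rewrite lte_fin; lra.
by rewrite -EFinM mulrC divfK ?VL//; lra.
Unshelve. all: by end_near. Qed.

End stationary.

(** * From the weighted contraction to starting laws with square integrable density *)

Section ergodicity.
Context d (T : measurableType d) (R : realType).
Local Open Scope ereal_scope.
Local Open Scope charge_scope.

(** The hypothesis speaks of the derivative of a signed measure, whereas integration uses a version
    that is nonnegative and finite everywhere; the two agree almost everywhere, so the second
    inherits the finite second moment. *)
Lemma L2_density_sqr_lty (pi nu : probability T R) : nu `<< pi ->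
  Lnorm pi 2%:E ('d (charge_of_finite_measure nu) '/d pi) < +oo ->
  exists f : T -> R, [/\ (forall x, 0 <= f x)%R, measurable_fun setT f,
    \int[pi]_x (f x ^+ 2)%:E < +oo &
    forall g : T -> R, (forall x, 0 <= g x)%R -> measurable_fun setT g ->
      \int[nu]_x (g x)%:E = \int[pi]_x (g x * f x)%:E].
Proof.
move=> nupi L2; pose f1 := 'd (charge_of_finite_measure nu) '/d pi.
pose f := Radon_Nikodym_SigmaFinite.f nu pi.
have mf : measurable_fun setT f.
  exact: measurable_int (Radon_Nikodym_SigmaFinite.f_integrable nupi).
have mf1 : measurable_fun setT f1 by apply: measurable_int; exact: Radon_Nikodym_integrable.
have f0 x : 0 <= f x by exact: Radon_Nikodym_SigmaFinite.f_ge0.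
have ffin x : f x \is a fin_num by exact: Radon_Nikodym_SigmaFinite.f_fin_num.
have mfr : measurable_fun setT (fine \o f).
  by apply: measurableT_comp => //; exact: measurable_fine.
exists (fine \o f); split => //.
- by move=> x /=; rewrite fine_ge0.
- have mf1r : measurable_fun setT (fine \o f1).
    by apply: measurableT_comp => //; exact: measurable_fine.
  have -> : \int[pi]_x ((fine \o f) x ^+ 2)%:E = \int[pi]_x `|f1 x| `^ 2%R.
    transitivity (\int[pi]_x ((fine \o f1) x ^+ 2)%:E).
      apply: ge0_ae_eq_integral => //.
      + by apply/measurable_EFinP; exact: measurable_funX.
      + by apply/measurable_EFinP; exact: measurable_funX.
      + by move=> x _; rewrite lee_fin sqr_ge0.
      + by move=> x _; rewrite lee_fin sqr_ge0.
      + have [S [mS S0 Ssub]] := ae_eq_Radon_Nikodym_SigmaFinite nupi measurableT.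
        exists S; split => // x /= neq; apply: Ssub => /= eqf; apply: neq => _.
        by rewrite /f eqf.
    apply: eq_integral => x _ /=; have : f1 x \is a fin_num by exact: Radon_Nikodym_fin_num.
    case: (f1 x) => [r| |]//= _.
    by rewrite powR_mulrn ?normr_ge0// real_normK// num_real.
  have n20 : (2%R : R) != 0%R by [].
  by have := poweR_Lnorm pi f1 n20 => /= <-; exact: poweR_lty.
- move=> g g0 mg.
  have mgE : measurable_fun setT (EFin \o g) by exact/measurable_EFinP.
  have := Radon_Nikodym_SigmaFinite.change_of_variables nupi (f := EFin \o g) g0 measurableT mgE.
  move=> /= <-.
  by apply: eq_integral => x _; rewrite EFinM /= fineK.
Qed.

Variables (P : R.-pker T ~> T) (pi : probability T R).
Hypothesis inv : forall A, measurable A -> \int[pi]_x P x A = pi A.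
Variables (W : T -> \bar R) (gam beta : R).
Hypotheses (W0 : forall x, 0 <= W x) (mW : measurable_fun setT W).
Hypotheses (gam01 : (0 < gam < 1)%R) (beta0 : (0 <= beta)%R).
Hypothesis contr : forall t A, measurable A -> exists2 c : R, (0 <= c)%R &
    forall x, `|fine (kiter P t x A) - c|%:E <=
              (gam ^+ t)%:E * (1 + beta%:E * W x).
Hypothesis Wint : \int[pi]_x W x < +oo.

Let prob_int_fin (m : probability T R) (h : T -> R) : measurable_fun setT h ->
  (forall x, 0 <= h x <= 1)%R -> \int[m]_x (h x)%:E \is a fin_num.
Proof.
move=> mh h01; have h0 x : (0 <= h x)%R by case/andP: (h01 x).
rewrite ge0_fin_numE; last by apply: integral_ge0 => x _; rewrite lee_fin.
apply: (@le_lt_trans _ _ (\int[m]_x 1)); last first.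
  by rewrite (integral_prob_cst _ (probability_setT m)) ltry.
apply: ge0_le_integral => //; [by move=> x _; rewrite lee_fin|exact/measurable_EFinP|].
by move=> x _; rewrite lee_fin; case/andP: (h01 x).
Qed.

Let dist_mean (m : probability T R) (h : T -> R) (a : R) : measurable_fun setT h ->
  (forall x, 0 <= h x <= 1)%R -> (0 <= a)%R ->
  `|\int[m]_x (h x)%:E - a%:E| <= \int[m]_x `|h x - a|%:E.
Proof.
move=> mh h01 a0; have h0 x : (0 <= h x)%R by case/andP: (h01 x).
have hfin := prob_int_fin m mh h01.
have md : measurable_fun setT (fun x => `|h x - a|%:E).
  apply/measurable_EFinP; apply: measurableT_comp => //.
  exact: measurable_funB.
have hE0 x : setT x -> 0 <= (h x)%:E by rewrite lee_fin.
have mhE : measurable_fun setT (fun x => (h x)%:E) by exact/measurable_EFinP.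
have dE0 x : setT x -> 0 <= `|h x - a|%:E by rewrite lee_fin.
have up : \int[m]_x (h x)%:E <= \int[m]_x `|h x - a|%:E + a%:E.
  rewrite -[X in _ <= _ + X](integral_prob_cst _ (probability_setT m)) -ge0_integralD//.
  apply: ge0_le_integral => //; first exact: emeasurable_funD.
  by move=> x _; rewrite -EFinD lee_fin; have := ler_norm (h x - a); lra.
have lo : a%:E <= \int[m]_x `|h x - a|%:E + \int[m]_x (h x)%:E.
  rewrite -[X in X <= _](integral_prob_cst _ (probability_setT m)) -ge0_integralD//.
  apply: ge0_le_integral => //; first exact: emeasurable_funD.
  move=> x _; rewrite -EFinD lee_fin distrC.
  by have := ler_norm (a - h x); lra.
have D0 : 0 <= \int[m]_x `|h x - a|%:E by exact: integral_ge0.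
move: hfin up lo D0; case: (\int[m]_x (h x)%:E) => [r| |]//.
case: (\int[m]_x `|h x - a|%:E) => [s| |]//.
- by rewrite -!EFinD abse_EFin !lee_fin ler_norml; lra.
- by move=> *; rewrite leey.
Qed.

(** The contraction bounds [h = |phi - a|] by [gam^t (u + U)], which [pi] integrates but [nu] need
    not. As [h <= 1], the [pi]-integral of [h^2] is also at most [2 gam^t U], and
    [h f <= s^t f^2 / 2 + h^2 / (2 s^t)] with [s = sqrt gam] balances the two terms at order [s^t].
    The rate is thus [sqrt gam], and the constant depends on [nu] only through the second moment of
    its density. *)
Lemma contraction_geometrically_ergodic : geometrically_ergodic P pi.
Proof.
have [g0 g1] := andP gam01.
pose u x := 1 + beta%:E * W x.
have bW0 x : 0 <= beta%:E * W x by rewrite mule_ge0.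
have u0 x : 0 <= u x by rewrite adde_ge0.
have mu : measurable_fun setT u.
  by apply: emeasurable_funD => //; exact: measurable_funeM.
have [U U0 UE] : exists2 U : R, (0 <= U)%R & \int[pi]_x u x = U%:E.
  have Ufin : \int[pi]_x u x \is a fin_num.
    rewrite ge0_fin_numE ?integral_ge0// ge0_integralD//; last exact: measurable_funeM.
    rewrite (integral_prob_cst _ (probability_setT pi)) lte_add_pinfty ?ltry//.
    by rewrite ge0_integralZl// lte_mul_pinfty.
  by exists (fine (\int[pi]_x u x)); rewrite ?fineK// fine_ge0// integral_ge0.
pose s := Num.sqrt gam.
have s0 : (0 < s)%R by rewrite sqrtr_gt0.
have s2 : (s ^+ 2 = gam)%R by rewrite sqr_sqrtr// ltW.
exists s.
  by rewrite s0 /= -(@ltr_pXn2r _ 2)// ?nnegrE ?ltW// expr1n s2.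
move=> nu nupi L2; have [f [f0 mf F fE]] := L2_density_sqr_lty nupi L2.
set F2 := \int[pi]_x (f x ^+ 2)%:E in F.
have F2fin : F2 \is a fin_num.
  by rewrite ge0_fin_numE// integral_ge0// => x _; rewrite lee_fin sqr_ge0.
exists (fine F2 / 2 + U)%R => t; apply: ge_ereal_sup => _ [A mA <-].
pose phi x := fine (kiter P t x A).
have phiE x : (phi x)%:E = kiter P t x A by rewrite /phi fineK// kiter_fin.
have phi01 x : (0 <= phi x <= 1)%R by rewrite -!lee_fin phiE kiter_ge0 kiter_le1.
have mphi : measurable_fun setT phi.
  apply/measurable_EFinP; rewrite (_ : _ \o _ = kiter P t ^~ A).
    exact: measurable_kiter.
  by apply/funext => x /=; rewrite phiE.
have piphi : \int[pi]_x (phi x)%:E = pi A.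
  by rewrite -(stationary_kiter inv t mA); apply: eq_integral => x _.
pose a := fine (pi A).
have aE : pi A = a%:E by rewrite /a fineK// fin_num_measure.
have a0 : (0 <= a)%R by rewrite -lee_fin -aE.
have a1 : (a <= 1)%R by rewrite -lee_fin -aE probability_le1.
have -> : law_at P nu t A = \int[nu]_x (phi x)%:E.
  by apply: eq_integral => x _; rewrite phiE.
rewrite aE; apply: (le_trans (dist_mean nu mphi phi01 a0)).
pose h x : R := `|phi x - a|%R.
have h0 x : (0 <= h x)%R by exact: normr_ge0.
have mh : measurable_fun setT h.
  by apply: measurableT_comp => //; exact: measurable_funB.
rewrite -/(h _) (fE h h0 mh).
have h1 x : (h x <= 1)%R by rewrite /h ler_norml; have := phi01 x; lra.
have K0 : (0 < gam ^+ t)%R by rewrite exprn_gt0.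
have hu x : (h x)%:E <= (gam ^+ t)%:E * (u x + U%:E).
  have [c c0 cP] := contr t mA.
  (* By invariance, moving the center from [c] to [pi A] costs one integral of the same bound. *)
  have ac : `|a - c|%:E <= (gam ^+ t * U)%:E.
    have := dist_mean pi mphi phi01 c0; rewrite piphi aE -EFinB abse_EFin => h2.
    apply: (le_trans h2); rewrite EFinM -UE -ge0_integralZl//; last by rewrite lee_fin ltW.
    apply: ge0_le_integral => //; last by move=> y _; exact: cP.
      apply/measurable_EFinP; apply: measurableT_comp => //.
      exact: measurable_funB.
    exact: measurable_funeM.
  have := cP x; have := u0 x; rewrite -/(u x) -/(phi x); case: (u x) => [ux| |]//.
    rewrite -EFinD -!EFinM !lee_fin => ux0 hc; rewrite lee_fin in ac.
    have := ler_distD c (phi x) a; rewrite /h (distrC c) => h2.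
    by lra.
  by move=> _ _; rewrite addye// gt0_muley ?lte_fin// leey.
have h2int : \int[pi]_x (h x ^+ 2)%:E <= (gam ^+ t * (2 * U))%:E.
  apply: (@le_trans _ _ (\int[pi]_x ((gam ^+ t)%:E * (u x + U%:E)))).
    apply: ge0_le_integral => //.
    - by move=> x _; rewrite lee_fin sqr_ge0.
    - by apply/measurable_EFinP; exact: measurable_funX.
    - by apply: measurable_funeM; apply: emeasurable_funD.
    - move=> x _; apply: le_trans (hu x); rewrite lee_fin expr2.
      by rewrite -[leRHS]mulr1 ler_wpM2l.
  rewrite ge0_integralZl//; last 3 first.
  - exact: emeasurable_funD.
  - by move=> x _; rewrite adde_ge0// lee_fin.
  - by rewrite lee_fin ltW.
  rewrite ge0_integralD//.
  by rewrite UE (integral_prob_cst _ (probability_setT pi)) -EFinD -EFinM mulr_natl.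
have st0 : (0 < s ^+ t)%R by rewrite exprn_gt0.
apply: (@le_trans _ _ (\int[pi]_x ((s ^+ t / 2)%:E * (f x ^+ 2)%:E
    + ((s ^+ t)^-1 / 2)%:E * (h x ^+ 2)%:E))).
  apply: ge0_le_integral => //.
  - by move=> x _; rewrite lee_fin mulr_ge0.
  - by apply/measurable_EFinP; exact: measurable_funM.
  - apply: emeasurable_funD; apply: measurable_funeM; apply/measurable_EFinP;
      exact: measurable_funX.
  move=> x _; rewrite -!EFinM -EFinD lee_fin.
  have := sqr_ge0 (s ^+ t * f x - h x)%R.
  have -> : (s ^+ t / 2 * f x ^+ 2 + (s ^+ t)^-1 / 2 * h x ^+ 2 =
    (s ^+ t)^-1 * ((s ^+ t * f x - h x) ^+ 2 / 2) + h x * f x)%R.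
    by field; rewrite gt_eqF.
  by move=> q; rewrite lerDr mulr_ge0 ?invr_ge0 ?(ltW st0)// divr_ge0.
have mf2 : measurable_fun setT (fun x => (f x ^+ 2)%:E).
  by apply/measurable_EFinP; exact: measurable_funX.
have mh2 : measurable_fun setT (fun x => (h x ^+ 2)%:E).
  by apply/measurable_EFinP; exact: measurable_funX.
have f20 x : setT x -> 0 <= (f x ^+ 2)%:E by rewrite lee_fin sqr_ge0.
have h20 x : setT x -> 0 <= (h x ^+ 2)%:E by rewrite lee_fin sqr_ge0.
have c10 : 0 <= (s ^+ t / 2)%:E by rewrite lee_fin divr_ge0// ltW.
have c20 : 0 <= ((s ^+ t)^-1 / 2)%:E by rewrite lee_fin divr_ge0// invr_ge0 ltW.
rewrite ge0_integralD//; last 4 first.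
- by move=> x _; rewrite mule_ge0// f20.
- exact: measurable_funeM.
- by move=> x _; rewrite mule_ge0// h20.
- exact: measurable_funeM.
rewrite !ge0_integralZl//.
apply: (@le_trans _ _ ((s ^+ t / 2)%:E * F2 + ((s ^+ t)^-1 / 2)%:E * (gam ^+ t * (2 * U))%:E)).
  apply: leeD => //; apply: lee_wpmul2l => //.
rewrite -(fineK F2fin) -!EFinM -EFinD lee_fin -s2 exprAC expr2.
by rewrite le_eqVlt; apply/orP; left; apply/eqP; field; rewrite gt_eqF.
Qed.

End ergodicity.

(** * Transfer of drift and minorization through the intermediate variable *)

Section two_stage.
Context d d' (X : measurableType d) (Y : measurableType d') (R : realType).
Local Open Scope ereal_scope.

Lemma markov_half (m : {measure set Y -> \bar R}) (g : Y -> \bar R) (S : R) :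
  m setT = 1 -> (forall y, 0 <= g y) -> measurable_fun setT g -> (0 <= S)%R ->
  \int[m]_y g y <= S%:E -> (2^-1)%:E <= m [set y | g y < (2 * S + 2)%:E].
Proof.
(* The level [2 S + 2], rather than [2 S], stays positive when [S = 0]. *)
move=> m1 g0 mg S0 gS; set S' := (2 * S + 2)%R.
have S'0 : (0 < S')%R by rewrite /S'; lra.
pose B := [set y | S'%:E <= g y].
have mB : measurable B by rewrite -[B]setTI; exact: emeasurable_fun_c_infty.
have := le_integral_abse m measurableT mg S'0.
rewrite setTI; under eq_integral do rewrite gee0_abs//.
have -> : [set x | S'%:E <= `|g x|] = B.
  by apply/seteqP; split => y /=; rewrite gee0_abs.
move=> /le_trans/(_ gS) mBS.
have -> : [set y | g y < S'%:E] = ~` B.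
  by apply/seteqP; split => y /=; rewrite ltNge => /negP.
have mBfin : m B \is a fin_num.
  by rewrite ge0_fin_numE// (@le_lt_trans _ _ 1) ?ltry// -m1 le_measure ?inE.
have : m setT = m B + m (~` B).
  by rewrite -(setUv B) measureU ?setICr//; exact: measurableC.
rewrite m1.
have CB0 : 0 <= m (~` B) by [].
move: mBfin mBS CB0; case: (m B) => [r| |]// _; case: (m (~` B)) => [s| |]//.
- rewrite -EFinM -EFinD !lee_fin => h1 h2 [h3].
  have : (S' * r <= S' / 2)%R by rewrite /S' in h1 *; lra.
  by rewrite ler_pM2l// => h4; lra.
Qed.

Variables (k1 : R.-pker X ~> Y) (k2 : R.-pker Y ~> X) (P : R.-pker X ~> X)
  (pi : probability X R).
Hypothesis PE : forall x A, measurable A -> P x A = \int[k1 x]_y k2 y A.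

(** The Lyapunov function of the chain is the integral [W x] of [g] under [k1 x]; its drift is that
    of [g], averaged over [k1 x]. If [W x <= S], Markov's inequality puts half of the mass of [k1 x]
    in a sublevel set of [g], so the minorization of [k2] passes to [P] with half the constant. *)
Theorem two_stage_geometrically_ergodic (g : Y -> \bar R) (lam L : R) :
  (forall A, measurable A -> \int[pi]_x P x A = pi A) ->
  (forall y, 0 <= g y) -> measurable_fun setT g ->
  (0 <= lam)%R -> (lam < 1)%R -> (0 <= L)%R ->
  (forall y, \int[k2 y]_x \int[k1 x]_z g z <= lam%:E * g y + L%:E) ->
  (forall S : R, (0 <= S)%R -> exists (eps : R) (eta : {measure set X -> \bar R}),
    [/\ (0 < eps)%R, eta setT = 1 &
      forall y A, measurable A -> g y <= S%:E -> eps%:E * eta A <= k2 y A]) ->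
  {ae pi, forall x, \int[k1 x]_y g y < +oo} ->
  geometrically_ergodic P pi.
Proof.
move=> inv g0 mg l0 l1 L0 drift minor Wfin.
pose W x := \int[k1 x]_y g y.
have W0 x : 0 <= W x by exact: integral_ge0.
have mW : measurable_fun setT W.
  by apply: measurable_fun_integral_kernel => // U mU; exact: measurable_kernel.
have mk2W : measurable_fun setT (fun y => \int[k2 y]_x W x).
  by apply: measurable_fun_integral_kernel => // U mU; exact: measurable_kernel.
have Pdrift x : \int[P x]_y W y <= lam%:E * W x + L%:E.
  rewrite (eq_measure_integral (mkcomp_noparam k1 k2 x)); last first.
    by move=> A mA _; rewrite PE.
  rewrite integral_mkcomp_noparam//.
  apply: (@le_trans _ _ (\int[k1 x]_y (lam%:E * g y + L%:E))).
    apply: ge0_le_integral => //.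
    - by move=> y _; exact: integral_ge0.
    - by apply: emeasurable_funD => //; exact: measurable_funeM.
  rewrite ge0_integralD//; last 2 first.
  - by move=> y _; rewrite mule_ge0.
  - exact: measurable_funeM.
  by rewrite ge0_integralZl// (integral_prob_cst _ (prob_kernel x)).
have Pminor (S : R) : (0 <= S)%R -> exists (eps : R) (eta : {measure set X -> \bar R}),
    [/\ (0 < eps)%R, eta setT = 1 &
    forall x A, measurable A -> W x <= S%:E -> eps%:E * eta A <= P x A].
  move=> S0; have S'0 : (0 <= 2 * S + 2)%R by lra.
  have [eps [eta [eps0 eta1 etaP]]] := minor _ S'0.
  exists (eps / 2)%R, eta; split => //; first by rewrite divr_gt0.
  move=> x A mA WS; rewrite PE//.
  pose D := [set y | g y < (2 * S + 2)%:E].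
  have mD : measurable D by rewrite -[D]setTI; exact: emeasurable_fun_infty_o.
  have mk2 : measurable_fun setT (k2 ^~ A) by exact: measurable_kernel.
  have e0 : 0 <= eps%:E * eta A by rewrite mule_ge0// lee_fin ltW.
  apply: (@le_trans _ _ (\int[k1 x]_(y in D) k2 y A)); last first.
    by apply: ge0_subset_integral => //.
  apply: (@le_trans _ _ (\int[k1 x]_(y in D) (eps%:E * eta A))); last first.
    apply: ge0_le_integral => //; first exact: measurable_funTS.
    by move=> y Dy; apply: etaP => //; exact: ltW.
  rewrite (integral_cst (k1 x) mD) EFinM -muleA muleCA muleC.
  by apply: lee_wpmul2l => //; exact: (markov_half (prob_kernel x)).
have [gam [beta [gam01 beta0 contr]]] := harris_contraction W0 mW l0 l1 L0 Pdrift Pminor.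
apply: (contraction_geometrically_ergodic inv W0 mW gam01 beta0 contr).
exact: (stationary_drift_lty inv W0 mW l0 l1 L0 Pdrift Wfin).
Qed.

End two_stage.

(** * Integration over tuples *)

Lemma measure_pushforward d d' (X : measurableType d) (Y : measurableType d')
    (R : realType) (mu : {measure set X -> \bar R}) (phi : X -> Y) :
  measurable_fun setT phi ->
  exists m : {measure set Y -> \bar R}, m = pushforward mu phi :> (set Y -> \bar R).
Proof.
move=> mphi; unshelve eexists.
  by apply: [the {measure set _ -> \bar R} of pushforward mu phi].
by [].
Qed.

Section real_affine.
Context {R : realType}.
Local Open Scope ereal_scope.
Local Notation mu := (@lebesgue_measure R).

Lemma lebesgue_measure_affine (a b : R) (A : set R) : (0 < a)%R -> measurable A ->
  mu A = a%:E * mu ((fun x : R => (a * x + b)%R) @^-1` A).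
Proof.
move=> a0 mA.
have mphi : measurable_fun setT (fun x : measurableTypeR R => (a * x + b)%R : measurableTypeR R).
  by apply: measurable_funD => //; exact: measurable_funM.
have [pm pmE] := measure_pushforward mu mphi.
have mE B : mscale (NngNum (ltW a0)) pm B = a%:E * mu ((fun x : R => (a * x + b)%R) @^-1` B).
  by rewrite /mscale/= pmE.
rewrite -mE.
apply: (@lebesgue_measure_unique _ (mscale (NngNum (ltW a0)) pm)) => // _ [[c e]] _ <-.
apply: etrans (esym (mE _)) => /=.
have -> : (fun x : R => (a * x + b)%R) @^-1` `]c, e]%classic =
    `]((c - b) / a)%R, ((e - b) / a)%R]%classic.
  apply/seteqP; split => x /=; rewrite !in_itv/= ltr_pdivrMr// ler_pdivlMr//;
    by rewrite ltrBlDr lerBrDr mulrC.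
rewrite !lebesgue_measure_itv/= !lte_fin ltr_pM2r ?invr_gt0// ltrD2r.
case: ifP => _; last by rewrite mule0.
by rewrite -!EFinB -EFinM; congr EFin; field; rewrite gt_eqF.
Qed.

Lemma integral_affine (a b : R) (f : R -> \bar R) : (0 < a)%R ->
  (forall x, 0 <= f x) -> measurable_fun setT f ->
  \int[mu]_x f x = a%:E * \int[mu]_x f (a * x + b)%R.
Proof.
move=> a0 f0 mf.
have mphi : measurable_fun setT (fun x : measurableTypeR R => (a * x + b)%R : measurableTypeR R).
  by apply: measurable_funD => //; exact: measurable_funM.
have [pm pmE] := measure_pushforward mu mphi.
have mE B : mscale (NngNum (ltW a0)) pm B = a%:E * mu ((fun x : R => (a * x + b)%R) @^-1` B).
  by rewrite /mscale/= pmE.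
transitivity (\int[mscale (NngNum (ltW a0)) pm]_x f x).
  apply: eq_measure_integral => A mA _.
  exact: etrans (lebesgue_measure_affine b a0 mA) (esym (mE A)).
rewrite ge0_integral_mscale//; congr (_ * _).
transitivity (\int[pushforward mu
    (fun x : measurableTypeR R => (a * x + b)%R : measurableTypeR R)]_x f x).
  by apply: eq_measure_integral => A mA _; rewrite pmE.
by rewrite ge0_integral_pushforward//= preimage_setT.
Qed.

Lemma integral_translation (b : R) (f : R -> \bar R) :
  (forall x, 0 <= f x) -> measurable_fun setT f ->
  \int[mu]_x f (x + b)%R = \int[mu]_x f x.
Proof.
move=> f0 mf; rewrite [RHS](@integral_affine 1 b)// mul1e.
by apply: eq_integral => x _; rewrite mul1r.
Qed.

Lemma integral_opp (f : R -> \bar R) :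
  (forall x, 0 <= f x) -> measurable_fun setT f ->
  \int[mu]_x f (- x)%R = \int[mu]_x f x.
Proof.
move=> f0 mf.
transitivity (\int[pushforward mu (-%R : _ -> measurableTypeR R)]_x f x).
  by rewrite ge0_integral_pushforward//= preimage_setT.
by apply: eq_measure_integral => A mA _; exact: lebesgue_measureN.
Qed.

End real_affine.

Section tuple_integrals.
Context {R : realType}.
Local Open Scope ereal_scope.
Local Notation mu := (@lebesgue_measure R).

Lemma measurable_cons_tuple_pair n : measurable_fun setT (@cons_tuple_pair R n).
Proof. exact: measurable_cons. Qed.

Lemma integral_lebesgue_tuple0 (F : 0.-tuple R -> \bar R) :
  \int[lebesgue_tuple]_t F t = F [tuple].
Proof.
have mF : measurable_fun setT F.
  move=> _ Y _; rewrite setTI.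
  have [H|H] := pselect ((F @^-1` Y) [tuple]).
    rewrite (_ : _ @^-1` _ = setT)//; apply/seteqP; split => // t _.
    by rewrite (tuple0 t).
  by rewrite (_ : _ @^-1` _ = set0)//; apply/seteqP; split => // t; rewrite (tuple0 t).
rewrite (eq_measure_integral (dirac ([tuple] : 0.-tuple R))).
  by rewrite integral_dirac// diracT mul1e.
by move=> A mA _.
Qed.

Lemma integral_lebesgue_tupleS n (F : n.+1.-tuple R -> \bar R) :
  (forall t, 0 <= F t) -> measurable_fun setT F ->
  \int[lebesgue_tuple]_t F t =
  \int[mu]_x \int[lebesgue_tuple]_t F [tuple of x :: t].
Proof.
move=> F0 mF.
have mc := @measurable_cons_tuple_pair n.
rewrite (eq_measure_integral (pushforward (mu \x (@lebesgue_tuple R n))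
  (@cons_tuple_pair R n))); last by move=> A mA _.
rewrite ge0_integral_pushforward//= preimage_setT fubini_tonelli1//.
  exact: measurableT_comp.
Qed.

Lemma measurable_integral_tuple n d (T : measurableType d)
    (F : T * n.-tuple R -> \bar R) :
  (forall z, 0 <= F z) -> measurable_fun setT F ->
  measurable_fun setT (fun x => \int[lebesgue_tuple]_t F (x, t)).
Proof.
by move=> F0 mF; apply: (measurable_fun_fubini_tonelli_F (m2 := @lebesgue_tuple R n)).
Qed.

(** Any position is allowed, whereas [lebesgue_tuple] grows at the head only: marginals are needed
    at every coordinate. *)
Definition tuple_ins n (i : 'I_n.+1) (x : R) (t : n.-tuple R) : n.+1.-tuple R :=
  [tuple if unlift i j is Some k then tnth t k else x | j < n.+1].

Lemma tnth_tuple_ins n (i : 'I_n.+1) x (t : n.-tuple R) : tnth (tuple_ins i x t) i = x.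
Proof. by rewrite tnth_mktuple unlift_none. Qed.

Lemma tnth_tuple_ins_lift n (i : 'I_n.+1) x (t : n.-tuple R) k :
  tnth (tuple_ins i x t) (lift i k) = tnth t k.
Proof. by rewrite tnth_mktuple liftK. Qed.

Lemma measurable_tuple_ins n (i : 'I_n.+1) d (T : measurableType d)
    (x : T -> R) (t : T -> n.-tuple R) :
  measurable_fun setT x -> measurable_fun setT t ->
  measurable_fun setT (fun z => tuple_ins i (x z) (t z)).
Proof.
move=> mx mt; apply/measurable_fun_tnthP => j.
rewrite (_ : _ \o _ = fun z => if unlift i j is Some k then tnth (t z) k else x z).
  case: (unlift i j) => [k|]//.
  exact: (measurableT_comp (measurable_tnth k)).
by apply/funext => z /=; rewrite tnth_mktuple.
Qed.

Lemma tuple_ins_ord0 n x (t : n.-tuple R) : tuple_ins ord0 x t = [tuple of x :: t].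
Proof.
apply: eq_from_tnth => j; case: (unliftP ord0 j) => [k|] ->.
  by rewrite tnth_tuple_ins_lift tnthS.
by rewrite tnth_tuple_ins tnth0.
Qed.

Lemma tuple_ins_lift0 n (i : 'I_n.+1) x y (t : n.-tuple R) :
  tuple_ins (lift ord0 i) x [tuple of y :: t] = [tuple of y :: tuple_ins i x t].
Proof.
apply: eq_from_tnth => j; case: (unliftP ord0 j) => [k|] ->.
  rewrite tnthS; case: (unliftP i k) => [l|] ->; last by rewrite !tnth_tuple_ins.
  have -> : lift ord0 (lift i l) = lift (lift ord0 i) (lift ord0 l).
    by apply/val_inj => /=; rewrite /bump /= !add1n ltnS; case: leqP.
  by rewrite !tnth_tuple_ins_lift tnthS.
rewrite tnth0.
have -> : ord0 = lift (lift ord0 i) ord0 :> 'I_n.+2 by apply/val_inj.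
by rewrite tnth_tuple_ins_lift tnth0.
Qed.

(** Induction on [n]: the head is split off, and Tonelli's theorem exchanges it with the inserted
    coordinate. *)
Lemma integral_tuple_ins n (i : 'I_n.+1) (F : n.+1.-tuple R -> \bar R) :
  (forall t, 0 <= F t) -> measurable_fun setT F ->
  \int[lebesgue_tuple]_t F t =
  \int[mu]_x \int[lebesgue_tuple]_t F (tuple_ins i x t).
Proof.
elim: n i F => [|n IH] i F F0 mF.
  rewrite (integral_lebesgue_tupleS F0 mF); apply: eq_integral => x _.
  by apply: eq_integral => t _; rewrite (ord1 i) tuple_ins_ord0.
case: (unliftP ord0 i) => [j|] ->; last first.
  rewrite (integral_lebesgue_tupleS F0 mF); apply: eq_integral => x _.
  by apply: eq_integral => t _; rewrite tuple_ins_ord0.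
rewrite (integral_lebesgue_tupleS F0 mF).
transitivity (\int[mu]_y \int[mu]_x \int[lebesgue_tuple]_t F [tuple of y :: tuple_ins j x t]).
  apply: eq_integral => y _; rewrite (IH j)//.
  by apply: measurableT_comp => //; apply: measurable_cons.
transitivity (\int[mu]_x \int[mu]_y \int[lebesgue_tuple]_t F [tuple of y :: tuple_ins j x t]).
  pose G (z : measurableTypeR R * measurableTypeR R) :=
    \int[lebesgue_tuple]_t F [tuple of z.1 :: tuple_ins j z.2 t].
  have G0 z : 0 <= G z by apply: integral_ge0.
  have mG : measurable_fun setT G.
    apply: measurable_integral_tuple (fun w => F [tuple of w.1.1 :: tuple_ins j w.1.2 w.2]) _ _ => //.
    apply: measurableT_comp => //; apply: measurable_cons.
      by apply: measurableT_comp => //.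
    apply: measurable_tuple_ins => //.
    by apply: measurableT_comp => //.
  exact: (@fubini_tonelli _ _ _ _ _ mu mu G mG G0).
apply: eq_integral => x _.
have mFx : measurable_fun setT (fun t => F (tuple_ins (lift ord0 j) x t)).
  by apply: measurableT_comp => //; exact: measurable_tuple_ins.
rewrite [RHS](integral_lebesgue_tupleS (fun t => F0 _) mFx).
by apply: eq_integral => y _; apply: eq_integral => t _; rewrite tuple_ins_lift0.
Qed.

Lemma integral_tuple_translation n (a : n.-tuple R) (F : n.-tuple R -> \bar R) :
  (forall t, 0 <= F t) -> measurable_fun setT F ->
  \int[lebesgue_tuple]_t F [tuple (tnth t i + tnth a i)%R | i < n] =
  \int[lebesgue_tuple]_t F t.
Proof.
elim: n a F => [|n IH] a F F0 mF.
  by rewrite !integral_lebesgue_tuple0; congr F; rewrite [LHS]tuple0.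
pose sh m (b : m.-tuple R) (t : m.-tuple R) := [tuple (tnth t i + tnth b i)%R | i < m].
have msh m (b : m.-tuple R) : measurable_fun setT (sh m b).
  apply/measurable_fun_tnthP => j; rewrite (_ : _ \o _ = fun t => (tnth t j + tnth b j)%R).
    by apply: measurable_funD => //; exact: measurable_tnth.
  by apply/funext => t /=; rewrite tnth_mktuple.
rewrite integral_lebesgue_tupleS//; last exact: (measurableT_comp mF (msh _ a)).
rewrite [RHS](integral_lebesgue_tupleS F0 mF).
rewrite -[RHS](integral_translation (thead a)); last 2 first.
- by move=> x; exact: integral_ge0.
- apply: (measurable_integral_tuple (F := fun w => F [tuple of w.1 :: w.2])) => //.
  by apply: measurableT_comp => //; exact: measurable_cons.
apply: eq_integral => x _.
rewrite -[RHS](IH [tuple of behead a])//; last first.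
  by apply: measurableT_comp => //; exact: measurable_cons.
apply: eq_integral => t _; congr F; apply: eq_from_tnth => i.
rewrite tnth_mktuple; case: (unliftP ord0 i) => [k|] ->.
  by rewrite !tnthS tnth_mktuple tnth_behead; congr (_ + tnth a _)%R; apply/val_inj; rewrite /= inordK// ltnS ltn_ord.
by rewrite !tnth0.
Qed.

Lemma integral_tuple_prod n (f : 'I_n -> R -> R) (c : 'I_n -> R) :
  (forall i x, 0 <= f i x)%R -> (forall i, measurable_fun setT (f i)) ->
  (forall i, \int[mu]_x (f i x)%:E = (c i)%:E) ->
  \int[lebesgue_tuple]_t (\prod_(i < n) f i (tnth t i))%:E = (\prod_(i < n) c i)%:E.
Proof.
elim: n f c => [|n IH] f c f0 mf fc.
  by rewrite integral_lebesgue_tuple0 !big_ord0.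
have prod0 (t : n.+1.-tuple R) : 0 <= (\prod_(i < n.+1) f i (tnth t i))%:E.
  by rewrite lee_fin prodr_ge0.
rewrite integral_lebesgue_tupleS//; last first.
  apply/measurable_EFinP; apply: measurable_prod => i _.
  by apply: measurableT_comp => //; exact: measurable_tnth.
transitivity (\int[mu]_x ((f ord0 x)%:E * (\prod_(i < n) c (lift ord0 i))%:E)).
  apply: eq_integral => x _.
  rewrite -(IH (fun i => f (lift ord0 i)) (fun i => c (lift ord0 i)))//.
  rewrite -ge0_integralZl//; last 3 first.
  - apply/measurable_EFinP; apply: measurable_prod => i _.
    by apply: measurableT_comp => //; exact: measurable_tnth.
  - by move=> t _; rewrite lee_fin prodr_ge0.
  - by rewrite lee_fin.
  apply: eq_integral => t _; rewrite -EFinM big_ord_recl tnth0.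
  by under eq_bigr do rewrite tnthS.
have c0 i : (0 <= c i)%R.
  by rewrite -lee_fin -fc integral_ge0// => x _; rewrite lee_fin.
rewrite ge0_integralZr//; last 3 first.
- by apply/measurable_EFinP; exact: mf.
- by move=> x _; rewrite lee_fin.
- by rewrite lee_fin prodr_ge0.
by rewrite fc -EFinM big_ord_recl.
Qed.

End tuple_integrals.

(** * Moments of generalized inverse Gaussian laws *)

Lemma ge0_integral_gt0 d (T : measurableType d) (R : realType)
    (mu : {measure set T -> \bar R}) (f : T -> \bar R) (A : set T) :
  measurable_fun setT f -> (forall x, (0 <= f x)%E) -> measurable A -> (0 < mu A)%E ->
  (forall x, A x -> (0 < f x)%E) -> (0 < \int[mu]_x f x)%E.
Proof.
move=> mf f0 mA muA fA.
rewrite lt_def integral_ge0// andbT; apply/eqP => J0.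
have J0' : (\int[mu]_x `|f x| = 0)%E.
  by rewrite -J0; apply: eq_integral => x _; rewrite gee0_abs.
have [S [mS S0 Ssub]] := (ae_eq_integral_abs mu measurableT mf).1 J0'.
have : (mu A <= mu S)%E.
  rewrite le_measure ?inE// => x Ax; apply: Ssub => /= /(_ I) fx0.
  by have := fA x Ax; rewrite fx0 ltxx.
by rewrite S0 leNgt muA.
Qed.

Section gig_integral.
Context {R : realType}.
Implicit Types q c d x t : R.
Local Notation mu := (@lebesgue_measure R).

(** The normalizing constant of GIG(q, c, d): a modified Bessel function of the second kind up to
    explicit factors, and a Gamma value times powers when [c = 0]. It stays an extended real because
    its infinite value at [q = c = 0] is used. *)
Definition gig_mass q c d : \bar R := (\int[mu]_x (gig_fun q c d x)%:E)%E.

Lemma measurable_gig_fun_arg q c d : measurable_fun [set: R] (gig_fun q c d).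
Proof.
by apply: (@measurable_gig_fun R _ _ q c (fun=> d) id) => //; exact: measurable_cst.
Qed.

Lemma measurable_gig_EFin q c d : measurable_fun [set: R] (fun x => (gig_fun q c d x)%:E).
Proof. by apply/measurable_EFinP; exact: measurable_gig_fun_arg. Qed.

Lemma gig_fun_le0 q c d x : x <= 0 -> gig_fun q c d x = 0.
Proof. by move=> x0; rewrite /gig_fun ltNge x0. Qed.

Lemma gig_funE q c d x : 0 < x ->
  gig_fun q c d x = x `^ (q - 1) * expR (- ((c * x + d / x) / 2)).
Proof. by move=> x0; rewrite /gig_fun x0. Qed.

Lemma gig_fun_gt0 q c d x : 0 < x -> 0 < gig_fun q c d x.
Proof. by move=> x0; rewrite gig_funE// mulr_gt0 ?powR_gt0 ?expR_gt0. Qed.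

Lemma gig_fun_powR q s c d x : 0 < x -> gig_fun (q + s) c d x = x `^ s * gig_fun q c d x.
Proof.
move=> x0; rewrite !gig_funE// mulrA -powRD ?(gt_eqF x0) ?implybT//.
by congr (_ `^ _ * _); ring.
Qed.

Lemma gig_mass_ge0 q c d : (0 <= gig_mass q c d)%E.
Proof. by apply: integral_ge0 => x _; rewrite lee_fin gig_fun_ge0. Qed.

Lemma gig_mass_gt0 q c d : (0 < gig_mass q c d)%E.
Proof.
have mu01 : (0 < mu `]0%R, 1%R]%classic)%E.
  by rewrite lebesgue_measure_itv/= lte_fin ltr01 oppr0 adde0 lte_fin ltr01.
apply: (@ge0_integral_gt0 _ _ _ mu (fun x => (gig_fun q c d x)%:E)
  `](0 : R), (1 : R)]%classic) => //.
- exact: measurable_gig_EFin.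
- by move=> x; rewrite lee_fin gig_fun_ge0.
- by move=> x /=; rewrite in_itv/= => /andP[x0 _]; rewrite lte_fin gig_fun_gt0.
Qed.

(** The substitution of [t x] for [x]. With [t = d] it reduces the second parameter to 1; with other
    [t] it is the source of the moment inequalities. *)
Lemma gig_mass_scale q c d t : 0 < t ->
  gig_mass q c d = ((t `^ q)%:E * gig_mass q (c * t) (d / t))%E.
Proof.
move=> t0; have g0 x : (0 <= (gig_fun q c d x)%:E)%E by rewrite lee_fin gig_fun_ge0.
rewrite /gig_mass [LHS](integral_affine 0 t0 g0 (measurable_gig_EFin q c d)).
have tq : t `^ q = t * t `^ (q - 1) 
  by rewrite -[X in X * _](powRr1 (ltW t0)) -powRD ?(gt_eqF t0) ?implybT//; congr (_ `^ _); ring.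
rewrite tq EFinM -muleA -[in RHS]ge0_integralZl//; last 3 first.
- exact: measurable_gig_EFin.
- by move=> x _; rewrite lee_fin gig_fun_ge0.
- by rewrite lee_fin powR_ge0.
congr (_ * _)%E; apply: eq_integral => x _; rewrite -EFinM addr0; congr EFin.
have [x0|x0] := leP x 0.
  by rewrite !gig_fun_le0 ?mulr0// mulr_ge0_le0// ltW.
rewrite !gig_funE ?mulr_gt0// powRM ?ltW// -mulrA; congr (_ * (_ * expR (- (_ / 2)))).
by field; rewrite !gt_eqF.
Qed.

Lemma gig_fun_le q c c' d d' x : c' <= c -> d' <= d -> gig_fun q c d x <= gig_fun q c' d' x.
Proof.
move=> cc dd; have [x0|x0] := leP x 0; first by rewrite !gig_fun_le0.
rewrite !gig_funE// ler_wpM2l ?powR_ge0// ler_expR lerN2 ler_wpM2r//.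
by rewrite lerD// ler_wpM2r// ?invr_ge0 ltW.
Qed.

Lemma gig_mass_le q c c' d d' : c' <= c -> d' <= d ->
  (gig_mass q c d <= gig_mass q c' d')%E.
Proof.
move=> cc dd; apply: ge0_le_integral => //.
- by move=> x _; rewrite lee_fin gig_fun_ge0.
- exact: measurable_gig_EFin.
- exact: measurable_gig_EFin.
- by move=> x _; rewrite lee_fin gig_fun_le.
Qed.

Definition pos_itv (n : nat) : set R := `[n.+1%:R^-1, n.+1%:R]%classic.

Lemma pos_itv_gt0 n x : pos_itv n x -> 0 < x.
Proof. by rewrite /pos_itv/= in_itv/= => /andP[+ _]; apply: lt_le_trans. Qed.

Lemma nondecreasing_pos_itv : nondecreasing_seq pos_itv.
Proof.
move=> i j ij; apply/subsetPset => x; rewrite /pos_itv/= !in_itv/= => /andP[h1 h2].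
apply/andP; split.
  by apply: le_trans h1; rewrite lef_pV2 ?posrE// ler_nat.
by apply: (le_trans h2); rewrite ler_nat.
Qed.

Lemma bigcup_pos_itv : \bigcup_n pos_itv n = `]0, +oo[%classic.
Proof.
apply/seteqP; split => [x [i _ /pos_itv_gt0]|x]; rewrite /= in_itv/= andbT// => x0.
pose N := (Num.truncn x + Num.truncn x^-1)%N.
have h1 : x <= N.+1%:R.
  apply/ltW; apply: lt_le_trans (truncnS_gt x) _; by rewrite ler_nat ltnS leq_addr.
have h2 : x^-1 <= N.+1%:R.
  apply/ltW; apply: lt_le_trans (truncnS_gt x^-1) _; by rewrite ler_nat ltnS leq_addl.
exists N => //; rewrite /pos_itv/= in_itv/= h1 andbT.
by rewrite -[leRHS]invrK lef_pV2 ?posrE// invr_gt0.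
Qed.

(** The fundamental theorem of calculus and the change of variables act on compact intervals inside
    the open half-line; this is their passage to the limit. *)
Lemma cvg_integral_pos_itv (f : R -> \bar R) :
  measurable_fun [set: R] f -> (forall x, (0 <= f x)%E) ->
  (\int[mu]_(x in pos_itv i) f x @[i --> \oo] --> \int[mu]_(x in `]0%R, +oo[) f x)%E.
Proof.
move=> mf f0; rewrite -bigcup_pos_itv.
apply: ge0_nondecreasing_set_cvg_integral => //.
- exact: nondecreasing_pos_itv.
- by move=> i; exact: measurable_itv.
- by move=> i; exact: measurable_funTS.
Qed.

Lemma integral_powR_itv (s a b : R) : s != 0 -> 0 < a -> a < b ->
  (\int[mu]_(x in `[a, b]) (x `^ (s - 1))%:E = ((b `^ s - a `^ s) / s)%:E)%E.
Proof.
move=> s0 a0 ab.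
have b0 : 0 < b by exact: lt_trans ab.
have cont x r : 0 < x -> {for x, continuous (fun y : R => y `^ r)}.
  move=> x0; apply: differentiable_continuous; apply/derivable1_diffP.
  by apply: derivable_powR; rewrite in_itv/= x0.
have contV x : 0 < x -> {for x, continuous (fun y : R => y `^ s / s)}.
  by move=> x0; apply: cvgM; [exact: cont|exact: cvg_cst].
rewrite (@continuous_FTC2 _ _ (fun x => x `^ s / s))//.
- by rewrite -EFinB mulrBl.
- apply: continuous_in_subspaceT => x; rewrite inE/= in_itv/= => /andP[ax _].
  by apply: cont; exact: lt_le_trans ax.
- split.
  + move=> x; rewrite in_itv/= => /andP[ax _].
    apply: derivableM => //; apply: derivable_powR.
    by rewrite in_itv/= andbT (lt_trans a0).
  + by apply: cvg_at_right_filter; exact: contV.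
  + by apply: cvg_at_left_filter; exact: contV.
- move=> x; rewrite in_itv/= => /andP[ax _].
  have x0 : 0 < x by exact: lt_trans ax.
  rewrite derive1E deriveMr ?derivable_powR ?in_itv/= ?andbT//.
  rewrite -derive1E powR_derive1 ?in_itv/= ?andbT//.
  by rewrite /GRing.scale/= mulrA mulVf// mul1r.
by apply: derivable_powR; rewrite in_itv/= andbT.
Qed.

Lemma powR_expR_bounded (m k : R) : 0 < k ->
  exists2 C : R, 0 <= C & forall y, 1 <= y -> y `^ m * expR (- (k * y)) <= C.
Proof.
(* Any integer above [|m|] serves: for [y >= 1] the term of order [N] of the exponential series
   dominates [y^m]. *)
move=> k0; pose N := (Num.truncn `|m|).+1.
exists (N`!%:R / k ^+ N); first by rewrite divr_ge0// exprn_ge0// ltW.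
move=> y y1; have y0 : 0 < y by exact: lt_le_trans y1.
have mN : m <= N%:R.
  by apply: le_trans (ler_norm m) _; apply/ltW/truncnS_gt.
have h1 : y `^ m <= y ^+ N.
  by rewrite -powR_mulrn ?(ltW y0)// ler_powR.
have h2 : (k * y) ^+ N <= N`!%:R * expR (k * y).
  have ky0 : 0 <= k * y by rewrite mulr_ge0// ltW.
  have := expR_ge1Dxn (Num.truncn `|m|) ky0; rewrite -/N => h.
  have : (k * y) ^+ N / N`!%:R <= expR (k * y) by lra.
  by rewrite ler_pdivrMr ?ltr0n ?fact_gt0// [expR _ * _]mulrC.
rewrite expRN ler_pdivrMr ?expR_gt0//; apply: (le_trans h1).
rewrite mulrAC ler_pdivlMr ?exprn_gt0// mulrC -exprMn; exact: h2.
Qed.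

(** The union of the three admissible ranges of the GIG laws: for nonnegative [c] and [d], the third
    condition is integrability at infinity and the fourth integrability at 0. *)
Definition gig_adm q c d := [/\ 0 <= c, 0 <= d, 0 < c \/ q < 0 & 0 < d \/ 0 < q].

(** Each end is dominated by an integrable power: where the exponential decays it beats every power
    and the exponent 1 is taken, otherwise the power in the density converges by itself. *)
Lemma gig_fun_tail q c d : gig_adm q c d ->
  exists r K : R, [/\ 0 < r, 0 <= K,
    forall x, 1 <= x -> gig_fun q c d x <= K * (x `^ (- r - 1)) &
    forall x, 0 < x -> x <= 1 -> gig_fun q c d x <= K * (x `^ (r - 1))].
Proof.
move=> [c0 d0 cq dq].
have [r1 [K1 [r10 K10 h1]]] : exists r K : R, [/\ 0 < r, 0 <= K &
    forall x, 1 <= x -> gig_fun q c d x <= K * (x `^ (- r - 1))].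
  have [cp|cn] := ltP 0 c.
    have [C C0 hC] := powR_expR_bounded (q + 1) (divr_gt0 cp (ltr0n R 2)).
    exists 1, C; split => // x x1; have x0 : 0 < x by exact: lt_le_trans x1.
    rewrite gig_funE//.
    have -> : x `^ (q - 1) = x `^ (q + 1) * x `^ (- 1 - 1).
      by rewrite -powRD ?(gt_eqF x0) ?implybT//; congr (_ `^ _); ring.
    rewrite mulrAC ler_wpM2r ?powR_ge0//; apply: le_trans (hC x x1).
    rewrite ler_wpM2l ?powR_ge0// ler_expR lerN2 mulrDl mulrAC lerDl.
    by rewrite !divr_ge0// ltW.
  have q0 : q < 0 by case: cq => //; rewrite ltNge cn.
  exists (- q), 1; split => //; first lra.
  move=> x x1; have x0 : 0 < x by exact: lt_le_trans x1.
  rewrite gig_funE// opprK mul1r ler_piMr ?powR_ge0//.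
  rewrite expR_le1 oppr_le0 divr_ge0//.
  by apply: addr_ge0; [apply: mulr_ge0|apply: divr_ge0] => //; exact: ltW.
have [r2 [K2 [r20 K20 h2]]] : exists r K : R, [/\ 0 < r, 0 <= K &
    forall x, 0 < x -> x <= 1 -> gig_fun q c d x <= K * (x `^ (r - 1))].
  have [dp|dn] := ltP 0 d.
    have [C C0 hC] := powR_expR_bounded (1 - q) (divr_gt0 dp (ltr0n R 2)).
    exists 1, C; split => // x x0 x1; rewrite gig_funE// subrr powRr0 mulr1.
    have -> : x `^ (q - 1) = x^-1 `^ (1 - q).
      by rewrite -powR_inv1 ?(ltW x0)// -powRrM mulN1r opprB.
    have y1 : 1 <= x^-1 by rewrite invf_ge1.
    apply: le_trans (hC _ y1).
    rewrite ler_wpM2l ?powR_ge0// ler_expR lerN2 mulrDl [d / 2 * _]mulrAC lerDr.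
    by rewrite divr_ge0// mulr_ge0// ltW.
  have q0 : 0 < q by case: dq => //; rewrite ltNge dn.
  exists q, 1; split => // x x0 x1.
  rewrite gig_funE// mul1r ler_piMr ?powR_ge0//.
  rewrite expR_le1 oppr_le0 divr_ge0//.
  by apply: addr_ge0; [apply: mulr_ge0|apply: divr_ge0] => //; exact: ltW.
exists (Num.min r1 r2), (Num.max K1 K2); split.
- by rewrite lt_min r10.
- by rewrite le_max K10.
- move=> x x1; apply: (le_trans (h1 x x1)).
  apply: ler_pM; rewrite ?powR_ge0// ?le_max ?lexx//.
  by rewrite ler_powR// lerB// lerN2 ge_min lexx.
- move=> x x0 x1; apply: (le_trans (h2 x x0 x1)).
  apply: ler_pM; rewrite ?powR_ge0// ?le_max ?lexx ?orbT//.
  by rewrite ger_powR ?x0// lerB// ge_min lexx orbT.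
Qed.

Lemma integral_gig_pos q c d :
  (gig_mass q c d = \int[mu]_(x in `]0%R, +oo[) (gig_fun q c d x)%:E)%E.
Proof.
rewrite [RHS]integral_mkcond; apply: eq_integral => x _.
rewrite patchE; case: ifPn => // /negP; rewrite inE/= in_itv/= andbT => /negP.
by rewrite -leNgt => x0; rewrite gig_fun_le0.
Qed.

Lemma gig_mass_lty q c d : gig_adm q c d -> (gig_mass q c d < +oo)%E.
Proof.
move=> /gig_fun_tail[r [K [r0 K0 h1 h2]]]; rewrite integral_gig_pos.
have mg := measurable_gig_EFin q c d.
have g0 x : (0 <= (gig_fun q c d x)%:E)%E by rewrite lee_fin gig_fun_ge0.
have cv := cvg_integral_pos_itv mg g0.
apply: (@le_lt_trans _ _ (2 * K / r)%:E); last exact: ltry.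
rewrite -(cvg_lim _ cv)//; apply: lime_le; first exact: cvgP cv.
(* For [i = 0] the interval is a single point, so the split at 1 starts with [i = 1]. *)
exists 1%N => // i /= i1; rewrite /pos_itv.
have a1 : (i.+1%:R^-1 : R) < 1 by rewrite invf_lt1 ?ltr1n.
have b1 : 1 < (i.+1%:R : R) by rewrite ltr1n.
have a0 : 0 < (i.+1%:R^-1 : R) by rewrite invr_gt0.
have -> : `[i.+1%:R^-1, i.+1%:R]%classic = `[(i.+1%:R^-1 : R), 1]%classic `|` `](1 : R), i.+1%:R]%classic.
  apply/seteqP; split => x /=; rewrite !in_itv/=.
    by move=> /andP[-> ->]; rewrite andbT; case: leP => _; [left|right].
  by move=> [/andP[-> h]|/andP[h ->]];
    rewrite ?andbT /= ?(le_trans h (ltW b1))// ltW// (lt_trans a1 h).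
rewrite ge0_integral_setU//=; last 2 first.
- exact: measurable_funTS.
- by apply/disj_setPS => x [/=]; rewrite !in_itv/= => /andP[_ ?] /andP[? _]; lra.
have bound (s u v : R) (A : set R) : s != 0 -> 0 < u -> u < v -> measurable A ->
    A `<=` `[u, v]%classic ->
    (forall x, A x -> gig_fun q c d x <= K * x `^ (s - 1)) ->
    (\int[mu]_(x in A) (gig_fun q c d x)%:E <= (K * ((v `^ s - u `^ s) / s))%:E)%E.
  move=> s0 u0 uv mA Auv hA.
  have mp : measurable_fun [set: R] (fun x : R => (x `^ (s - 1))%:E).
    by apply/measurable_EFinP; exact: measurable_powR.
  have p0 (x : R) : (0 <= (x `^ (s - 1))%:E)%E by rewrite lee_fin powR_ge0.
  rewrite EFinM -integral_powR_itv//.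
  apply: (@le_trans _ _ (\int[mu]_(x in A) (K%:E * (x `^ (s - 1))%:E))%E).
    apply: ge0_le_integral => //.
    - exact: measurable_funTS.
    - by apply: measurable_funeM; exact: measurable_funTS.
  rewrite ge0_integralZl//; last exact: measurable_funTS.
  apply: lee_wpmul2l => //; apply: ge0_subset_integral => //.
  exact: measurable_funTS.
apply: (@le_trans _ _ ((K / r)%:E + (K / r)%:E)); last first.
  by rewrite -EFinD lee_fin; lra.
apply: leeD.
  apply: (le_trans (bound r _ _ _ (lt0r_neq0 r0) a0 a1 _ _ _)) => //.
    move=> x /=; rewrite in_itv/= => /andP[ax x1]; apply: h2 => //.
    exact: lt_le_trans ax.
  rewrite lee_fin powR1 mulrA ler_wpM2r ?invr_ge0 ?(ltW r0)// ler_piMr//.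
have nr0 : - r != 0 by rewrite oppr_eq0 lt0r_neq0.
apply: (le_trans (bound (- r) _ _ _ nr0 ltr01 b1 _ _ _)) => //.
- by move=> x /=; rewrite !in_itv/= => /andP[/ltW -> ->].
- by move=> x /=; rewrite in_itv/= => /andP[/ltW x1 _]; apply: h1.
rewrite lee_fin powR1 invrN mulrN -mulNr opprB mulrA ler_wpM2r ?invr_ge0 ?(ltW r0)// ler_piMr//.
Qed.

Lemma gig_massK q c d : gig_adm q c d -> ((fine (gig_mass q c d))%:E = gig_mass q c d)%E.
Proof. by move=> adm; rewrite fineK// ge0_fin_numE ?gig_mass_ge0 ?gig_mass_lty. Qed.

Lemma fine_gig_mass_gt0 q c d : gig_adm q c d -> 0 < fine (gig_mass q c d).
Proof. by move=> adm; rewrite -lte_fin gig_massK// gig_mass_gt0. Qed.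

Lemma gig_massE q c d : gig_mass q c d = (\int[mu]_x (gig_fun q c d x)%:E)%E.
Proof. by []. Qed.

End gig_integral.

(* keeps unification from comparing integrals up to conversion *)
Opaque gig_mass.

(** * Gaussian absolute moments as inverse gamma masses *)

Section gauss_moment.
Context {R : realType}.
Local Notation mu := (@lebesgue_measure R).

Definition gauss_w (z : R) : R := expR (- (z ^+ 2 / 2)).

Lemma gauss_w_ge0 z : 0 <= gauss_w z. Proof. exact: expR_ge0. Qed.

Lemma measurable_gauss_w : measurable_fun [set: R] gauss_w.
Proof.
apply: measurableT_comp => //; apply: measurable_funN.
by apply: measurable_funM => //; exact: measurable_funX.
Qed.

Lemma measurable_norm_powR (s : R) : measurable_fun [set: R] (fun z : R => `|z| `^ s).
Proof.
apply: (measurableT_comp (measurable_powR _)).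
exact: (@measurableT_comp _ _ _ _ _ _ (@Num.norm _ R) _ id).
Qed.

Lemma measurable_gauss_momentf (s : R) :
  measurable_fun [set: R] (fun z : R => (`|z| `^ s * gauss_w z)%:E).
Proof.
apply/measurable_EFinP; apply: measurable_funM; last exact: measurable_gauss_w.
exact: measurable_norm_powR.
Qed.

Definition gauss_moment (s : R) : \bar R := (\int[mu]_z (`|z| `^ s * gauss_w z)%:E)%E.

Let G (s z : R) : R := z `^ s * gauss_w z.

Lemma continuous_powR_pos (x r : R) : 0 < x -> {for x, continuous (fun y : R => y `^ r)}.
Proof.
move=> x0; apply: differentiable_continuous; apply/derivable1_diffP.
by apply: derivable_powR; rewrite in_itv/= x0.
Qed.

Let substG s (a b : R) : 0 < a -> a < b ->
  (\int[mu]_(z in `[(b `^ (- 2^-1))%R, (a `^ (- 2^-1))%R]) (G s z)%:E =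
   (2^-1)%:E * \int[mu]_(x in `[a, b]) (gig_fun (- 2^-1 - s / 2) 0 1 x)%:E)%E.
Proof.
move=> a0 ab; have b0 : 0 < b by exact: lt_trans ab.
pose F (x : R) : R := x `^ (- 2^-1).
have cF (x : R) : 0 < x -> {for x, continuous F} by move=> ?; exact: continuous_powR_pos.
have dF (x : R) : 0 < x -> F^`()%classic x = - 2^-1 * x `^ (- 2^-1 - 1).
  by move=> x0; rewrite powR_derive1// in_itv/= x0.
have cF' (x : R) : 0 < x -> {for x, continuous F^`()%classic}.
  move=> x0; have cp : {for x, continuous (fun y : R => - 2^-1 * y `^ (- 2^-1 - 1))}.
    by apply: cvgM; [exact: cvg_cst|exact: continuous_powR_pos].
  rewrite /prop_for /continuous_at dF//.
  apply: cvg_trans cp; apply: near_eq_cvg.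
  near=> y; rewrite dF//; near: y; exact: lt_nbhsr.
rewrite -/(F a) -/(F b).
rewrite (@integration_by_substitution_decreasing _ F (G s) a b)//.
- transitivity (\int[mu]_(x in `[a, b]) ((2^-1)%:E * (gig_fun (- 2^-1 - s / 2) 0 1 x)%:E))%E.
    apply: eq_integral => x; rewrite inE/= in_itv/= => /andP[ax _].
    have x0 : 0 < x by exact: lt_le_trans ax.
    rewrite -EFinM; congr EFin => /=.
    rewrite -[LHS]/(G s (F x) * - F^`()%classic x) dF// gig_funE// /G /gauss_w /F.
    have -> : (x `^ (- 2^-1)) ^+ 2 = x^-1.
      by rewrite -powR_mulrn ?powR_ge0// -powRrM mulNr mulVf// powR_inv1 ?(ltW x0).
    have -> : x `^ (- 2^-1 - s / 2 - 1) = x `^ (- 2^-1) `^ s * x `^ (- 2^-1 - 1).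
      by rewrite -powRrM -powRD ?(gt_eqF x0) ?implybT//; congr (_ `^ _); lra.
    by rewrite mul0r add0r mul1r; ring.
  rewrite ge0_integralZl//.
  - by apply: measurable_funTS; exact: measurable_gig_EFin.
  - by move=> x _; rewrite lee_fin gig_fun_ge0.
- exact: ltW.
- move=> x y; rewrite !in_itv/= => /andP[ax _] /andP[ay _] xy.
  have x0 : 0 < x by exact: lt_le_trans ax.
  have y0 : 0 < y by exact: lt_le_trans ay.
  by rewrite /F !powRN ltf_pV2 ?posrE ?powR_gt0// gt0_ltr_powR// ?nnegrE ltW.
- move=> x; rewrite in_itv/= => /andP[ax _]; apply: cF'; exact: lt_trans ax.
- by apply: (cvgP (F^`()%classic a)); apply: cvg_at_right_filter; exact: cF'.
- by apply: (cvgP (F^`()%classic b)); apply: cvg_at_left_filter; exact: cF'.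
- split.
  + move=> x; rewrite in_itv/= => /andP[ax _]; apply: derivable_powR.
    by rewrite in_itv/= andbT (lt_trans a0).
  + by apply: cvg_at_right_filter; exact: cF.
  + by apply: cvg_at_left_filter; exact: cF.
- apply: continuous_in_subspaceT => z; rewrite inE/= in_itv/= => /andP[bz _].
  have z0 : 0 < z by apply: lt_le_trans bz; rewrite powR_gt0.
  apply: cvgM; first exact: continuous_powR_pos.
  apply: (cvg_comp _ expR); last exact: continuous_expR.
  apply: (@cvgN _ R^o); apply: cvgM; last exact: cvg_cst.
  exact: sqr_continuous.
Unshelve. all: by end_near. Qed.

Let mG s : measurable_fun [set: R] (fun z => (G s z)%:E).
Proof.
apply/measurable_EFinP; apply: measurable_funM; last exact: measurable_gauss_w.
exact: measurable_powR.
Qed.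

Let G0 s z : (0 <= (G s z)%:E)%E.
Proof. by rewrite lee_fin mulr_ge0 ?powR_ge0 ?gauss_w_ge0. Qed.

Let integral_G s : (\int[mu]_(z in `]0%R, +oo[) (G s z)%:E =
  (2^-1)%:E * gig_mass (- 2^-1 - s / 2) 0 1)%E.
Proof.
have mg := @measurable_gig_EFin R (- 2^-1 - s / 2) 0 1.
have g0 x : (0 <= (gig_fun (- 2^-1 - s / 2) 0 1 x)%:E :> \bar R)%E.
  by rewrite lee_fin gig_fun_ge0.
have sub (u v : R) : 0 < u -> `[u, v]%classic `<=` `]0, +oo[%classic.
  move=> u0 x /=; rewrite !in_itv/= andbT => /andP[ux _]; exact: lt_le_trans ux.
rewrite integral_gig_pos; apply/eqP; rewrite eq_le; apply/andP; split.
- have cv := cvg_integral_pos_itv (mG s) (G0 s).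
  rewrite -(cvg_lim _ cv)//; apply: lime_le; first exact: cvgP cv.
  exists 1%N => // i /= i1.
  (* Since [z = x^(-1/2)], the endpoints for [x] are the squares of those for [z]. *)
  have a0 : 0 < (i.+1%:R ^- 2 : R) by rewrite invr_gt0 exprn_gt0.
  have ab : (i.+1%:R ^- 2 : R) < i.+1%:R ^+ 2.
    apply: (@lt_trans _ _ 1).
      by rewrite invf_lt1 ?exprn_gt0// exprn_egt1// ltr1n.
    by rewrite exprn_egt1// ltr1n.
  have := substG s a0 ab.
  have h0 : 0 <= (i.+1%:R : R) by [].
  have -> : ((i.+1%:R ^- 2 : R) `^ (- 2^-1) = i.+1%:R).
    by rewrite -powR_invn// -powRrM mulrNN divff// powRr1.
  have -> : ((i.+1%:R ^+ 2 : R) `^ (- 2^-1) = i.+1%:R^-1).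
    by rewrite -powR_mulrn// -powRrM mulrN divff// powR_inv1.
  rewrite -/(pos_itv i) => ->; apply: lee_wpmul2l => //.
  apply: ge0_subset_integral => //; first exact: measurable_funTS.
  exact: sub.
- have cv := cvg_integral_pos_itv mg g0.
  rewrite -(cvg_lim _ cv)// -limeMl//; last exact: cvgP cv.
  apply: lime_le; first by apply: is_cvgeMl => //; exact: cvgP cv.
  exists 1%N => // i /= i1; rewrite /pos_itv -substG//; last first.
    apply: (@lt_trans _ _ 1); first by rewrite invf_lt1 ?ltr1n.
    by rewrite ltr1n.
  apply: ge0_subset_integral; [exact: measurable_itv|exact: measurable_itv| | |].
  - exact: measurable_funTS (mG s).
  - by move=> z _; exact: G0.
  by apply: sub; rewrite powR_gt0.
Qed.

(** The substitution [z = x^(-1/2)] turns [z^s exp(- z^2 / 2) dz] on the positive half-line into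
    half of the GIG weight with [c = 0] and [d = 1]; the two half-lines restore the factor. Moments
    of both Gibbs steps thus become values of a single function of the index, so their products can
    be compared by convexity. *)
Lemma gauss_momentE s : gauss_moment s = gig_mass (- 2^-1 - s / 2) 0 1.
Proof.
pose h (z : R) : \bar R := ((fun z => (G s z)%:E) \_ `]0%R, +oo[) z.
have mh : measurable_fun [set: R] h.
  apply/(measurable_restrictT _ _).1 => //; exact: measurable_funTS.
have h0 z : (0 <= h z)%E by apply: erestrict_ge0 => x _; exact: G0.
have hE z : 0 < z -> h z = (G s z)%:E.
  by move=> z0; rewrite /h patchE mem_set//= in_itv/= z0.
have hE0 z : z <= 0 -> h z = 0%E.
  by move=> z0; rewrite /h patchE memNset//= in_itv/= andbT => /lt_geF; rewrite z0.
have mhN : measurable_fun [set: R] (fun z => h (- z)).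
  by apply: (measurableT_comp mh).
transitivity (\int[mu]_z (h z + h (- z)%R))%E.
  apply: ge0_ae_eq_integral => //.
  - exact: measurable_gauss_momentf.
  - exact: emeasurable_funD.
  - by move=> z _; rewrite lee_fin mulr_ge0 ?powR_ge0 ?gauss_w_ge0.
  - by move=> z _; rewrite adde_ge0.
  exists [set (0 : R)]; split; [exact: measurable_set1|exact: lebesgue_measure_set1|].
  move=> z /= hz; apply: contrapT => /eqP z0; apply: hz => _.
  have [zn|zp|z00] := ltgtP z 0; last by rewrite z00 eqxx in z0.
  - rewrite (hE0 z (ltW zn)) hE ?oppr_gt0// add0e /G ltr0_norm//.
    by rewrite /gauss_w sqrrN.
  - by rewrite (hE0 (- z)) ?oppr_le0 ?(ltW zp)// hE// adde0 /G gtr0_norm.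
rewrite ge0_integralD// integral_opp//.
have -> : (\int[mu]_x h x = (2^-1)%:E * gig_mass (- 2^-1 - s / 2) 0 1)%E.
  by rewrite -integral_G [RHS]integral_mkcond.
rewrite -ge0_muleDl ?lee_fin// -EFinD.
by rewrite (_ : 2^-1 + 2^-1 = 1 :> R) ?mul1e//; lra.
Qed.

Lemma gauss_moment_lty s : -1 < s -> (gauss_moment s < +oo)%E.
Proof.
move=> s1; rewrite gauss_momentE gig_mass_lty//; split => //.
- by right; lra.
- by left.
Qed.

Lemma gauss_moment_gt0 s : (0 < gauss_moment s)%E.
Proof. by rewrite gauss_momentE gig_mass_gt0. Qed.

End gauss_moment.

(** [4 a b U V <= (b U + a V)^2 < 4 T^2 = 4 a b S T]. *)
Lemma amgm_product (R : realFieldType) (a b S T U V : R) :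
  0 < a -> 0 < b -> 0 < S -> 0 < T -> 0 < U -> 0 < V -> T = a * b * S ->
  b * U + a * V < T + T -> U * V < S * T.
Proof.
move=> a0 b0 S0 T0 U0 V0 TE h.
have h2 : (b * U + a * V) ^+ 2 < (T + T) ^+ 2.
  by rewrite ltr_pXn2r ?nnegrE ?addr_ge0 ?mulr_ge0// ltW.
have h3 := sqr_ge0 (b * U - a * V).
have ab0 : 0 < a * b by exact: mulr_gt0.
rewrite -(ltr_pM2l ab0); suff : 4 * (a * b * (U * V)) < 4 * (a * b * (S * T)) by lra.
have -> : 4 * (a * b * (S * T)) = (T + T) ^+ 2 by rewrite TE; ring.
apply: le_lt_trans h2.
have -> : (b * U + a * V) ^+ 2 = (b * U - a * V) ^+ 2 + 4 * (a * b * (U * V)) by ring.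
by rewrite lerDr.
Qed.

(** * Strict log-convexity of the inverse gamma moments *)

Section log_convexity.
Context {R : realType}.
Implicit Types s x y alpha beta : R.
Local Notation mu := (@lebesgue_measure R).
Let j s := fine (gig_mass s 0 (1 : R)).

Let adm0 s : s < 0 -> gig_adm s 0 (1 : R).
Proof. by move=> s0; split => //; [right|left]. Qed.

(* [(x ^ alpha - y ^ alpha) (x ^ beta - y ^ beta) >= 0], strictly for [x <> y];
   optimizing over [y] then gives the product form. *)
Let three_point s alpha beta y : 0 < alpha -> 0 < beta -> s + alpha + beta < 0 -> 0 < y ->
  y `^ beta * j (s + alpha) + y `^ alpha * j (s + beta) <
  j (s + alpha + beta) + y `^ alpha * y `^ beta * j s.
Proof.
move=> al0 be0 sab y0.
pose g := gig_fun s 0 (1 : R).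
have mg := @measurable_gig_fun_arg R s 0 1.
pose k x := g x * ((x `^ alpha - y `^ alpha) * (x `^ beta - y `^ beta)).
have k0 x : 0 <= k x.
  have [x0|x0] := leP x 0; first by rewrite /k /g gig_fun_le0// mul0r.
  rewrite mulr_ge0 ?gig_fun_ge0//.
  have [xy|yx] := leP x y.
    by rewrite mulr_le0// subr_le0 ge0_ler_powR// ?nnegrE ltW.
  by rewrite mulr_ge0// subr_ge0 ge0_ler_powR// ?nnegrE ltW.
have mpow r : measurable_fun [set: R] (fun x : R => x `^ r) by exact: measurable_powR.
have mk : measurable_fun [set: R] (fun x => (k x)%:E).
  apply/measurable_EFinP; apply: measurable_funM => //.
  by apply: measurable_funM; apply: measurable_funB.
have Ik : (0 < \int[mu]_x (k x)%:E)%E.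
  have mu01 : (0 < mu `]y, (y + 1)%R]%classic)%E.
    by rewrite lebesgue_measure_itv/= lte_fin ltrDl ltr01 -EFinB lte_fin; lra.
  apply: (@ge0_integral_gt0 _ _ _ mu (fun x => (k x)%:E) `]y, (y + 1)%R]%classic) => //.
  move=> x /=; rewrite in_itv/= => /andP[yx _]; have x0 : 0 < x by exact: lt_trans yx.
  by rewrite lte_fin mulr_gt0 ?gig_fun_gt0// mulr_gt0// subr_gt0 gt0_ltr_powR// ?nnegrE ltW.
have E1 : (\int[mu]_x (y `^ beta * gig_fun (s + alpha) 0 1 x + y `^ alpha * gig_fun (s + beta) 0 1 x)%:E
    + \int[mu]_x (k x)%:E =
    \int[mu]_x (gig_fun (s + alpha + beta) 0 1 x + (y `^ alpha * y `^ beta) * g x)%:E)%E.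
  pose l x := (y `^ beta * gig_fun (s + alpha) 0 1 x + y `^ alpha * gig_fun (s + beta) 0 1 x)%:E.
  have l0 x : setT x -> (0 <= l x)%E.
    by rewrite lee_fin addr_ge0// mulr_ge0 ?powR_ge0 ?gig_fun_ge0.
  have ml : measurable_fun [set: R] l.
    apply/measurable_EFinP; apply: measurable_funD; apply: measurable_funM => //;
      exact: measurable_gig_fun_arg.
  have k0E x : setT x -> (0 <= (k x)%:E)%E by rewrite lee_fin.
  rewrite -(ge0_integralD mu measurableT l0 ml k0E mk).
  apply: eq_integral => x _; rewrite -EFinD; congr EFin.
  have [x0|x0] := leP x 0.
    by rewrite /k /g !gig_fun_le0//; ring.
  by rewrite /k /g !gig_fun_powR//; ring.
have lin (u v a b : R) : 0 <= u -> 0 <= v -> a < 0 -> b < 0 ->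
    (\int[mu]_x (u * gig_fun a 0 1 x + v * gig_fun b 0 1 x)%:E = (u * j a + v * j b)%:E)%E.
  move=> u0 v0 a0 b0; under eq_integral do rewrite EFinD !EFinM.
  have mga := @measurable_gig_EFin R a 0 1; have mgb := @measurable_gig_EFin R b 0 1.
  have ga x : (0 <= (gig_fun a 0 1 x)%:E :> \bar R)%E by rewrite lee_fin gig_fun_ge0.
  have gb x : (0 <= (gig_fun b 0 1 x)%:E :> \bar R)%E by rewrite lee_fin gig_fun_ge0.
  rewrite ge0_integralD//; last 4 first.
  - by move=> x _; rewrite mule_ge0.
  - exact: measurable_funeM.
  - by move=> x _; rewrite mule_ge0.
  - exact: measurable_funeM.
  have u0E : (0 <= u%:E)%E by rewrite lee_fin.
  have v0E : (0 <= v%:E)%E by rewrite lee_fin.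
  rewrite (ge0_integralZl mu measurableT mga (fun x _ => ga x) u0E).
  rewrite (ge0_integralZl mu measurableT mgb (fun x _ => gb x) v0E).
  by rewrite EFinD !EFinM (gig_massK (adm0 a0)) (gig_massK (adm0 b0)).
have s0 : s < 0 by lra.
have sa0 : s + alpha < 0 by lra.
have sb0 : s + beta < 0 by lra.
move: E1; rewrite lin ?powR_ge0//.
under [in RHS]eq_integral do rewrite -[gig_fun (s + alpha + beta) _ _ _]mul1r.
rewrite lin ?mulr_ge0 ?powR_ge0//.
move: Ik; case: (\int[mu]_x (k x)%:E)%E => [r| |]//.
by rewrite lte_fin -EFinD mul1r => r0 [<-]; rewrite ltrDl.
Qed.

Lemma gig_mass_strict_log_convex s alpha beta :
  0 < alpha -> 0 < beta -> s + alpha + beta < 0 ->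
  j (s + alpha) * j (s + beta) < j s * j (s + alpha + beta).
Proof.
move=> al0 be0 sab.
have s0 : s < 0 by lra.
have sa0 : s + alpha < 0 by lra.
have sb0 : s + beta < 0 by lra.
have js : 0 < j s by apply/fine_gig_mass_gt0/adm0.
have jt : 0 < j (s + alpha + beta) by apply/fine_gig_mass_gt0/adm0.
have j1 : 0 < j (s + alpha) by apply/fine_gig_mass_gt0/adm0.
have j2 : 0 < j (s + beta) by apply/fine_gig_mass_gt0/adm0.
have H y : 0 < y -> _ := @three_point s alpha beta y al0 be0 sab.
move: js jt j1 j2 H; move: (j s) (j (s + alpha)) (j (s + beta)) (j (s + alpha + beta)).
(* This [y] satisfies [y^alpha * y^beta = T / S], so that both terms on the right of [three_point]
   equal [T]. *)
move=> S U V T S0 T0 U0 V0 H; pose y := (T / S) `^ (alpha + beta)^-1.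
have y0 : 0 < y by rewrite powR_gt0// divr_gt0.
have := H y y0.
have : y `^ alpha * y `^ beta = T / S.
  rewrite -powRD ?(gt_eqF y0) ?implybT// -powRrM mulVf ?powRr1 ?divr_ge0 ?(ltW S0) ?(ltW T0)//.
  by rewrite gt_eqF// addr_gt0.
have a0 : 0 < y `^ alpha by rewrite powR_gt0.
have b0 : 0 < y `^ beta by rewrite powR_gt0.
move: (y `^ alpha) (y `^ beta) a0 b0 => a b a0 b0 abE.
have Sn := lt0r_neq0 S0; rewrite abE divfK//.
have TE : T = a * b * S by rewrite abE divfK.
move=> h; exact: (amgm_product a0 b0 S0 T0 U0 V0 TE h).
Qed.

End log_convexity.

(** * Real arithmetic behind the moment estimates *)

Section moment_algebra.
Variable R : realType.
Implicit Types c d t theta w m mi : R.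

Lemma scaling_alg (T u v m0 m1 mi : R) :
  0 <= T * m0 + (u * m1 + (v * mi + -1 * m0)) -> m0 <= T * m0 + u * m1 + v * mi.
Proof. lra. Qed.

(** The scaling inequality gives [m2 <= C1 m1 + d / (c t) m0]. Absorbing [C1 m1] into [(1 - t) m2]
    costs a factor [1 / t], so the leading coefficient becomes [d / c] times [t ^- 2], which is at
    most [theta] times [d / c]. *)
Lemma second_moment_alg c d t theta w m0 m1 m2 :
  let C1 := 2 * (w - 1) / (c * (1 - t)) in
  let C2 := C1 ^+ 2 / (4 * (1 - t)) in
  0 < c -> 0 < t -> t < 1 -> 0 < theta -> theta^-1 <= t ^+ 2 -> 0 <= d -> 0 < m0 ->
  C1 * m1 <= (1 - t) * m2 + C2 * m0 ->
  m1 <= w * m1 + c * (t - 1) / 2 * m2 + d * (t^-1 - 1) / 2 * m0 ->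
  m2 <= (theta * (d / c) + (C2 / t + 1)) * m0.
Proof.
move=> C1 C2 c0 t0 t1 th0 tt d0 m00 sq h.
have t1' : 0 < 1 - t by rewrite subr_gt0.
have h1 : c * (1 - t) / 2 * m2 <= c * (1 - t) / 2 * (C1 * m1) + d * (t^-1 - 1) / 2 * m0.
  have -> : c * (1 - t) / 2 * (C1 * m1) = (w - 1) * m1.
    by rewrite /C1; field; rewrite (gt_eqF c0) (gt_eqF t1').
  by move: h; clear; lra.
have h2 : m2 <= C1 * m1 + d / (c * t) * m0.
  have p0 : 0 < c * (1 - t) / 2 by rewrite divr_gt0// mulr_gt0.
  rewrite -(ler_pM2l p0); apply: (le_trans h1); rewrite [leRHS]mulrDr lerD2l.
  rewrite le_eqVlt; apply/orP; left; apply/eqP; field.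
  by rewrite (gt_eqF c0) (gt_eqF t0).
have h3 : t * m2 <= (C2 + d / (c * t)) * m0.
  by move: sq h2; move: (d / (c * t)) (C1 * m1) C2; clear => *; lra.
have h4 : m2 <= (C2 / t + d / c * t ^- 2) * m0.
  rewrite -(ler_pM2l t0); apply: (le_trans h3).
  rewrite le_eqVlt; apply/orP; left; apply/eqP; clear sq h3; move: C2 => C2; field.
  by rewrite (gt_eqF c0) (gt_eqF t0).
apply: (le_trans h4); rewrite ler_wpM2r ?(ltW m00)//.
have h5 : d / c * t ^- 2 <= theta * (d / c).
  rewrite mulrC ler_wpM2r ?divr_ge0 ?(ltW c0)//.
  by rewrite -[leRHS]invrK lef_pV2 ?posrE ?exprn_gt0 ?invr_gt0.
by move: h5; move: (d / c * t ^- 2) (theta * (d / c)) (C2 / t); clear => *; lra.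
Qed.

Lemma first_moment_alg (r s m0 m1 m2 : R) : 0 < r -> r ^+ 2 = s ->
  2 * r * m1 <= m2 + s * m0 -> m2 <= s * m0 -> m1 <= r * m0.
Proof.
move=> r0 rE h h2.
have h3 : 2 * r * m1 <= 2 * r * (r * m0).
  rewrite (_ : 2 * r * (r * m0) = s * m0 + s * m0); first by move: h h2; clear; lra.
  by rewrite -rE; ring.
by rewrite ler_pM2l ?mulr_gt0// in h3.
Qed.

(** At [t = 2] the scaling inequality carries the inverse moment with the negative coefficient
    [- d / 4], hence bounds it by [m0] and [m1]. The crude [sqrt s <= 1 + s] is linear in [d], and
    dividing by [d >= delta] makes the constant uniform. *)
Lemma inverse_moment_alg c d delta C w m0 m1 mi :
  0 < c -> 0 < delta -> 0 < C -> 0 <= w -> delta <= d -> 0 < d -> 0 < m0 -> 0 < mi ->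
  m1 <= Num.sqrt (2 * (d / c) + C) * m0 ->
  m0 <= w * m0 + c * (2 - 1) / 2 * m1 + d * (2^-1 - 1) / 2 * mi ->
  mi <= 4 * (w / delta + c / 2 * (1 / delta + 2 / c + C / delta)) * m0.
Proof.
move=> c0 de0 C0 w0 ded d0 m00 mi0; set s := 2 * (d / c) + C => h1 h2.
have s0 : 0 < s by rewrite ltr_wpDl// mulr_ge0// divr_ge0// ltW.
have h3 : Num.sqrt s <= 1 + s.
  have := sqr_ge0 (Num.sqrt s - 1).
  have -> : (Num.sqrt s - 1) ^+ 2 = Num.sqrt s ^+ 2 - 2 * Num.sqrt s + 1 by ring.
  rewrite sqr_sqrtr ?(ltW s0)//; have := sqrtr_ge0 s.
  by clear h1; move: s (Num.sqrt s) s0; clear => *; lra.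
have h4 : m1 <= (1 + s) * m0.
  by apply: (le_trans h1); rewrite ler_wpM2r// ltW.
have h5 : d / 4 * mi <= w * m0 + c / 2 * ((1 + s) * m0).
  have : c / 2 * m1 <= c / 2 * ((1 + s) * m0) by rewrite ler_wpM2l// divr_ge0// ltW.
  by move: h2 m00; move: ((1 + s) * m0); clear => *; lra.
have h6 : w + c / 2 * (1 + s) <=
    d / 4 * (4 * (w / delta + c / 2 * (1 / delta + 2 / c + C / delta))).
  rewrite (_ : d / 4 * _ = w * (d / delta) +
     c / 2 * ((d / delta) + 2 * (d / c) + C * (d / delta))); last first.
    by field; rewrite (gt_eqF c0) (gt_eqF de0).
  have dd : 1 <= d / delta by rewrite ler_pdivlMr// mul1r.
  apply: lerD; first by rewrite ler_peMr.
  rewrite ler_wpM2l ?divr_ge0 ?(ltW c0)// /s.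
  have : C <= C * (d / delta) by rewrite ler_peMr// ltW.
  by move: dd; move: (d / delta) (C * (d / delta)) (2 * (d / c)); clear => *; lra.
have d4 : 0 < d / 4 by rewrite divr_gt0.
rewrite -(ler_pM2l d4); apply: (le_trans h5).
rewrite [leRHS]mulrA [c / 2 * _]mulrA -mulrDl.
by rewrite ler_wpM2r// ltW.
Qed.

Lemma neg_moment_small_alg (kappa jq Me dq du C m m' : R) :
  0 <= kappa -> 0 <= jq -> 0 < Me -> 0 <= du -> 0 <= C -> 0 <= m ->
  m' <= dq * du * jq -> dq * Me <= m -> kappa * m' <= (kappa * jq / Me * du + C) * m.
Proof.
move=> k0 j0 Me0 du0 C0 m0 h1 h2.
apply: (@le_trans _ _ (kappa * jq / Me * du * m)); last first.
  by rewrite ler_wpM2r// lerDl.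
apply: (@le_trans _ _ (kappa * (dq * du * jq))); first by rewrite ler_wpM2l.
have -> : kappa * (dq * du * jq) = kappa * jq / Me * du * (dq * Me).
  by field; rewrite (gt_eqF Me0).
by rewrite ler_wpM2l// mulr_ge0// divr_ge0 ?mulr_ge0// ltW.
Qed.

End moment_algebra.

(** * GIG moment estimates with constants uniform in the second scale parameter *)

Section gig_moments.
Context {R : realType}.
Implicit Types q c d x t u : R.
Local Notation mu := (@lebesgue_measure R).
Local Notation gm q c d := (fine (gig_mass q c d)).

Lemma gig_massP q c d : gig_adm q c d -> exists2 m : R, 0 < m & gig_mass q c d = m%:E.
Proof.
move=> adm; exists (gm q c d); first exact: fine_gig_mass_gt0.
by rewrite gig_massK.
Qed.

Lemma gig_moment q s c d :
  (\int[mu]_x (x `^ s * gig_fun q c d x)%:E = gig_mass (q + s) c d)%E.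
Proof.
apply: eq_integral => x _; have [x0|x0] := leP x 0.
  by rewrite !gig_fun_le0// mulr0.
by rewrite gig_fun_powR.
Qed.

Lemma gig_integrable q c d : gig_adm q c d ->
  mu.-integrable setT (fun x => (gig_fun q c d x)%:E).
Proof.
move=> adm; apply/integrableP; split; first exact: measurable_gig_EFin.
have -> : (\int[mu]_x `|(gig_fun q c d x)%:E| = gig_mass q c d)%E.
  by apply: eq_integral => x _; rewrite gee0_abs// lee_fin gig_fun_ge0.
exact: gig_mass_lty.
Qed.

(** Integrability is kept next to the value, so that linear combinations with negative coefficients
    integrate without differences of infinities. *)
Definition has_integral (f : R -> R) (v : R) :=
  mu.-integrable setT (fun x => (f x)%:E) /\ (\int[mu]_x (f x)%:E = v%:E)%E.

Lemma has_integral_gig q c d : gig_adm q c d -> has_integral (gig_fun q c d) (gm q c d).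
Proof. by move=> adm; split; [exact: gig_integrable|rewrite gig_massK]. Qed.

Lemma has_integralD f g v w : has_integral f v -> has_integral g w ->
  has_integral (fun x => f x + g x) (v + w).
Proof.
move=> [fi fv] [gi gw]; split.
  by under eq_fun do rewrite EFinD; exact: integrableD.
by under eq_integral do rewrite EFinD; rewrite integralD// fv gw EFinD.
Qed.

Lemma has_integralZ f v k : has_integral f v -> has_integral (fun x => k * f x) (k * v).
Proof.
move=> [fi fv]; split.
  by under eq_fun do rewrite EFinM; exact: integrableZl.
by under eq_integral do rewrite EFinM; rewrite integralZl// fv EFinM.
Qed.

Lemma has_integral_ge0 f v : has_integral f v -> (forall x, 0 <= f x) -> 0 <= v.
Proof.
move=> [_ fv] f0; rewrite -lee_fin -fv; apply: integral_ge0 => x _.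
by rewrite lee_fin.
Qed.



(** The densities with parameters [(c t, d / t)] and [(c, d)] are compared pointwise by
    [exp y >= 1 + y], and scaling evaluates the mass of the former. This plays the role of
    integration by parts, which is the first order of the inequality at [t = 1]. *)
Lemma gig_scaling_ineq q c d t : 0 < t -> gig_adm (q - 1) c d -> gig_adm q c d ->
  gig_adm (q + 1) c d ->
  gm q c d <= t `^ (- q) * gm q c d + c * (t - 1) / 2 * gm (q + 1) c d
    + d * (t^-1 - 1) / 2 * gm (q - 1) c d.
Proof.
move=> t0 adm1 adm adm2.
have admt : gig_adm q (c * t) (d / t).
  case: adm => c0 d0 h1 h2; split.
  - by rewrite mulr_ge0// ltW.
  - by rewrite divr_ge0// ltW.
  - by case: h1 => h; [left; rewrite mulr_gt0|right].
  - by case: h2 => h; [left; rewrite divr_gt0|right].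
have tE : gm q (c * t) (d / t) = t `^ (- q) * gm q c d.
  rewrite [in RHS](gig_mass_scale q c d t0) -(gig_massK admt) -EFinM /=.
  by rewrite mulrA powRN mulVf ?mul1r// gt_eqF// powR_gt0.
have := has_integralD (has_integral_gig admt) (has_integralD
  (has_integralZ (c * (t - 1) / 2) (has_integral_gig adm2)) (has_integralD
  (has_integralZ (d * (t^-1 - 1) / 2) (has_integral_gig adm1))
  (has_integralZ (-1) (has_integral_gig adm)))).
move=> /has_integral_ge0 E.
apply: scaling_alg; rewrite -tE; apply: E => x.
have [x0|x0] := leP x 0; first by rewrite !gig_fun_le0// !mulr0 !addr0.
rewrite (gig_fun_powR q 1)// (gig_fun_powR q (-1))// powRr1 ?powR_inv1 ?(ltW x0)//.
have -> : gig_fun q (c * t) (d / t) x =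
    gig_fun q c d x * expR (- (c * (t - 1) / 2 * x) - d * (t^-1 - 1) / 2 / x).
  rewrite !gig_funE// -[RHS]mulrA -expRD; congr (_ * expR _).
  by field; rewrite (gt_eqF t0) (gt_eqF x0).
set y := (X in expR X); have y1 := expR_ge1Dx y.
rewrite (_ : _ + _ = gig_fun q c d x * (expR y - (1 + y))); last first.
  by move: (expR y) => e; rewrite /y; ring.
by rewrite mulr_ge0 ?gig_fun_ge0// subr_ge0.
Qed.

Lemma gig_adm_up q s c d : 0 < c -> 0 <= s -> gig_adm q c d -> gig_adm (q + s) c d.
Proof.
move=> c0 s0 [h1 h2 h3 h4]; split => //; first by left.
by case: h4 => h; [left|right; rewrite ltr_wpDr].
Qed.

(** For large [d] the law concentrates near [sqrt (d / c)], so the second moment is asymptotic to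
    [d / c]; the slack [theta > 1] buys an additive constant independent of [d]. *)
Lemma gig_second_moment q c theta : 0 < c -> 1 < theta ->
  exists2 C : R, 0 < C & forall d, gig_adm q c d ->
    gm (q + 2) c d <= (theta * (d / c) + C) * gm q c d.
Proof.
move=> c0 th1.
(* Below 1, and [t^2 >= theta^-1] by the inequality of arithmetic and geometric means. *)
pose t := (1 + theta^-1) / 2.
have th0 : 0 < theta by exact: lt_trans th1.
have thV : 0 < theta^-1 < 1 by rewrite invr_gt0 th0/= invf_lt1.
have t01 : 0 < t < 1 by rewrite /t; lra.
have [t0 t1] := andP t01.
have tt : theta^-1 <= t ^+ 2.
  rewrite /t; have := sqr_ge0 (1 - theta^-1); move: theta^-1 => y; nra.
pose C1 := 2 * (t `^ (- (q + 1)) - 1) / (c * (1 - t)).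
pose C2 := C1 ^+ 2 / (4 * (1 - t)).
have C20 : 0 <= C2 by rewrite divr_ge0 ?sqr_ge0//; lra.
exists (C2 / t + 1); first by rewrite ltr_wpDl// divr_ge0// ltW.
move=> d adm.
have d0 : 0 <= d by case: adm.
have adm1 : gig_adm (q + 1) c d by exact: gig_adm_up.
have adm2 : gig_adm (q + 2) c d by exact: gig_adm_up.
(* Taken at index [q + 1], the inequality involves the moments of orders 0, 1 and 2 relative to
   [q]. *)
have := @gig_scaling_ineq (q + 1) c d t t0.
rewrite addrK -addrA (_ : 1 + 1 = 2 :> R)// => /(_ adm adm1 adm2).
have m00 := fine_gig_mass_gt0 adm.
have sq : C1 * gm (q + 1) c d <= (1 - t) * gm (q + 2) c d + C2 * gm q c d.
  have := has_integralD (has_integralZ (- C1) (has_integral_gig adm1)) (has_integralD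
    (has_integralZ (1 - t) (has_integral_gig adm2)) (has_integralZ C2 (has_integral_gig adm))).
  move=> /has_integral_ge0 E.
  rewrite -subr_ge0 (_ : _ - _ = - C1 * gm (q + 1) c d +
    ((1 - t) * gm (q + 2) c d + C2 * gm q c d)); last first.
    by rewrite mulNr addrC.
  apply: E => x.
  have [x0|x0] := leP x 0; first by rewrite !gig_fun_le0// !mulr0 !addr0.
  rewrite (gig_fun_powR q 1)// (gig_fun_powR q 2)// powRr1 ?(ltW x0)// powR_mulrn ?(ltW x0)//.
  rewrite (_ : _ + _ = gig_fun q c d x * ((1 - t) * (x - C1 / (2 * (1 - t))) ^+ 2)).
    by rewrite mulr_ge0 ?gig_fun_ge0// mulr_ge0 ?sqr_ge0//; lra.
  by rewrite /C2; field; lra.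
exact: (@second_moment_alg _ _ _ _ _ (t `^ (- (q + 1)))).
Qed.

(** Jensen's inequality, in the form [(x - r)^2 >= 0] with [r] the square root of the bound on the
    second moment. *)
Lemma gig_first_moment q c theta : 0 < c -> 1 < theta ->
  exists2 C : R, 0 < C & forall d, gig_adm q c d ->
    gm (q + 1) c d <= Num.sqrt (theta * (d / c) + C) * gm q c d.
Proof.
move=> c0 th1; have [C C0 hC] := @gig_second_moment q c theta c0 th1.
exists C => // d adm.
have d0 : 0 <= d by case: adm.
set s := theta * (d / c) + C.
have s0 : 0 < s.
  by rewrite /s ltr_wpDl// mulr_ge0 ?divr_ge0// ltW// (lt_trans _ th1).
have m00 := fine_gig_mass_gt0 adm.
pose r := Num.sqrt s.
have r0 : 0 < r by rewrite sqrtr_gt0.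
have rE : r ^+ 2 = s by rewrite sqr_sqrtr// ltW.
have adm1 : gig_adm (q + 1) c d by exact: gig_adm_up.
have adm2 : gig_adm (q + 2) c d by exact: gig_adm_up.
have h : 2 * r * gm (q + 1) c d <= gm (q + 2) c d + s * gm q c d.
  have := has_integralD (has_integralZ (- (2 * r)) (has_integral_gig adm1)) (has_integralD
    (has_integral_gig adm2) (has_integralZ s (has_integral_gig adm))).
  move=> /has_integral_ge0 E.
  rewrite -subr_ge0 (_ : _ - _ = - (2 * r) * gm (q + 1) c d +
    (gm (q + 2) c d + s * gm q c d)); last first.
    by rewrite mulNr addrC.
  apply: E => x.
  have [x0|x0] := leP x 0; first by rewrite !gig_fun_le0// !mulr0 !addr0.
  rewrite (gig_fun_powR q 1)// (gig_fun_powR q 2)// powRr1 ?(ltW x0)// powR_mulrn ?(ltW x0)//.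
  rewrite (_ : _ + _ = gig_fun q c d x * (x - r) ^+ 2).
    by rewrite mulr_ge0 ?gig_fun_ge0// sqr_ge0.
  by rewrite -rE; ring.
have := hC d adm; rewrite -/s -/r.
by move=> h2; exact: (first_moment_alg r0 rE h h2).
Qed.

Lemma gig_inverse_moment q c delta : 0 < c -> 0 < delta ->
  exists2 C : R, 0 < C & forall d, delta <= d ->
    gm (q - 1) c d <= C * gm q c d.
Proof.
move=> c0 de0; have [C C0 hC] := @gig_first_moment q c 2 c0 (ltr1n R 2).
pose C' := 4 * (2 `^ (- q) / delta + c / 2 * (1 / delta + 2 / c + C / delta)).
have C'0 : 0 < C'.
  rewrite mulr_gt0// ltr_wpDl ?divr_ge0 ?powR_ge0 ?(ltW de0)//.
  by rewrite mulr_gt0 ?divr_gt0// !addr_gt0 ?divr_gt0.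
exists C' => // d ded; have d0 : 0 < d by exact: lt_le_trans ded.
have adm r : gig_adm r c d by split; [exact: ltW|exact: ltW|left|left].
have := @gig_scaling_ineq q c d 2 (ltr0n R 2) (adm _) (adm _) (adm _).
have := hC d (adm _).
have m00 := fine_gig_mass_gt0 (adm q); have m10 := fine_gig_mass_gt0 (adm (q - 1)).
move=> h1 h2; exact: (inverse_moment_alg _ _ _ _ _ _ _ _ h1 h2).
Qed.

Lemma gig_mass_inv_gamma q d : 0 < d -> gig_mass q 0 d = ((d `^ q)%:E * gig_mass q 0 (1 : R))%E.
Proof. by move=> d0; rewrite (gig_mass_scale q 0 d d0) mul0r divff// gt_eqF. Qed.

(** Monotone convergence as the first scale parameter decreases to 0. The claim is a strict lower
    bound in the extended reals because the limit may be infinite. *)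
Lemma gig_mass_cvg0 q (k : \bar R) : (k < gig_mass q 0 (1 : R))%E ->
  exists2 e : R, 0 < e & (k < gig_mass q e (1 : R))%E.
Proof.
move=> kq; apply: contrapT => nex.
pose F (n : nat) x : \bar R := (gig_fun q n.+1%:R^-1 1 x)%:E.
have F0 n x : (0 <= F n x)%E by rewrite lee_fin gig_fun_ge0.
have mF n : measurable_fun [set: R] (F n) by exact: measurable_gig_EFin.
have ndF x : {homo F ^~ x : n m / (n <= m)%N >-> (n <= m)%E}.
  by move=> n m nm; rewrite lee_fin gig_fun_le// lef_pV2 ?posrE// ler_nat.
have := monotone_convergence mu measurableT mF (fun n x _ => F0 n x) (fun x _ => ndF x).
have -> : (\int[mu]_x limn (F ^~ x) = gig_mass q 0 1)%E.
  rewrite gig_massE; apply: eq_integral => x _; apply/cvg_lim => //; apply: cvg_EFin; first exact: nearW.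
  have [x0|x0] := leP x 0.
    rewrite gig_fun_le0//; apply: cvg_near_cst; apply: nearW => n /=.
    by rewrite /F /= gig_fun_le0.
  rewrite gig_funE//.
  rewrite (_ : _ \o _ = fun n => x `^ (q - 1) * expR (- ((n.+1%:R^-1 * x + 1 / x) / 2))); last first.
    by apply/funext => n /=; rewrite gig_funE.
  apply: cvgM; first exact: cvg_cst.
  apply: (cvg_comp _ expR); last exact: continuous_expR.
  apply: cvgN; apply: cvgM; last exact: cvg_cst.
  apply: cvgD; last exact: cvg_cst.
  by apply: cvgM; [exact: cvg_harmonic|exact: cvg_cst].
move=> E; move: kq; rewrite E ltNge => /negP; apply; apply: lime_le.
  apply: ereal_nondecreasing_is_cvgn => n m nm; apply: ge0_le_integral => //.
  - exact: mF.
  - exact: mF.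
  - by move=> x _; exact: ndF.
apply: nearW => n; rewrite leNgt; apply/negP => h; apply: nex.
by exists n.+1%:R^-1; rewrite ?invr_gt0.
Qed.

(** Scaling by [d] brings both masses to parameters [c d] and 1 and produces the factor [d^(-u)]. If
    [c d <= e], the numerator is at most its value at 0 and the denominator at least its value at
    [e]; the strict inequality assumed at 0 survives for small [e] and gives [lam < 1]. For larger
    [d] the inverse moment bounds the negative one, since [x^(-u) <= 1 + x^(-1)]. *)
Lemma gig_neg_moment q u c kappa : 0 < c -> 0 < u -> u <= 1 -> q - u < 0 -> 0 <= kappa ->
  (kappa%:E * gig_mass (q - u) 0 (1 : R) < gig_mass q 0 (1 : R))%E ->
  exists lam C : R, [/\ 0 <= lam, lam < 1, 0 <= C & forall d, 0 < d ->
    kappa * gm (q - u) c d <= (lam * d `^ (- u) + C) * gm q c d].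
Proof.
move=> c0 u0 u1 qu k0 kq; have [e e0 ke] := gig_mass_cvg0 kq.
have admj : gig_adm (q - u) 0 (1 : R) by split => //; [right|left].
have adme : gig_adm q e (1 : R) by split => //; [exact: ltW|left|left].
have adm r d : 0 < d -> gig_adm r c d by split; [exact: ltW|exact: ltW|left|left].
have [Me Me0 MeE] := gig_massP adme; have [jq j0 jE] := gig_massP admj.
move: ke; rewrite MeE jE -EFinM lte_fin => ke.
have de0 : 0 < e / c by rewrite divr_gt0.
have [C C0 hC] := @gig_inverse_moment q c (e / c) c0 de0.
exists (kappa * jq / Me), (kappa * (1 + C)); split.
- by rewrite divr_ge0 ?mulr_ge0// ltW.
- by rewrite ltr_pdivrMr// mul1r.
- by rewrite mulr_ge0// addr_ge0// ltW.
move=> d d0; have := hC d; have [m m00 mE] := gig_massP (adm q d d0).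
have [m' m'0 m'E] := gig_massP (adm (q - u) d d0).
have [m1 m10 m1E] := gig_massP (adm (q - 1) d d0).
rewrite m1E mE m'E /= => {}hC.
have [dsmall|dlarge] := leP d (e / c).
  apply: (@neg_moment_small_alg R kappa jq Me (d `^ q) (d `^ (- u)) _ m m') => //;
    rewrite ?powR_ge0//.
  - exact: ltW.
  - by rewrite mulr_ge0// addr_ge0// ltW.
  - exact: ltW.
  - rewrite -powRD ?(gt_eqF d0) ?implybT//.
    rewrite -lee_fin -m'E EFinM -jE (gig_mass_scale (q - u) c d d0) divff ?gt_eqF//.
    apply: lee_wpmul2l; first by rewrite lee_fin powR_ge0.
    by apply: gig_mass_le => //; rewrite mulr_ge0// ltW.
  - rewrite -lee_fin -mE EFinM -MeE (gig_mass_scale q c d d0) divff ?gt_eqF//.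
    apply: lee_wpmul2l; first by rewrite lee_fin powR_ge0.
    by apply: gig_mass_le => //; rewrite mulrC -ler_pdivlMr.
have h1 : m' <= m + m1.
  rewrite -lee_fin EFinD -m'E -mE -m1E.
  have g0 r x : (0 <= (gig_fun r c d x)%:E :> \bar R)%E by rewrite lee_fin gig_fun_ge0.
  have mg r := @measurable_gig_EFin R r c d.
  rewrite !gig_massE -(ge0_integralD mu measurableT (fun x _ => g0 q x) (mg q)
    (fun x _ => g0 (q - 1) x) (mg (q - 1))).
  apply: (ge0_le_integral mu measurableT (fun x _ => g0 (q - u) x) (mg (q - u))).
    by apply: emeasurable_funD; exact: mg.
  move=> x _; rewrite -EFinD lee_fin.
  have [x0|x0] := leP x 0; first by rewrite !gig_fun_le0// addr0.
  rewrite !(gig_fun_powR q)// -[X in _ <= X + _]mul1r -mulrDl ler_wpM2r ?gig_fun_ge0//.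
  have [x1|x1] := leP 1 x.
    have : x `^ (- u) <= 1.
      by rewrite -[leRHS](powRr0 x) ler_powR// oppr_le0 ltW.
    by have := powR_ge0 x (-1); move: (x `^ (-1)) (x `^ (- u)); clear => *; lra.
  have : x `^ (- u) <= x `^ (-1) by rewrite ger_powR ?x0 ?(ltW x1)// lerN2.
  by move: (x `^ (-1)) (x `^ (- u)); clear => *; lra.
apply: (@le_trans _ _ (kappa * (1 + C) * m)); last first.
  rewrite ler_wpM2r ?(ltW m00)// lerDr mulr_ge0 ?powR_ge0//.
  by rewrite divr_ge0 ?mulr_ge0// ltW.
rewrite -mulrA ler_wpM2l// mulrDl mul1r; apply: (le_trans h1).
by rewrite lerD2l; apply: hC; exact: ltW.
Qed.

End gig_moments.

(** * Moments of Gaussian laws *)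

Section powR_ineq.
Context {R : realType}.

(** The fractions [a / (a + b)] and [b / (a + b)] add up to 1, and [y <= y^r] for [0 < y <= 1]. *)
Lemma powR_subadditive (r a b : R) : 0 < r -> r <= 1 -> 0 <= a -> 0 <= b ->
  (a + b) `^ r <= a `^ r + b `^ r.
Proof.
move=> r0 r1 a0 b0.
have [->|an] := eqVneq a 0; first by rewrite add0r lerDr powR_ge0.
have [->|bn] := eqVneq b 0; first by rewrite addr0 lerDl powR_ge0.
have ap : 0 < a by rewrite lt_def an.
have bp : 0 < b by rewrite lt_def bn.
have s0 : 0 < a + b by exact: addr_gt0.
have key x : 0 < x -> x <= a + b -> (x / (a + b)) * (a + b) `^ r <= x `^ r.
  move=> x0 xs; have y0 : 0 < x / (a + b) by exact: divr_gt0.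
  have -> : x `^ r = (x / (a + b)) `^ r * (a + b) `^ r.
    by rewrite -powRM ?(ltW y0) ?(ltW s0)// divfK// gt_eqF.
  rewrite ler_wpM2r ?powR_ge0// ger1_powR// y0/=.
  by rewrite ler_pdivrMr// mul1r.
apply: le_trans (lerD (key a ap _) (key b bp _)); rewrite ?lerDl ?lerDr//.
by rewrite -mulrDl -mulrDl divff ?mul1r// gt_eqF.
Qed.

Lemma powR_normD (r a b : R) : 0 < r -> r <= 1 ->
  `|a + b| `^ r <= `|a| `^ r + `|b| `^ r.
Proof.
move=> r0 r1; apply: le_trans (powR_subadditive r0 r1 (normr_ge0 a) (normr_ge0 b)).
by apply: ge0_ler_powR; rewrite ?nnegrE ?addr_ge0 ?ler_normD// ltW.
Qed.

End powR_ineq.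

Section gaussian.
Context {R : realType}.
Local Notation mu := (@lebesgue_measure R).
Local Notation gw := (@gauss_w R).
Implicit Types (c xi r : R) (f : R -> \bar R).

(** The expectation of [f (c + xi Z)], for [Z] standard normal, times [gauss_moment 0]; it is left
    unnormalized so that the Gaussian constant stays a symbol. *)
Definition gauss_int f c xi : \bar R := (\int[mu]_z (f (c + xi * z)%R * (gw z)%:E))%E.

Let mgw : measurable_fun [set: R] (fun z => (gw z)%:E).
Proof. by apply/measurable_EFinP; exact: measurable_gauss_w. Qed.

Let gw0 z : (0 <= (gw z)%:E)%E. Proof. by rewrite lee_fin gauss_w_ge0. Qed.

Let maff c xi : measurable_fun [set: R] (fun z : R => c + xi * z).
Proof. by apply: measurable_funD => //; exact: measurable_funM. Qed.

Lemma measurable_gauss_int f c xi : measurable_fun [set: R] f ->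
  measurable_fun [set: R] (fun z => (f (c + xi * z)%R * (gw z)%:E)%E).
Proof. by move=> mf; apply: emeasurable_funM => //; exact: (measurableT_comp mf (maff c xi)). Qed.

Lemma gauss_int_affine f c xi : 0 < xi -> (forall x, 0 <= f x)%E -> measurable_fun [set: R] f ->
  (\int[mu]_t (f t * (expR (- ((t - c) ^+ 2 / (2 * xi ^+ 2))))%:E) =
   xi%:E * gauss_int f c xi)%E.
Proof.
move=> xi0 f0 mf; rewrite (integral_affine c xi0); last 2 first.
- by move=> x; rewrite mule_ge0// lee_fin expR_ge0.
- apply: emeasurable_funM => //; apply/measurable_EFinP.
  apply: measurableT_comp => //; apply: measurable_funN.
  apply: measurable_funM => //; apply: measurable_funX; exact: measurable_funB.
apply: congr1; apply: eq_integral => z _; rewrite [xi * z + c]addrC.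
suff -> : expR (- ((c + xi * z - c) ^+ 2 / (2 * xi ^+ 2))) = gw z by [].
rewrite /gauss_w; congr expR; congr (- _); have := lt0r_neq0 xi0; clear => h; field.
by rewrite h.
Qed.

Lemma gauss_intD f g c xi : (forall x, 0 <= f x)%E -> measurable_fun [set: R] f ->
  (forall x, 0 <= g x)%E -> measurable_fun [set: R] g ->
  gauss_int (fun x => f x + g x)%E c xi = (gauss_int f c xi + gauss_int g c xi)%E.
Proof.
move=> f0 mf g0 mg; rewrite /gauss_int -ge0_integralD//.
- by apply: eq_integral => z _; rewrite ge0_muleDl.
- by move=> z _; rewrite mule_ge0.
- exact: measurable_gauss_int.
- by move=> z _; rewrite mule_ge0.
- exact: measurable_gauss_int.
Qed.

(** Meant for functions that are infinite at 0, where a negative real power takes a conventional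
    value. *)
Lemma gauss_int_ae f g c xi : 0 < xi -> (forall x, 0 <= f x)%E -> measurable_fun [set: R] f ->
  (forall x, 0 <= g x)%E -> measurable_fun [set: R] g ->
  (forall x, x != 0 -> f x = g x) -> gauss_int f c xi = gauss_int g c xi.
Proof.
move=> xi0 f0 mf g0 mg fg; apply: ge0_ae_eq_integral => //.
- exact: measurable_gauss_int.
- exact: measurable_gauss_int.
- by move=> z _; rewrite mule_ge0.
- by move=> z _; rewrite mule_ge0.
exists [set (- c / xi : R)]; split; [exact: measurable_set1|exact: lebesgue_measure_set1|].
move=> z /= h; apply: contrapT => zc; apply: h => _; rewrite fg//.
apply/negP => /eqP e; apply: zc.
have xin := lt0r_neq0 xi0.
have h : xi * z = - c by apply/eqP; rewrite -addr_eq0 addrC; apply/eqP.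
by apply: (mulfI xin); rewrite h mulrCA divff// mulr1.
Qed.

Definition gauss_mean r : R := fine (gauss_moment r) / fine (@gauss_moment R 0).

Lemma gauss_int1 c xi : gauss_int (fun=> 1%E) c xi = gauss_moment 0.
Proof. by apply: eq_integral => z _; rewrite mul1e powRr0 mul1r. Qed.

Lemma fine_gauss_moment_gt0 r : -1 < r -> 0 < fine (@gauss_moment R r).
Proof. by move=> r1; rewrite fine_gt0// gauss_moment_gt0 gauss_moment_lty. Qed.

Lemma gauss_momentK r : -1 < r -> ((fine (@gauss_moment R r))%:E = gauss_moment r)%E.
Proof.
by move=> r1; rewrite fineK// ge0_fin_numE ?gauss_moment_lty// ltW// gauss_moment_gt0.
Qed.

Let m10 : (-1 : R) < 0. Proof. by rewrite ltrN10. Qed.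

Lemma gauss_meanE r : -1 < r -> gauss_moment r = ((gauss_mean r)%:E * gauss_moment 0)%E.
Proof.
move=> r1; rewrite -(gauss_momentK m10) -(gauss_momentK r1) -EFinM /gauss_mean divfK//.
by rewrite gt_eqF// fine_gauss_moment_gt0.
Qed.

Lemma gauss_mean_ge0 r : -1 < r -> 0 <= gauss_mean r.
Proof. by move=> r1; rewrite divr_ge0// ltW// fine_gauss_moment_gt0. Qed.

Let integral_lin (k l : R) (u v : R -> R) : 0 <= k -> 0 <= l -> (forall z, 0 <= u z) ->
  (forall z, 0 <= v z) -> measurable_fun [set: R] (fun z => (u z)%:E) ->
  measurable_fun [set: R] (fun z => (v z)%:E) ->
  (\int[mu]_z (k%:E * (u z)%:E + l%:E * (v z)%:E) =
   k%:E * \int[mu]_z (u z)%:E + l%:E * \int[mu]_z (v z)%:E)%E.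
Proof.
move=> k0 l0 u0 v0 mu' mv.
have h1 z : [set: R] z -> (0 <= k%:E * (u z)%:E)%E by move=> _; rewrite -EFinM lee_fin mulr_ge0.
have h2 z : [set: R] z -> (0 <= l%:E * (v z)%:E)%E by move=> _; rewrite -EFinM lee_fin mulr_ge0.
apply: etrans (ge0_integralD mu measurableT h1 _ h2 _) _; [exact: measurable_funeM..|].
congr (_ + _)%E.
  by apply: (@ge0_integralZl_EFin _ _ _ mu _ measurableT (fun z => (u z)%:E)) => // z _; rewrite lee_fin.
by apply: (@ge0_integralZl_EFin _ _ _ mu _ measurableT (fun z => (v z)%:E)) => // z _; rewrite lee_fin.
Qed.

Lemma gauss_int_powR_le r c xi : 0 < r -> r <= 1 -> 0 < xi ->
  (gauss_int (fun x => (`|x| `^ r)%:E) c xi <=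
   (`|c| `^ r + xi `^ r * gauss_mean r)%:E * gauss_moment 0)%E.
Proof.
move=> r0 r1 xi0; have rm1 : -1 < r by exact: lt_trans r0.
apply: (@le_trans _ _ (\int[mu]_z ((`|c| `^ r)%:E * (gw z)%:E +
   (xi `^ r)%:E * (`|z| `^ r * gw z)%:E))%E).
  apply: ge0_le_integral => //.
  - by move=> z _; rewrite mule_ge0// lee_fin powR_ge0.
  - apply: (@measurable_gauss_int (fun x : R => (`|x| `^ r)%:E)).
    by apply/measurable_EFinP; exact: measurable_norm_powR.
  - apply: emeasurable_funD; apply: measurable_funeM => //.
    exact: measurable_gauss_momentf.
  - move=> z _; rewrite -!EFinM -EFinD lee_fin mulrA -mulrDl ler_wpM2r ?gauss_w_ge0//.
    apply: (le_trans (powR_normD _ _ r0 r1)).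
    by rewrite normrM powRM// (gtr0_norm xi0).
rewrite (integral_lin (u := gw) (v := fun z => `|z| `^ r * gw z)) ?powR_ge0//; last 2 first.
- by move=> z; rewrite mulr_ge0 ?powR_ge0 ?gauss_w_ge0.
- exact: measurable_gauss_momentf.
have -> : (\int[mu]_x (`|x| `^ r * gw x)%:E = gauss_moment r)%E by [].
rewrite (gauss_meanE rm1).
have -> : (\int[mu]_x (gw x)%:E = gauss_moment 0)%E.
  by apply: eq_integral => z _; rewrite powRr0 mul1r.
rewrite EFinD ge0_muleDl; first by rewrite (EFinM (xi `^ r)) muleA.
  by rewrite lee_fin powR_ge0.
by rewrite lee_fin mulr_ge0 ?powR_ge0// gauss_mean_ge0.
Qed.

Lemma gauss_int_sqr_le e c xi : 0 < e -> 0 < xi ->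
  (gauss_int (fun x => (x ^+ 2)%:E) c xi <=
   ((1 + e) * c ^+ 2 + (1 + e^-1) * xi ^+ 2 * gauss_mean 2)%:E * gauss_moment 0)%E.
Proof.
move=> e0 xi0; have rm1 : -1 < (2 : R) by lra.
have e1 : 0 <= 1 + e by rewrite addr_ge0// ltW.
have e2 : 0 <= 1 + e^-1 by rewrite addr_ge0// invr_ge0 ltW.
have c1 : 0 <= (1 + e) * c ^+ 2 by rewrite mulr_ge0 ?sqr_ge0.
have c2 : 0 <= (1 + e^-1) * xi ^+ 2 by rewrite mulr_ge0 ?sqr_ge0.
apply: (@le_trans _ _ (\int[mu]_z (((1 + e) * c ^+ 2)%:E * (gw z)%:E +
   ((1 + e^-1) * xi ^+ 2)%:E * (`|z| `^ 2 * gw z)%:E))%E).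
  apply: ge0_le_integral => //.
  - by move=> z _; rewrite mule_ge0// lee_fin sqr_ge0.
  - apply: (@measurable_gauss_int (fun x : R => (x ^+ 2)%:E)).
    by apply/measurable_EFinP; exact: measurable_funX.
  - apply: emeasurable_funD; apply: measurable_funeM => //.
    exact: measurable_gauss_momentf.
  - move=> z _; rewrite -!EFinM -EFinD lee_fin powR_mulrn// real_normK ?num_real//.
    rewrite (mulrA _ (z ^+ 2)) -mulrDl ler_wpM2r ?gauss_w_ge0//.
    rewrite -subr_ge0 (_ : _ - _ = e * (c - e^-1 * (xi * z)) ^+ 2).
      by rewrite mulr_ge0 ?sqr_ge0// ltW.
    have := lt0r_neq0 e0; clear => h; field; exact: h.
rewrite (integral_lin (u := gw) (v := fun z => `|z| `^ 2 * gw z))//; last 2 first.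
- by move=> z; rewrite mulr_ge0 ?powR_ge0 ?gauss_w_ge0.
- exact: measurable_gauss_momentf.
have -> : (\int[mu]_x (`|x| `^ 2 * gw x)%:E = gauss_moment 2)%E by [].
rewrite (gauss_meanE rm1).
have -> : (\int[mu]_x (gw x)%:E = gauss_moment 0)%E.
  by apply: eq_integral => z _; rewrite powRr0 mul1r.
rewrite EFinD ge0_muleDl; first by rewrite (EFinM ((1 + e^-1) * xi ^+ 2)) muleA.
  by rewrite lee_fin.
by rewrite lee_fin mulr_ge0// gauss_mean_ge0.
Qed.

Let rearrangement r e z : 0 < r -> z != 0 -> z + e != 0 ->
  `|z + e| `^ (- r) * gw z + `|z| `^ (- r) * gw (z + e) <=
  `|z| `^ (- r) * gw z + `|z + e| `^ (- r) * gw (z + e).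
Proof.
move=> r0 z0 ze.
have fle (x y : R) : x != 0 -> y != 0 -> `|x| <= `|y| -> `|y| `^ (- r) <= `|x| `^ (- r).
  move=> x0 y0 xy; rewrite !powRN lef_pV2 ?posrE ?powR_gt0 ?normr_gt0//.
  by apply: ge0_ler_powR; rewrite ?nnegrE// ltW.
have gle (x y : R) : `|x| <= `|y| -> gw y <= gw x.
  move=> xy; rewrite /gauss_w ler_expR lerN2 ler_wpM2r//.
  by rewrite -[x ^+ 2]real_normK ?num_real// -[y ^+ 2]real_normK ?num_real// ler_pXn2r ?nnegrE.
rewrite -subr_ge0 (_ : _ - _ =
  (`|z| `^ (- r) - `|z + e| `^ (- r)) * (gw z - gw (z + e))); last by ring.
have [h|h] := leP `|z| `|z + e|.
  by rewrite mulr_ge0// subr_ge0; [exact: fle|exact: gle].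
by rewrite mulr_le0// subr_le0; [apply: fle|apply: gle] => //; exact: ltW.
Qed.

(* Rearrangement: the two factors are ordered in opposite ways by [|z|] and
   [|z + e|]; reflections and translations turn both mixed terms into the
   same integral. *)
Lemma gauss_int_negpowR_le r c xi : 0 < r -> r < 1 -> 0 < xi ->
  (gauss_int (fun x => (`|x| `^ (- r))%:E) c xi <=
   (xi `^ (- r) * gauss_mean (- r))%:E * gauss_moment 0)%E.
Proof.
move=> r0 r1 xi0; have rm1 : -1 < - r by rewrite ltrN2.
pose e := c / xi.
pose f (z : R) : R := `|z| `^ (- r).
have f0 z : 0 <= f z by exact: powR_ge0.
have mf : measurable_fun [set: R] f by exact: measurable_norm_powR.
have mg : measurable_fun [set: R] gw by exact: measurable_gauss_w.
have mtr (h : R -> R) : measurable_fun [set: R] h -> measurable_fun [set: R] (fun z : R => h (z + e)).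
  by move=> mh; apply: (measurableT_comp mh); exact: measurable_funD.
have g0 z : 0 <= gw z by exact: gauss_w_ge0.
have int1 : (\int[mu]_z (f (z + e) * gw z)%:E <= \int[mu]_z (f z * gw z)%:E)%E.
  have [I IE] : exists I, I = (\int[mu]_z (f (z + e) * gw z)%:E)%E by eexists.
  have [J JE] : exists J, J = (\int[mu]_z (f z * gw z)%:E)%E by eexists.
  rewrite -IE -JE.
  have mfg : measurable_fun [set: R] (fun z => (f z * gw z)%:E).
    by apply/measurable_EFinP; exact: measurable_funM.
  have m1 : measurable_fun [set: R] (fun z => (f (z + e) * gw z)%:E).
    by apply/measurable_EFinP; apply: measurable_funM => //; exact: mtr.
  have m2 : measurable_fun [set: R] (fun z => (f z * gw (z + e))%:E).
    by apply/measurable_EFinP; apply: measurable_funM => //; exact: mtr.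
  have m3 : measurable_fun [set: R] (fun z => (f (z + e) * gw (z + e))%:E).
    by apply/measurable_EFinP; apply: measurable_funM; exact: mtr.
  have fg0 (a b : R) : (0 <= (f a * gw b)%:E)%E by rewrite lee_fin mulr_ge0.
  have J3 : (\int[mu]_z (f (z + e) * gw (z + e))%:E = J)%E.
    by rewrite JE; exact: (integral_translation e (f := fun z => (f z * gw z)%:E)).
  (* The reflection followed by the translation by [e] maps [z] to [- z - e], which exchanges the
     arguments of the two factors up to sign. *)
  have I2 : (\int[mu]_z (f z * gw (z + e))%:E = I)%E.
    rewrite IE; apply: etrans (esym (integral_opp (f := fun z => (f z * gw (z + e))%:E) (fun z => fg0 _ _) m2)) _.
    apply: etrans (esym (integral_translation e (f := fun z => (f (- z) * gw (- z + e))%:E) (fun z => fg0 _ _) _)) _.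
      by apply: (measurableT_comp m2); exact: oppr_measurable.
    apply: eq_integral => z _; congr (_ * _)%:E.
      by rewrite /f normrN.
    by rewrite /gauss_w opprD subrK sqrrN.
  have IJ : (I + I <= J + J)%E.
    have -> : (I + I = \int[mu]_z ((f (z + e) * gw z)%:E + (f z * gw (z + e))%:E))%E.
      by rewrite -{2}I2 IE; apply: esym; exact: (ge0_integralD mu measurableT (fun z _ => fg0 _ _) m1 (fun z _ => fg0 _ _) m2).
    have -> : (J + J = \int[mu]_z ((f z * gw z)%:E + (f (z + e) * gw (z + e))%:E))%E.
      by rewrite -{2}J3 JE; apply: esym; exact: (ge0_integralD mu measurableT (fun z _ => fg0 _ _) mfg (fun z _ => fg0 _ _) m3).
    apply: ae_ge0_le_integral.
    - exact: measurableT.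
    - by move=> z _; apply: adde_ge0.
    - exact: (emeasurable_funD m1 m2).
    - by move=> z _; apply: adde_ge0.
    - exact: (emeasurable_funD mfg m3).
    (* At these two points a negative power of 0 occurs; its conventional value 0 breaks the
       monotonicity behind [rearrangement]. *)
    exists ([set (0 : R)] `|` [set - e]); split.
    - by apply: measurableU; exact: measurable_set1.
    - have h := measureU2 mu (measurable_set1 (0 : R)) (measurable_set1 (- e)).
      have eq_lee (x y : \bar R) : x = y -> (x <= y)%E by move=> ->.
      apply/eqP; rewrite eq_le measure_ge0 andbT; apply: (le_trans h).
      rewrite -[leRHS]adde0; apply: leeD; apply: eq_lee; exact: lebesgue_measure_set1.
    move=> z /= h; apply: contrapT => /not_orP[z0 ze]; apply: h => _.
    have z0' : z != 0 by apply/eqP.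
    have ze' : z + e != 0 by apply/eqP => h; apply: ze; rewrite -[z](addrK e) h sub0r.
    rewrite -!EFinD lee_fin; exact: rearrangement.
  have I0 : (0 <= I)%E by rewrite IE; apply: integral_ge0 => z _.
  have J0 : (0 <= J)%E by rewrite JE; apply: integral_ge0 => z _.
  move: IJ I0 J0; move: (I) (J); clear => -[i| |] [j| |]//=; rewrite ?leey//.
  by rewrite -!EFinD !lee_fin -!mulr2n lerMn2r.
apply: (@le_trans _ _ ((xi `^ (- r))%:E * \int[mu]_z (f (z + e) * gw z)%:E)%E).
  rewrite le_eqVlt; apply/orP; left; apply/eqP.
  rewrite -ge0_integralZl//; last 3 first.
  - by apply/measurable_EFinP; apply: measurable_funM => //; exact: mtr.
  - by move=> z _; rewrite lee_fin mulr_ge0.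
  - by rewrite lee_fin powR_ge0.
  apply: eq_integral => z _; rewrite -!EFinM mulrA; congr (_ * _)%:E.
  rewrite /f -(gtr0_norm xi0) -powRM// -normrM (gtr0_norm xi0); congr (`|_| `^ _).
  by rewrite /e; field; rewrite gt_eqF.
rewrite EFinM -muleA -(gauss_meanE rm1); apply: lee_wpmul2l; last exact: int1.
by rewrite lee_fin powR_ge0.
Qed.

End gaussian.

(** * The conditional precision matrix *)

Section dot_product.
Context {R : realType}.
Implicit Types p q : nat.

Definition dotv p (x y : 'cV[R]_p) : R := \sum_i x i 0 * y i 0.

Lemma dotvE p (x y : 'cV[R]_p) : (x^T *m y) 0 0 = dotv x y.
Proof. by rewrite mxE; apply: eq_bigr => i _; rewrite mxE. Qed.

Lemma dotvC p (x y : 'cV[R]_p) : dotv x y = dotv y x.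
Proof. by apply: eq_bigr => i _; rewrite mulrC. Qed.

Lemma dotvDr p (x y z : 'cV[R]_p) : dotv x (y + z) = dotv x y + dotv x z.
Proof. by rewrite -big_split/=; apply: eq_bigr => i _; rewrite mxE mulrDr. Qed.

Lemma dotvDl p (x y z : 'cV[R]_p) : dotv (x + y) z = dotv x z + dotv y z.
Proof. by rewrite dotvC dotvDr !(dotvC z). Qed.

Lemma dotvZr p a (x y : 'cV[R]_p) : dotv x (a *: y) = a * dotv x y.
Proof. by rewrite mulr_sumr; apply: eq_bigr => i _; rewrite mxE mulrCA. Qed.

Lemma dotvZl p a (x y : 'cV[R]_p) : dotv (a *: x) y = a * dotv x y.
Proof. by rewrite dotvC dotvZr dotvC. Qed.

Lemma dotvNr p (x y : 'cV[R]_p) : dotv x (- y) = - dotv x y.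
Proof. by rewrite -scaleN1r dotvZr mulN1r. Qed.

Lemma dotvNl p (x y : 'cV[R]_p) : dotv (- x) y = - dotv x y.
Proof. by rewrite dotvC dotvNr dotvC. Qed.

Lemma dotv_mulmx p q (A : 'M[R]_(p, q)) x y : dotv x (A *m y) = dotv (A^T *m x) y.
Proof. by rewrite -!dotvE trmx_mul trmxK mulmxA. Qed.

Lemma dotvv_ge0 p (x : 'cV[R]_p) : 0 <= dotv x x.
Proof. by apply: sumr_ge0 => i _; rewrite -expr2 sqr_ge0. Qed.

Lemma dotvv_eq0 p (x : 'cV[R]_p) : dotv x x = 0 -> x = 0.
Proof.
move=> h; apply/colP => i; rewrite mxE; apply/eqP; rewrite -sqrf_eq0 expr2; apply/eqP.
by apply: (psumr_eq0P _ h) => // j _; rewrite -expr2 sqr_ge0.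
Qed.

Lemma dotv_amgm p (x y : 'cV[R]_p) (c : R) : 0 < c ->
  dotv x y <= c * dotv x x + dotv y y / (4 * c).
Proof.
move=> c0; have := dotvv_ge0 (c *: x - 2^-1 *: y).
rewrite dotvDl !dotvDr !dotvNl !dotvNr !dotvZl !dotvZr (dotvC y x) => h.
rewrite -subr_ge0 (_ : _ - _ = c^-1 * (c * (c * dotv x x) - c * (2^-1 * dotv x y) -
  2^-1 * (c * dotv x y) + 2^-1 * (2^-1 * dotv y y))); last first.
  by have := lt0r_neq0 c0; clear => h; field.
rewrite mulr_ge0 ?invr_ge0 ?(ltW c0)//; move: h; rewrite opprK.
by move: (dotv x x) (dotv x y) (dotv y y) => u v w; lra.
Qed.

Lemma dotv_delta p (i : 'I_p) (x : 'cV[R]_p) : dotv (delta_mx i 0) x = x i 0.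
Proof.
rewrite /dotv (bigD1 i)//= big1 ?addr0; first by rewrite mxE !eqxx mul1r.
by move=> j ji; rewrite mxE (negPf ji) mul0r.
Qed.

End dot_product.

Section precision.
Context {R : realType} {m n : nat}.
Variables (B : 'M[R]_(m, n)) (rho : R).
Hypothesis rho0 : 0 < rho.
Implicit Types V x y : 'cV[R]_n.

(** Equal to [barQ] on the orthant ([barQE]), with the inverse of the diagonal part written
    entrywise. *)
Definition precision V : 'M[R]_n := rho *: (B^T *m B) + diag_mx (\row_i (V i 0)^-1).

Lemma dotv_precision V x y : dotv x (precision V *m y) =
  rho * dotv (B *m x) (B *m y) + \sum_i x i 0 * y i 0 / V i 0.
Proof.
rewrite /precision mulmxDl dotvDr; congr (_ + _).
  by rewrite -scalemxAl dotvZr -mulmxA dotv_mulmx trmxK.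
apply: eq_bigr => i _; rewrite -mulrA; congr (_ * _).
by rewrite mul_diag_mx !mxE mulrC.
Qed.

Lemma dotv_precisionC V x y : dotv x (precision V *m y) = dotv y (precision V *m x).
Proof.
rewrite !dotv_precision dotvC; congr (_ + _).
by apply: eq_bigr => i _; rewrite (mulrC (x i 0)).
Qed.

Lemma sum_sqr_div_ge0 V x : orthant V -> 0 <= \sum_i x i 0 * x i 0 / V i 0.
Proof. by move=> V0; apply: sumr_ge0 => i _; rewrite divr_ge0 -?expr2 ?sqr_ge0// ltW. Qed.

Lemma precision_ge V x : orthant V ->
  \sum_i x i 0 * x i 0 / V i 0 <= dotv x (precision V *m x).
Proof. by move=> V0; rewrite dotv_precision lerDr mulr_ge0 ?dotvv_ge0 ?ltW. Qed.

Lemma precision_ge0 V x : orthant V -> 0 <= dotv x (precision V *m x).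
Proof. by move=> V0; apply: le_trans (precision_ge x V0); exact: sum_sqr_div_ge0. Qed.

Lemma precision_eq0 V x : orthant V -> dotv x (precision V *m x) = 0 -> x = 0.
Proof.
move=> V0 h; apply/colP => i; rewrite mxE.
have e : \sum_i x i 0 * x i 0 / V i 0 = 0.
  have := precision_ge x V0; rewrite h => h'.
  by apply/eqP; rewrite eq_le h' sum_sqr_div_ge0.
have /eqP : x i 0 * x i 0 / V i 0 = 0.
  by apply: (psumr_eq0P _ e) => // j _; rewrite divr_ge0 -?expr2 ?sqr_ge0// ltW.
by rewrite !mulf_eq0 invr_eq0 (gt_eqF (V0 i)) orbF orbb => /eqP.
Qed.

Lemma precision_unit V : orthant V -> precision V \in unitmx.
Proof.
move=> V0; rewrite -row_free_unit -kermx_eq0; apply/rowV0P => v /sub_kermxP h.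
apply: trmx_inj; rewrite trmx0; apply: (@precision_eq0 V) => //.
by rewrite -dotvE trmxK mulmxA h mul0mx mxE.
Qed.

(** [s] is the inverse of the [i]-th diagonal entry of the inverse precision matrix, so
    [sigma^2 / s] is the variance of coordinate [i], and [v] is the direction of regression on it.
    The quadratic form at [v] is [s] and dominates [1 / V_i]; at [e - v] it is nonnegative and
    equals the [i]-th diagonal entry of the precision matrix minus [s]. *)
Lemma precision_direction V (i : 'I_n) : orthant V -> exists (v : 'cV[R]_n) (s : R),
  [/\ v i 0 = 1, precision V *m v = s *: delta_mx i 0, (V i 0)^-1 <= s &
    s <= (V i 0)^-1 + rho * dotv (col i B) (col i B)].
Proof.
move=> V0; have Qu := precision_unit V0.
pose e : 'cV[R]_n := delta_mx i 0; pose g := invmx (precision V) *m e.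
have Qg : precision V *m g = e by rewrite mulKVmx.
have gi : g i 0 = dotv g (precision V *m g) by rewrite Qg dotvC dotv_delta.
have gi0 : 0 < g i 0.
  rewrite lt_def gi precision_ge0// andbT; apply/eqP => /(precision_eq0 V0) g0.
  have /(congr1 (fun M : 'cV[R]_n => M i 0)) : e = 0 by rewrite -Qg g0 mulmx0.
  by rewrite !mxE !eqxx => /eqP; rewrite oner_eq0.
pose s := (g i 0)^-1; pose v := s *: g; exists v, s.
have vi : v i 0 = 1 by rewrite mxE mulVf// gt_eqF.
have Qv : precision V *m v = s *: e by rewrite -scalemxAr Qg.
have vQv : dotv v (precision V *m v) = s by rewrite Qv dotvZr dotvC dotv_delta vi mulr1.
split => //.
- rewrite -vQv; apply: le_trans (precision_ge v V0).
  rewrite (bigD1 i)//= vi !mul1r lerDl; apply: sumr_ge0 => j _.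
  by rewrite divr_ge0 -?expr2 ?sqr_ge0// ltW.
- have := precision_ge0 (e - v) V0.
  rewrite mulmxBr dotvDr !dotvDl !dotvNr !dotvNl vQv Qv dotvZr !dotv_delta.
  have ei : e i 0 = 1 by rewrite mxE !eqxx.
  rewrite ?(dotv_precisionC V v e) ?Qv ?dotvZr ?dotv_delta ei mulr1 subrr addr0 subr_ge0.
  move=> /le_trans; apply.
  rewrite -[leLHS](dotv_delta i (precision V *m e)) dotv_precision -colE addrC lerD2r.
  rewrite (bigD1 i)//= big1; first by rewrite mxE !eqxx !mul1r addr0.
  by move=> j ji; rewrite mxE (negPf ji) mul0r mul0r.
Qed.

(** For the quadratic form, [v] is orthogonal to the vectors that vanish at [i]. The Gaussian
    density thus factors into coordinate [i] and the others without inverting a block. *)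
Lemma precision_split V (i : 'I_n) (v : 'cV[R]_n) (s t : R) x : v i 0 = 1 ->
  precision V *m v = s *: delta_mx i 0 -> x i 0 = 0 ->
  dotv (t *: v + x) (precision V *m (t *: v + x)) =
  t ^+ 2 * s + dotv x (precision V *m x).
Proof.
move=> vi Qv xi; rewrite mulmxDr dotvDr !dotvDl -scalemxAr !dotvZr !dotvZl.
rewrite (dotv_precisionC V v x) Qv !dotvZr ![dotv _ (delta_mx _ _)]dotvC !dotv_delta vi xi.
by rewrite !mulr0 addr0 add0r mulr1 mulrA expr2.
Qed.

End precision.

(** * Bounds on the conditional mean *)

Section mean_bounds.
Context {R : realType} {m n : nat}.
Variables (B : 'M[R]_(m, n)) (rho : R).
Hypothesis rho0 : 0 < rho.
Implicit Types V x y : 'cV[R]_n.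
Local Notation Q := (precision B rho).

(** Pairing the equation with [x] gives [|B x|^2 <= <B x, w>], hence [|B x| <= |w|] whatever [V] is.
    The second part reads the equation coordinatewise and places [D_V^-1 x] in the range of
    [B^T]. *)
Lemma mean_shift_residual V x w : orthant V -> Q V *m x = rho *: (B^T *m w) ->
  dotv (B *m x) (B *m x) <= dotv w w /\
  forall i, x i 0 / V i 0 = (B^T *m (rho *: (w - B *m x))) i 0.
Proof.
move=> V0 Qx; split.
  have := dotv_precision B rho V x x; rewrite Qx dotvZr dotv_mulmx trmxK => h.
  have := sum_sqr_div_ge0 x V0; have := dotvv_ge0 (w - B *m x).
  rewrite dotvDl !dotvDr !dotvNl !dotvNr (dotvC w) opprK.
  move: h; move: (dotv (B *m x) w) (dotv (B *m x) (B *m x)) (dotv w w) (\sum_i _).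
  move=> a b c d h h1 d0; have r0 := rho0.
  have ab : b <= a by rewrite -(ler_pM2l r0) h lerDl.
  lra.
move=> i; have := congr1 (fun M : 'cV[R]_n => M i 0) Qx.
rewrite /precision mulmxDl mul_diag_mx -scalemxAl -mulmxA linearZ/= linearB/= scalerBr.
move: (B^T *m w) (B^T *m (B *m x)) => u v; rewrite !mxE => <-.
by rewrite addrAC subrr add0r mulrC.
Qed.

(* The vector [D_V^-1 x] lies in the range of [B^T] and has the signs of [x].
   One such vector [z] per sign pattern thus serves all the solutions with that
   pattern: [<z, x>] dominates [|x|] and is controlled by [B x]. *)
Lemma mean_shift_bounded (w : 'cV[R]_m) : exists2 C : R, 0 <= C &
  forall V x, orthant V -> Q V *m x = rho *: (B^T *m w) -> \sum_i `|x i 0| <= C.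
Proof.
pose pat (x : 'cV[R]_n) : {ffun 'I_n -> bool * bool} := [ffun i => (0 < x i 0, x i 0 < 0)].
have H (e : {ffun 'I_n -> bool * bool}) : exists C : R, 0 <= C /\
  forall V x, orthant V -> Q V *m x = rho *: (B^T *m w) -> pat x = e ->
    \sum_i `|x i 0| <= C.
  have [[V0 [x0 [oV0 Qx0 pe]]]|no] := pselect (exists V x, [/\ orthant V,
      Q V *m x = rho *: (B^T *m w) & pat x = e]); last first.
    by exists 0; split => // V x oV Qx px; case: no; exists V, x.
  have [_ zE] := mean_shift_residual oV0 Qx0.
  pose lam := rho *: (w - B *m x0); pose z := B^T *m lam.
  (* Dominates [1 / |z_i|] for each nonzero [z_i]; where [z_i = 0], the common sign pattern forces
     [x_i = 0]. *)
  pose k := \sum_i `|z i 0|^-1.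
  have k0 : 0 <= k by apply: sumr_ge0 => i _; rewrite invr_ge0.
  exists (k * (dotv lam lam + dotv w w)); split.
    by rewrite mulr_ge0// addr_ge0// dotvv_ge0.
  move=> V x oV Qx px.
  have [Bx _] := mean_shift_residual oV Qx.
  have zx i : `|x i 0| <= k * (z i 0 * x i 0).
    have /(congr1 (fun f : {ffun 'I_n -> bool * bool} => f i)) : pat x = pat x0 by rewrite px pe.
    rewrite !ffunE => -[xp xn].
    have zi : z i 0 = x0 i 0 / V0 i 0 by rewrite zE.
    have V0i : 0 < (V0 i 0)^-1 by rewrite invr_gt0 oV0.
    have kz : z i 0 != 0 -> 1 <= k * `|z i 0|.
      move=> zn; rewrite -[leLHS](mulVf (_ : `|z i 0| != 0)) ?normr_eq0//.
      rewrite ler_wpM2r// /k (bigD1 i)//= lerDl.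
      by apply: sumr_ge0 => j _; rewrite invr_ge0.
    have zxE : z i 0 * x i 0 = `|z i 0| * `|x i 0|.
      rewrite -normrM ger0_norm// zi mulrAC mulr_ge0 ?(ltW V0i)//.
      have [xp'|xn'|xe] := ltgtP (x i 0) 0.
      - by move: xn; rewrite xp' => /esym x0n; rewrite nmulr_rge0// ltW.
      - by move: xp; rewrite xn' => /esym x0p; rewrite mulr_ge0// ltW.
      - by rewrite xe mulr0.
    rewrite zxE mulrA.
    have [x0e|zn] := eqVneq (z i 0) 0; last by rewrite ler_peMl// kz.
    suff -> : x i 0 = 0 by rewrite normr0 mulr0.
    have x0e' : x0 i 0 = 0.
      by apply/eqP; move/eqP: x0e; rewrite zi mulf_eq0 (gt_eqF V0i) orbF.
    by move: xp xn; rewrite x0e' ltxx; case: ltgtP.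
  apply: (@le_trans _ _ (k * dotv z x)).
    by rewrite mulr_sumr; apply: ler_sum => i _; exact: zx.
  rewrite ler_wpM2l// /z -[B^T *m lam]trmxK.
  rewrite trmxK dotvC dotv_mulmx trmxK.
  have := dotvv_ge0 (B *m x - lam); have := dotvv_ge0 lam; have := dotvv_ge0 (B *m x).
  move: Bx; rewrite dotvDl !dotvDr !dotvNl !dotvNr (dotvC lam) opprK.
  move: (dotv (B *m x) lam) (dotv (B *m x) (B *m x)) (dotv w w) (dotv lam lam).
  by move=> a b c d; lra.
have [C HC] := choice H.
exists (\sum_e C e); first by apply: sumr_ge0 => e _; have [] := HC e.
move=> V x oV Qx; have [_ /(_ V x oV Qx erefl) h] := HC (pat x).
apply: (le_trans h); rewrite (bigD1 (pat x))//= lerDl.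
by apply: sumr_ge0 => e _; have [] := HC e.
Qed.

Lemma mean_unit_energy V y : Q V *m y = const_mx 1 ->
  rho * dotv (B *m y) (B *m y) + \sum_i y i 0 * y i 0 / V i 0 = \sum_i y i 0.
Proof.
move=> Qy; rewrite -dotv_precision Qy.
by apply: eq_bigr => i _; rewrite mxE mulr1.
Qed.

(** Sum [2 |y_i| <= y_i^2 / V_i + V_i], and bound the sum of the [y_i^2 / V_i] by that of the [y_i],
    from the energy identity. *)
Lemma mean_unit_bound V y : orthant V -> Q V *m y = const_mx 1 ->
  \sum_i `|y i 0| <= \sum_i V i 0.
Proof.
move=> V0 Qy; have := mean_unit_energy Qy.
have h1 : 0 <= rho * dotv (B *m y) (B *m y) by rewrite mulr_ge0 ?dotvv_ge0// ltW.
have h2 : \sum_i y i 0 <= \sum_i `|y i 0| by apply: ler_sum => i _; exact: ler_norm.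
have h3 : \sum_i (`|y i 0| + `|y i 0|) <= \sum_i (y i 0 * y i 0 / V i 0 + V i 0).
  apply: ler_sum => i _; have Vi := V0 i; rewrite -subr_ge0.
  rewrite (_ : _ - _ = (`|y i 0| - V i 0) ^+ 2 / V i 0).
    by rewrite divr_ge0 ?sqr_ge0// ltW.
  rewrite sqrrB real_normK ?num_real// expr2 mulr2n.
  by have := lt0r_neq0 Vi; clear => h; field.
move: h1 h2 h3; rewrite !big_split/=.
move: (rho * _) (\sum_i y i 0) (\sum_i `|y i 0|) (\sum_i y i 0 * _ / _) (\sum_i _) => *.
lra.
Qed.

(** In the energy identity the sum of the [y_i] is [<y, p> + <B y, lam>], and [rho |B y|^2] absorbs
    the second term up to a constant. With [V_i <= v] this leaves [|y|^2 <= v <y, p> + C v], so only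
    the part [p] of the all-ones vector contributes at order [v^2]. *)
Lemma mean_unit_sqr_bound (p : 'cV[R]_n) (lam : 'cV[R]_m) :
  const_mx 1 = p + B^T *m lam -> exists2 C : R, 0 <= C &
  forall V y v, orthant V -> Q V *m y = const_mx 1 -> 0 < v ->
    (forall i, V i 0 <= v) -> dotv y y <= v ^+ 2 * dotv p p + C * v.
Proof.
move=> pl; pose C := dotv lam lam / (4 * rho); exists (2 * C).
  by rewrite mulr_ge0// divr_ge0 ?dotvv_ge0// mulr_ge0// ltW.
move=> V y v V0 Qy v0 Vv; have := mean_unit_energy Qy.
have -> : \sum_i y i 0 = dotv y p + dotv (B *m y) lam.
  rewrite -[B in B *m y]trmxK -dotv_mulmx -dotvDr -pl.
  by apply: eq_bigr => i _; rewrite mxE mulr1.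
have h1 : dotv (B *m y) lam <= rho * dotv (B *m y) (B *m y) + C by exact: dotv_amgm.
have h2 : dotv y y <= v * \sum_i y i 0 * y i 0 / V i 0.
  rewrite mulr_sumr; apply: ler_sum => i _; have Vi := V0 i.
  rewrite mulrCA -[leLHS]mulr1 ler_wpM2l -?expr2 ?sqr_ge0//.
  by rewrite ler_pdivlMr// mul1r.
have h3 : 2 * v * dotv y p <= v ^+ 2 * dotv p p + dotv y y.
  have := dotvv_ge0 (v *: p - y).
  rewrite dotvDl !dotvDr !dotvNl !dotvNr !dotvZl !dotvZr (dotvC p) opprK expr2.
  by move: (dotv y y) (dotv p p) (dotv y p) => *; lra.
move=> h; move: h1 h2 h3 h; move: (dotv y y) (dotv p p) (dotv y p) (dotv (B *m y) lam).
move: (rho * _) (\sum_i _) => a b c d e f h1 h2 h3 h.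
have : v * b <= v * (e + C) by rewrite ler_pM2l//; lra.
lra.
Qed.

End mean_bounds.

(** * The null-smallness assumption *)

Section model_algebra.
Context {R : realType} {m n k : nat} (md : llnGm R m n k).
Local Notation B := (mdlB md).

Lemma invmx_diag (V : 'cV[R]_n) : orthant V ->
  invmx (diag_mx V^T) = diag_mx (\row_i (V i 0)^-1).
Proof.
move=> V0; have h : diag_mx V^T *m diag_mx (\row_i (V i 0)^-1) = 1%:M.
  rewrite mulmx_diag -diag_const_mx; congr diag_mx; apply/rowP => i.
  by rewrite !mxE divff// gt_eqF// V0.
have [u _] := mulmx1_unit h.
by rewrite -[RHS](mulKmx u) h mulmx1.
Qed.

Lemma barQE (V : 'cV[R]_n) : orthant V -> barQ md V = precision B (rho md) V.
Proof. by move=> V0; rewrite /barQ invmx_diag. Qed.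

(** [p] is the orthogonal projection of the all-ones vector onto [Null B = K Null A]. The columns of
    [N = K U] are a basis of that space with Gram matrix [G], so [p = N G^-1 z] and its squared norm
    is [z^T G^-1 z]. As [a = 0], the prefactor in the assumption is 1. If [Null A] is trivial,
    [p = 0]. *)
Lemma null_small_decomposition : mdlK md \in unitmx -> mdl_a md = 0 -> mdl_mu md != 0 ->
  null_small md -> exists (p : 'cV[R]_n) (lam : 'cV[R]_m),
    const_mx 1 = p + B^T *m lam /\ dotv p p < 1.
Proof.
move=> Ku a0 mu0; pose r := \rank (kermx (mdlA md)^T).
(* The product of [A K^-1] and [cokermx B] vanishes, so the columns of [K^-1] times [cokermx B] lie
   in [Null A]; and being annihilated by [cokermx B] is the test for membership in the range of
   [B^T]. *)
have cok : (invmx (mdlK md) *m cokermx B)^T = (invmx (mdlK md) *m cokermx B)^T *m pinvmx (kermx (mdlA md)^T) *m kermx (mdlA md)^T.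
  rewrite mulmxKpV//; apply/sub_kermxP; rewrite -trmx_mul mulmxA.
  by rewrite -[_ *m invmx _]/B mulmx_coker trmx0.
have range (w : 'cV[R]_n) : w^T *m cokermx B = 0 -> exists lam, w = B^T *m lam.
  move=> /eqP; rewrite -submxE => /submxP[D wD]; exists D^T.
  by rewrite -trmx_mul -wD trmxK.
case=> [r0|[U [UU UE small]]].
  have [|lam lamE] := range (const_mx 1); last first.
    by exists 0, lam; rewrite add0r; split => //; rewrite /dotv big1 ?ltr01// => i _; rewrite mxE mul0r.
  have K0 : kermx (mdlA md)^T = 0 by apply/eqP; rewrite -mxrank_eq0 r0.
  have C0 : invmx (mdlK md) *m cokermx B = 0.
    by apply: trmx_inj; rewrite cok K0 mulmx0 trmx0.
  by rewrite -[cokermx B](mulKVmx Ku) C0 mulmx0 mulmx0.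
pose N := mdlK md *m U; pose G := N^T *m N; pose z : 'cV[R]_r := N^T *m const_mx 1.
have GE : U^T *m (mdlK md)^T *m mdlK md *m U = G by rewrite /G /N trmx_mul !mulmxA.
have zE : U^T *m (mdlK md)^T *m const_mx 1 = z :> 'cV[R]__ by rewrite /z /N trmx_mul.
move: small; rewrite GE zE => small.
have Gsym : G^T = G by rewrite /G trmx_mul trmxK.
have Gu : G \in unitmx.
  rewrite -row_free_unit -kermx_eq0; apply/rowV0P => v /sub_kermxP vG.
  have NV : N *m v^T = 0.
    by apply: dotvv_eq0; rewrite -dotvE trmx_mul trmxK mulmxA -(mulmxA v) vG mul0mx mxE.
  have UV : U *m v^T = 0 by rewrite -[U](mulKmx Ku) -mulmxA NV mulmx0.
  by apply: trmx_inj; rewrite trmx0 -[v^T]mul1mx -UU -mulmxA UV mulmx0.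
pose p := N *m (invmx G *m z).
have [|lam lamE] := range (const_mx 1 - p).
  have /submxP[D DE] : ((invmx (mdlK md) *m cokermx B)^T <= U^T)%MS.
    by rewrite (eqmxP UE) cok submxMl.
  have -> : cokermx B = N *m D^T.
    by rewrite -[LHS](mulKVmx Ku) -[X in _ *m X]trmxK DE trmx_mul trmxK mulmxA.
  rewrite mulmxA (_ : _ *m N = 0) ?mul0mx//; apply: trmx_inj; rewrite trmx0 trmx_mul trmxK.
  by rewrite mulmxBr /p mulmxA mulKVmx// subrr.
exists p, lam; split; first by rewrite -lamE addrC subrK.
have pp : dotv p p = (z^T *m invmx G *m z) 0 0.
  rewrite -dotvE /p trmx_mul trmx_mul trmx_inv Gsym; congr (fun_of_matrix _ 0 0).
  have h : N^T *m (N *m (invmx G *m z)) = z by rewrite mulmxA -/G mulKVmx.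
  by rewrite -(mulmxA (z^T *m invmx G)) h.
rewrite pp; move: small; rewrite a0 mulr0 add0r sqrtr_sqr divff ?normr_eq0// mul1r.
move=> h; have h0 : 0 <= (z^T *m invmx G *m z) 0 0 by rewrite -pp dotvv_ge0.
by rewrite -(sqr_sqrtr h0) expr_lt1// sqrtr_ge0.
Qed.

End model_algebra.

(** * The two Gibbs kernels *)

Section density_integral.
Context d (T : measurableType d) (R : realType).
Local Open Scope ereal_scope.
Variables (mu : {measure set T -> \bar R}) (f : T -> \bar R).
Hypotheses (f0 : forall y, 0 <= f y) (mf : measurable_fun setT f).
Local Notation nu := (mdensity mu f0 mf).

Import HBNNSimple.

Let integral_mdensity_indic (A : set T) : measurable A ->
  \int[nu]_x (\1_A x)%:E = \int[mu]_x (f x * (\1_A x)%:E).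
Proof.
move=> mA; rewrite integral_indic//= setIT /mdensity integral_mkcond.
by apply: eq_integral => x _; rewrite patchE indicE; case: (x \in A); rewrite ?mule1 ?mule0.
Qed.

Let integral_mdensity_nnsfun (h : {nnsfun T >-> R}) :
  \int[nu]_x (h x)%:E = \int[mu]_x (f x * (h x)%:E).
Proof.
under [LHS]eq_integral do rewrite fimfunE -fsumEFin//.
rewrite [LHS]ge0_integral_fsum//; last 2 first.
  - by move=> r; exact/measurable_EFinP/measurableT_comp.
  - by move=> n x _; rewrite EFinM nnfun_muleindic_ge0.
under [RHS]eq_integral.
  move=> x _; rewrite fimfunE -fsumEFin// ge0_mule_fsumr; last first.
    by move=> r; rewrite EFinM nnfun_muleindic_ge0.
  over.
rewrite [RHS]ge0_integral_fsum//; last 2 first.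
  - move=> r; apply: emeasurable_funM => //.
    by apply/measurable_EFinP; do 2 apply/measurableT_comp => //.
  - by move=> n x _; rewrite mule_ge0// EFinM nnfun_muleindic_ge0.
apply: eq_fsbigr => r _; rewrite integralZl_indic_nnsfun// integral_mdensity_indic//.
have [r0|r0] := leP 0%R r; last first.
  have h0 x : \1_(h @^-1` [set r]) x = 0%R :> R by rewrite preimage_nnfun0// indic0.
  rewrite !integral0_eq ?mule0// => x _; rewrite h0 ?mulr0 mule0//.
have mi : measurable_fun [set: T] (fun x => f x * (\1_(h @^-1` [set r]) x)%:E).
  by apply: emeasurable_funM => //; apply/measurable_EFinP.
apply: etrans (esym (@ge0_integralZl_EFin _ _ _ mu _ measurableT _ _ mi _ r0)) _.
  by move=> x _; rewrite mule_ge0// lee_fin.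
by apply: eq_integral => x _; rewrite muleCA -EFinM.
Qed.

Lemma integral_mdensity (g : T -> \bar R) :
  (forall x, 0 <= g x) -> measurable_fun setT g ->
  \int[nu]_x g x = \int[mu]_x (f x * g x).
Proof.
move=> g0 mg.
pose g_ := nnsfun_approx measurableT mg.
transitivity (\int[nu]_x (lim ((g_ n x)%:E @[n --> \oo]))).
  by apply/eq_integral => z _; apply/esym/cvg_lim => //=; exact: cvg_nnsfun_approx.
rewrite monotone_convergence//; last 3 first.
  by move=> n; exact/measurable_EFinP.
  by move=> n z _; rewrite lee_fin.
  by move=> z _ a b ab; rewrite lee_fin; exact/lefP/nd_nnsfun_approx.
transitivity (\int[mu]_x (lim ((f x * (g_ n x)%:E) @[n --> \oo]))).
  rewrite monotone_convergence//; last 3 first.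
  - by move=> n; apply: emeasurable_funM => //; exact/measurable_EFinP.
  - by move=> n z _; rewrite mule_ge0// lee_fin.
  - move=> z _ a b ab; rewrite lee_wpmul2l//.
    by rewrite lee_fin; exact/lefP/nd_nnsfun_approx.
  by congr (lim (_ @ \oo)); apply/funext => n; exact: integral_mdensity_nnsfun.
apply: eq_integral => x _.
have gx : (g_ n x)%:E @[n --> \oo] --> g x by exact: cvg_nnsfun_approx.
apply/cvg_lim => //.
(* The product is not continuous at [0 * +oo], so the zeros of [f] and of [g] are treated apart. *)
have [fx0|fx0] := eqVneq (f x) 0.
  by rewrite fx0 mul0e; under eq_fun do rewrite mul0e; exact: cvg_cst.
have [gx0|gx0] := eqVneq (g x) 0.
  rewrite gx0 mule0 (_ : (fun n => _) = cst 0); first exact: cvg_cst.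
  apply/funext => n; have : (g_ n x)%:E <= g x by rewrite nnsfun_approxE; exact: le_approx.
  by rewrite gx0 => gn0; rewrite (_ : (g_ n x)%:E = 0) ?mule0//; apply/eqP; rewrite eq_le gn0 lee_fin/=.
apply: cvgeM => //; last exact: cvg_cst.
by apply: neq0_mule_def; rewrite mule_eq0 negb_or fx0.
Qed.

End density_integral.

Section mnormalize_density.
Context d (T : measurableType d) (R : realType).
Local Open Scope ereal_scope.
Variables (mu : {measure set T -> \bar R}) (f : T -> \bar R).
Hypotheses (f0 : forall y, 0 <= f y) (mf : measurable_fun setT f).

(** A positive finite total mass excludes the default branch of the normalization. *)
Lemma integral_mnormalize_density (P : probability T R) (k : R) (g : T -> \bar R) :
  (0 < k)%R -> \int[mu]_x f x = k%:E ->
  (forall x, 0 <= g x) -> measurable_fun setT g ->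
  \int[mnormalize (mdensity mu f0 mf) P]_x g x = k^-1%:E * \int[mu]_x (f x * g x).
Proof.
move=> k0 kE g0 mg; have ik0 : (0 <= k^-1)%R by rewrite invr_ge0 ltW.
rewrite -(integral_mdensity mu f0 mf g0 mg).
rewrite (eq_measure_integral (mscale (NngNum ik0) (mdensity mu f0 mf))).
  by rewrite ge0_integral_mscale.
move=> A mA _; rewrite [LHS](_ : _ = if (k%:E == 0) || (k%:E == +oo) then P A
    else mdensity mu f0 mf A * (fine k%:E)^-1%:E); last first.
  transitivity ((if (mdensity mu f0 mf setT == 0) || (mdensity mu f0 mf setT == +oo)
    then fun U => P U else fun U => mdensity mu f0 mf U * (fine (mdensity mu f0 mf setT))^-1%:E) A) => //.
  rewrite (_ : mdensity mu f0 mf setT = k%:E)//; by case: ifP.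
by rewrite eqe (gt_eqF k0)/= muleC.
Qed.

End mnormalize_density.

(** * Gaussian integrals over tuples *)

Section gaussian_tuple.
Context {R : realType}.
Local Notation leb := (@lebesgue_measure R).
Local Notation gw := (@gauss_w R).

Lemma gauss_kernel_int (c xi : R) : 0 < xi ->
  (\int[leb]_t (expR (- ((t - c) ^+ 2 / (2 * xi ^+ 2))))%:E = xi%:E * gauss_moment 0)%E.
Proof.
move=> xi0; have := @gauss_int_affine R (fun=> 1%E) c xi xi0 (fun _ => lee01) (measurable_cst _).
by rewrite gauss_int1 => <-; apply: eq_integral => t _; rewrite mul1e.
Qed.

(** A product of Gaussian kernels is at most 1 and has a positive integral. *)
Lemma lebesgue_tuple_gt0 n : (0 < @lebesgue_tuple R n setT)%E.
Proof.
have w1 (x : R) : expR (- (x ^+ 2 / (2 * 1 ^+ 2))) <= 1.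
  by rewrite -[leRHS]expR0 ler_expR oppr_le0 divr_ge0 ?sqr_ge0// expr1n mulr1.
pose f (i : 'I_n) (x : R) : R := expR (- ((x - 0) ^+ 2 / (2 * 1 ^+ 2))).
have mf i : measurable_fun [set: R] (f i).
  apply: measurableT_comp => //; apply: measurable_funN.
  by apply: measurable_funM => //; apply: measurable_funX; exact: measurable_funB.
have g0 : 0 < fine (@gauss_moment R 0) by apply: fine_gauss_moment_gt0; rewrite ltrN10.
have := @integral_tuple_prod R n f (fun=> fine (gauss_moment 0)) _ mf _.
move=> h; have {}h := h (fun i x => expR_ge0 _) _.
have {}h := h (fun i => etrans (gauss_kernel_int 0 (ltr01)) _).
have h1 : (1%:E * gauss_moment 0 = (fine (@gauss_moment R 0))%:E)%E.
  by rewrite mul1e gauss_momentK// ltrN10.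
have {h1}h := h h1.
apply: (@lt_le_trans _ _ (\prod_(i < n) fine (@gauss_moment R 0))%:E).
  by rewrite lte_fin prodr_gt0.
rewrite -h -[leRHS]mul1e -integral_cst//; apply: ge0_le_integral => //.
- by move=> t _; rewrite lee_fin prodr_ge0// => i _; exact: expR_ge0.
- apply/measurable_EFinP; apply: measurable_prod => i _.
  exact: (measurableT_comp (mf i) (measurable_tnth i)).
- move=> t _; rewrite lee_fin; apply: prodr_ile1 => i _.
  by rewrite expR_ge0 /f subr0 w1.
Qed.

(** Stands in for the evaluation of a Gaussian determinant: positivity and domination by a product
    kernel suffice for a positive finite mass. *)
Lemma gaussian_dominated n (psi : n.-tuple R -> R) (tau : 'I_n -> R) :
  measurable_fun setT psi -> (forall t, 0 < psi t) -> (forall i, 0 < tau i) ->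
  (forall t, psi t <= \prod_i expR (- (tnth t i ^+ 2 / (2 * tau i ^+ 2)))) ->
  exists2 r : R, 0 < r & (\int[lebesgue_tuple]_t (psi t)%:E = r%:E)%E.
Proof.
move=> mpsi psi0 tau0 dom.
pose f (i : 'I_n) (x : R) : R := expR (- ((x - 0) ^+ 2 / (2 * tau i ^+ 2))).
have mf i : measurable_fun [set: R] (f i).
  apply: measurableT_comp => //; apply: measurable_funN.
  by apply: measurable_funM => //; apply: measurable_funX; exact: measurable_funB.
have fi i : (\int[leb]_x (f i x)%:E = (tau i * fine (gauss_moment 0))%:E)%E.
  by rewrite gauss_kernel_int// EFinM gauss_momentK// ltrN10.
have h := @integral_tuple_prod R n f _ (fun i x => expR_ge0 _) mf fi.
have mpsi' : measurable_fun setT (fun t => (psi t)%:E) by apply/measurable_EFinP.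
have I0 : (0 < \int[lebesgue_tuple]_t (psi t)%:E)%E.
  apply: (ge0_integral_gt0 mpsi' _ measurableT (lebesgue_tuple_gt0 n)) => t.
    by rewrite lee_fin ltW.
  by rewrite lte_fin.
have I1 : (\int[lebesgue_tuple]_t (psi t)%:E < +oo)%E.
  apply: (@le_lt_trans _ _ (\prod_(i < n) (tau i * fine (gauss_moment 0)))%:E); last by rewrite ltry.
  rewrite -h; apply: ge0_le_integral => //.
  - by move=> t _; rewrite lee_fin ltW.
  - apply/measurable_EFinP; apply: measurable_prod => i _.
    exact: (measurableT_comp (mf i) (measurable_tnth i)).
  - move=> t _; rewrite lee_fin; apply: (le_trans (dom t)).
    by rewrite le_eqVlt; apply/orP; left; apply/eqP; apply: eq_bigr => i _; rewrite /f subr0.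
exists (fine (\int[lebesgue_tuple]_t (psi t)%:E)%E); first by rewrite fine_gt0// I0.
by rewrite fineK// ge0_fin_numE// ltW.
Qed.

End gaussian_tuple.

Section gaussian_marginal.
Context {R : realType} {m : nat}.
Local Notation leb := (@lebesgue_measure R).

(** The normal density with mean [c] and covariance [s2 Q^-1], up to normalization. *)
Definition gauss_tuple n (Q : 'M[R]_n) (c : 'cV[R]_n) (s2 : R) (x : 'cV[R]_n) : R :=
  expR (- (dotv (x - c) (Q *m (x - c)) / (2 * s2))).

Lemma measurable_gauss_tuple n Q c s2 d (T : measurableType d) (x : T -> 'cV[R]_n) :
  mx_measurable x -> measurable_fun setT (fun z => gauss_tuple Q c s2 (x z)).
Proof.
move=> mx; apply: measurableT_comp => //; apply: measurable_funN.
have mxc : mx_measurable (fun z => x z - c).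
  by apply: mx_measurableD => //; exact: mx_measurable_cst.
apply: measurable_funM => //; apply: measurable_sum => i; apply: measurable_funM; first exact: mxc.
by apply: (mx_measurableM _ mxc); exact: mx_measurable_cst.
Qed.

Lemma gauss_tuple_le n (B : 'M[R]_(m, n)) rho V s2 c x : 0 < rho -> 0 < s2 -> orthant V ->
  gauss_tuple (precision B rho V) c s2 x <=
  \prod_i expR (- ((x i 0 - c i 0) ^+ 2 / (2 * Num.sqrt (s2 * V i 0) ^+ 2))).
Proof.
move=> rho0 s20 V0; rewrite -expR_sum ler_expR sumrN lerN2.
apply: (@le_trans _ _ ((\sum_i (x - c) i 0 * (x - c) i 0 / V i 0) / (2 * s2))).
  rewrite mulr_suml; apply: ler_sum => i _; rewrite sqr_sqrtr; last first.
    by rewrite mulr_ge0 ?ltW// V0.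
  rewrite !mxE -expr2 -mulrA -invfM (mulrC (V i 0)) mulrA //.
by rewrite ler_wpM2r ?invr_ge0 ?mulr_ge0 ?(ltW s20)// precision_ge.
Qed.

Lemma gauss_tuple_mass n (B : 'M[R]_(m, n)) rho V s2 c : 0 < rho -> 0 < s2 -> orthant V ->
  exists2 r : R, 0 < r &
    (\int[lebesgue_tuple]_t (gauss_tuple (precision B rho V) c s2 (tuple_col t))%:E = r%:E)%E.
Proof.
move=> rho0 s20 V0; set F := fun t => (gauss_tuple (precision B rho V) c s2 (tuple_col t))%:E.
have mF : measurable_fun setT F.
  by apply/measurable_EFinP; apply: measurable_gauss_tuple; exact: mx_measurable_tuple_col.
have F0 t : (0 <= F t)%E by rewrite lee_fin expR_ge0.
rewrite -(integral_tuple_translation [tuple c i 0 | i < n] F0 mF).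
apply: (@gaussian_dominated _ _ _ (fun i => Num.sqrt (s2 * V i 0))).
- apply/measurable_EFinP; apply: (measurableT_comp mF); apply/measurable_fun_tnthP => i.
  rewrite (_ : _ \o _ = fun t => tnth t i + tnth [tuple c j 0 | j < n] i); last first.
    by apply/funext => t; rewrite /= tnth_mktuple.
  by apply: measurable_funD => //; exact: measurable_tnth.
- by move=> t; exact: expR_gt0.
- by move=> i; rewrite sqrtr_gt0 mulr_gt0// V0.
- move=> t; apply: (le_trans (gauss_tuple_le B _ _ rho0 s20 V0)).
  rewrite le_eqVlt; apply/orP; left; apply/eqP; apply: eq_bigr => i _.
  by rewrite mxE !tnth_mktuple addrK.
Qed.

(** For a fixed value [x] of coordinate [i], the other coordinates are translated along [v], so that
    the deviation from [c] becomes [(x - c_i) v + y] with [y_i = 0]; [precision_split] then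
    separates the integral. The unspecified factor [r] is the same for all [f]. *)
Lemma gaussian_tuple_marginal n (B : 'M[R]_(m, n)) rho V s2 (c v : 'cV[R]_n) (i : 'I_n) (s : R) :
  0 < rho -> 0 < s2 -> orthant V -> 0 < s -> v i 0 = 1 ->
  precision B rho V *m v = s *: delta_mx i 0 ->
  exists2 r : R, 0 < r & forall f : R -> \bar R, (forall x, 0 <= f x)%E ->
    measurable_fun setT f ->
    (\int[lebesgue_tuple]_t (f (tnth t i) *
       (gauss_tuple (precision B rho V) c s2 (tuple_col t))%:E) =
     r%:E * gauss_int f (c i 0)%R (Num.sqrt (s2 / s)))%E.
Proof.
move=> rho0 s20 V0 s0 vi Qv; case: n B V c v i V0 vi Qv => [|n] B V c v i V0 vi Qv; first by have := ltn_ord i.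
set Q := precision B rho V in Qv *; set xi := Num.sqrt (s2 / s).
have xi0 : 0 < xi by rewrite sqrtr_gt0 divr_gt0.
have xi2 : xi ^+ 2 = s2 / s by rewrite sqr_sqrtr// ltW// divr_gt0.
pose psi (t : n.-tuple R) := gauss_tuple Q 0 s2 (tuple_col (tuple_ins i 0 t)).
have mtins (g : n.-tuple R -> n.-tuple R) x : measurable_fun setT g ->
    measurable_fun setT (fun t => tuple_ins i x (g t)).
  by move=> mg; exact: measurable_tuple_ins.
have mpsi : measurable_fun setT psi.
  by apply: measurable_gauss_tuple; apply: mx_measurable_tuple_col; exact: mtins.
have [r r0 rE] : exists2 r : R, 0 < r & (\int[lebesgue_tuple]_t (psi t)%:E = r%:E)%E.
  apply: (@gaussian_dominated _ _ _ (fun j => Num.sqrt (s2 * V (lift i j) 0))) => //.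
  - by move=> t; exact: expR_gt0.
  - by move=> j; rewrite sqrtr_gt0 mulr_gt0// V0.
  - move=> t; apply: (le_trans (gauss_tuple_le B _ _ rho0 s20 V0)).
    rewrite (bigD1_ord i)//= !mxE tnth_tuple_ins subrr expr0n/= mul0r oppr0 expR0 mul1r.
    rewrite le_eqVlt; apply/orP; left; apply/eqP; apply: eq_bigr => j _.
    by rewrite !mxE tnth_tuple_ins_lift subr0.
exists (r * xi) => [|f f0 mf]; first exact: mulr_gt0.
have mgt : measurable_fun setT (fun t : n.+1.-tuple R => (gauss_tuple Q c s2 (tuple_col t))%:E).
  by apply/measurable_EFinP; apply: measurable_gauss_tuple; exact: mx_measurable_tuple_col.
have gt0 t : (0 <= (gauss_tuple Q c s2 (tuple_col t))%:E)%E by rewrite lee_fin expR_ge0.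
rewrite (integral_tuple_ins i); last 2 first.
- by move=> t; rewrite mule_ge0.
- by apply: emeasurable_funM => //; exact: (measurableT_comp mf (measurable_tnth i)).
have inner x : (\int[lebesgue_tuple]_t (f (tnth (tuple_ins i x t) i) *
    (gauss_tuple Q c s2 (tuple_col (tuple_ins i x t)))%:E) =
    r%:E * (f x * (expR (- ((x - c i 0) ^+ 2 / (2 * xi ^+ 2))))%:E))%E.
  under eq_integral do rewrite tnth_tuple_ins.
  have mg : measurable_fun setT (fun t : n.-tuple R => (gauss_tuple Q c s2 (tuple_col (tuple_ins i x t)))%:E).
    by apply: (measurableT_comp mgt); exact: mtins.
  rewrite ge0_integralZl//.
  rewrite muleCA; congr (_ * _)%E.
  pose a := [tuple (c + (x - c i 0) *: v) (lift i j) 0 | j < n].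
  rewrite -(integral_tuple_translation a (fun t => gt0 _) mg).
  rewrite -rE muleC -ge0_integralZl//; last 2 first.
  - exact/measurable_EFinP.
  - by move=> t _; rewrite lee_fin expR_ge0.
  apply: eq_integral => t _; rewrite -EFinM; congr (_%:E).
  rewrite /psi /gauss_tuple -expRD; congr expR; rewrite subr0.
  set y := tuple_col (tuple_ins i 0 t).
  have -> : tuple_col (tuple_ins i x [tuple (tnth t j + tnth a j)%R | j < n]) - c =
      (x - c i 0) *: v + y.
    apply/colP => l; rewrite !mxE; case: (unliftP i l) => [j|] ->.
      by rewrite !tnth_tuple_ins_lift !tnth_mktuple !mxE; ring.
    by rewrite !tnth_tuple_ins vi mulr1 addr0.
  have yi : y i 0 = 0 by rewrite mxE tnth_tuple_ins.
  rewrite (precision_split _ vi Qv yi) xi2.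
  move: (dotv _ _) => z; have sn := lt0r_neq0 s0; have s2n := lt0r_neq0 s20.
  clear -sn s2n; field; rewrite sn s2n.
  done.
under eq_integral do rewrite inner.
pose h (x : R) : \bar R := (f x * (expR (- ((x - c i 0) ^+ 2 / (2 * xi ^+ 2))))%:E)%E.
have h0 x : (0 <= h x)%E by rewrite mule_ge0// lee_fin expR_ge0.
have mh : measurable_fun setT h.
  apply: emeasurable_funM => //; apply/measurable_EFinP; apply: measurableT_comp => //.
  apply: measurable_funN; apply: measurable_funM => //; apply: measurable_funX.
  exact: measurable_funB.
have r0E : (0 <= r%:E)%E by rewrite lee_fin ltW.
rewrite (ge0_integralZl leb measurableT mh (fun x _ => h0 x) r0E) /h.
by rewrite gauss_int_affine// EFinM muleA.
Qed.

End gaussian_marginal.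

(** * The law of M given V *)

Section drawM.
Context {R : realType} {m n k : nat} (md : llnGm R m n k) (Y : 'cV[R]_m).
Local Notation B := (mdlB md).
Local Notation sigma := (mdl_sigma md).
Hypotheses (sigma0 : 0 < sigma) (sigma_eps0 : 0 < mdl_sigma_eps md).
Hypothesis condM_gt0 : forall V M, orthant V -> 0 < condM_pdf md Y V M.
Local Notation Q := (precision B (rho md)).

Lemma rho_gt0 : 0 < rho md.
Proof. by rewrite /rho mulr_gt0 ?invr_gt0 ?exprn_gt0. Qed.

Let sigma20 : 0 < sigma ^+ 2. Proof. exact: exprn_gt0. Qed.

Definition meanM V := invmx (Q V) *m barm md Y.

Lemma condM_pdfE V : orthant V -> exists2 l : R, 0 < l & forall M,
  condM_pdf md Y V M = l * gauss_tuple (Q V) (meanM V) (sigma ^+ 2) M.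
Proof.
move=> V0; have Qu := precision_unit B rho_gt0 V0.
pose D := Num.sqrt ((2 * pi) ^+ n * \det (sigma ^+ 2 *: invmx (Q V))).
have E M : condM_pdf md Y V M = D^-1 * gauss_tuple (Q V) (meanM V) (sigma ^+ 2) M.
  rewrite /condM_pdf /mvnormal_pdf barQE// mulrC /gauss_tuple -dotvE; congr (_ * expR (- _)).
  rewrite invmxZ; last by rewrite unitmxZ ?unitmx_inv// unitfE gt_eqF.
  rewrite invmxK -mulmxA -scalemxAl -scalemxAr mxE -/(meanM V).
  rewrite (mulrC 2 (sigma ^+ 2)) (invfM (sigma ^+ 2) 2) mulrA; congr (_ * _); exact: mulrC.
(* The assumed positivity of the density provides [D^-1 > 0]. *)
exists D^-1 => //; have := condM_gt0 0 V0.
by rewrite E pmulr_lgt0// expR_gt0.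
Qed.

Lemma drawM_integral V : orthant (tuple_col V) -> exists2 l : R, 0 < l &
  forall g : n.-tuple R -> \bar R, (forall t, 0 <= g t)%E -> measurable_fun setT g ->
  (\int[drawM md Y V]_M g M = l%:E * \int[lebesgue_tuple]_M (g M *
     (gauss_tuple (Q (tuple_col V)) (meanM (tuple_col V)) (sigma ^+ 2) (tuple_col M))%:E))%E.
Proof.
move=> V0; have [l l0 lE] := condM_pdfE V0.
have [r r0 rE] := gauss_tuple_mass B (meanM (tuple_col V)) rho_gt0 sigma20 V0.
have mG : measurable_fun setT (fun M : n.-tuple R =>
    (gauss_tuple (Q (tuple_col V)) (meanM (tuple_col V)) (sigma ^+ 2) (tuple_col M))%:E).
  by apply/measurable_EFinP; apply: measurable_gauss_tuple; exact: mx_measurable_tuple_col.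
exists r^-1 => [|g g0 mg]; first by rewrite invr_gt0.
have cE : (\int[lebesgue_tuple]_M (condM_pdf md Y (tuple_col V) (tuple_col M))%:E = (l * r)%:E)%E.
  under eq_integral do rewrite lE EFinM.
  rewrite ge0_integralZl_EFin ?(ltW l0)//; first by rewrite rE.
  by move=> t _; rewrite lee_fin expR_ge0.
apply: etrans (integral_mnormalize_density _ _ _ (mulr_gt0 l0 r0) cE g0 mg) _.
under eq_integral => M _.
  have -> : ((condM_pdf md Y (tuple_col V) (tuple_col M))%:E * g M = l%:E * (g M *
     (gauss_tuple (Q (tuple_col V)) (meanM (tuple_col V)) (sigma ^+ 2) (tuple_col M))%:E))%E.
    by rewrite lE EFinM -muleA (muleC (g M)).
  over.
rewrite ge0_integralZl_EFin ?(ltW l0)//; last 2 first.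
- by move=> t _; rewrite mule_ge0// lee_fin expR_ge0.
- exact: emeasurable_funM.
by rewrite muleA -EFinM invfM mulrAC mulVf ?mul1r// gt_eqF.
Qed.

(** Testing against [f = 1] identifies the unknown factor as the inverse of [gauss_moment 0]. The
    lower bound on [s] serves the positive moments of [M_i], the upper bound the negative ones. *)
Lemma drawM_marginal V i : orthant (tuple_col V) -> exists s : R,
  [/\ (tnth V i)^-1 <= s, s <= (tnth V i)^-1 + rho md * dotv (col i B) (col i B) &
  forall f : R -> \bar R, (forall x, 0 <= f x)%E -> measurable_fun setT f ->
    (\int[drawM md Y V]_M f (tnth M i) * gauss_moment 0 =
     gauss_int f (meanM (tuple_col V) i 0)%R (Num.sqrt (sigma ^+ 2 / s)))%E].
Proof.
move=> V0; have [v [s [vi Qv s1 s2]]] := precision_direction B rho_gt0 i V0.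
have ViE : tuple_col V i 0 = tnth V i by rewrite mxE.
have s0 : 0 < s by apply: lt_le_trans s1; rewrite invr_gt0 V0.
exists s; rewrite -ViE; split=> // f f0 mf.
have [l l0 lE] := drawM_integral V0.
have [r r0 rE] := gaussian_tuple_marginal (meanM (tuple_col V)) rho_gt0 sigma20 V0 s0 vi Qv.
have key (h : R -> \bar R) : (forall x, 0 <= h x)%E -> measurable_fun setT h ->
    (\int[drawM md Y V]_M h (tnth M i) = (l * r)%:E *
     gauss_int h (meanM (tuple_col V) i 0)%R (Num.sqrt (sigma ^+ 2 / s)))%E.
  move=> h0 mh; rewrite (lE (fun M => h (tnth M i)))//; last first.
    exact: (measurableT_comp mh (measurable_tnth i)).
  by rewrite rE// muleA.
have := key (fun=> 1%E) (fun=> lee01) (measurable_cst _).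
rewrite gauss_int1 integral_cst// mul1e (_ : drawM md Y V setT = 1%E); last exact: prob_kernel.
move=> e1.
by rewrite key// muleAC -e1 mul1e.
Qed.

End drawM.

(** * The law of V given M *)

Section drawV.
Context {R : realType} {m n k : nat} (md : llnGm R m n k) (Y : 'cV[R]_m).
Local Notation leb := (@lebesgue_measure R).
Local Notation sigma := (mdl_sigma md).

Definition gq := mdl_p md - 2^-1.
Definition gc := mdl_a md + mdl_mu md ^+ 2 / sigma ^+ 2.
Definition gd (x : R) := mdl_b md + x ^+ 2 / sigma ^+ 2.

Definition adm_tuple (M : n.-tuple R) := forall i, gig_adm gq gc (gd (tnth M i)).

Lemma condV_pdfE (M V : n.-tuple R) : condV_pdf md (tuple_col M) (tuple_col V) =
  \prod_i gig_pdf gq gc (gd (tnth M i)) (tnth V i).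
Proof. by apply: eq_bigr => i _; rewrite !mxE. Qed.

Lemma measurable_gig_pdf_arg q c d : measurable_fun [set: R] (gig_pdf q c d).
Proof. exact: measurable_gig_pdf. Qed.

Lemma integral_gig_pdf q c d : gig_adm q c d -> (\int[leb]_x (gig_pdf q c d x)%:E = 1%:E)%E.
Proof.
move=> a; have [M M0 ME] := gig_massP a.
have E : (\int[leb]_x (gig_pdf q c d x)%:E = M^-1%:E * gig_mass q c d)%E.
  rewrite gig_massE -ge0_integralZl_EFin ?invr_ge0 ?(ltW M0)//; last 2 first.
  - by move=> x _; rewrite lee_fin gig_fun_ge0.
  - exact: measurable_gig_EFin.
  by apply: eq_integral => x _; rewrite -EFinM /gig_pdf -gig_massE ME mulrC.
by rewrite E ME -EFinM mulVf// gt_eqF.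
Qed.

Lemma drawV_integral M (g : n.-tuple R -> \bar R) : adm_tuple M ->
  (forall t, 0 <= g t)%E -> measurable_fun setT g ->
  (\int[drawV md M]_V g V =
   \int[lebesgue_tuple]_V ((condV_pdf md (tuple_col M) (tuple_col V))%:E * g V))%E.
Proof.
move=> aM g0 mg.
have cE : (\int[lebesgue_tuple]_V (condV_pdf md (tuple_col M) (tuple_col V))%:E = (1 : R)%:E)%E.
  under eq_integral do rewrite condV_pdfE.
  rewrite (integral_tuple_prod (f := fun i => gig_pdf gq gc (gd (tnth M i))) (c := fun=> 1)) ?big1//.
  - by move=> i x; exact: gig_pdf_ge0.
  - by move=> i; exact: measurable_gig_pdf_arg.
  - by move=> i; exact: integral_gig_pdf.
apply: etrans (integral_mnormalize_density _ _ _ ltr01 cE g0 mg) _.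
by rewrite invr1 mul1e.
Qed.

Lemma condV_pdf_out M V : ~ orthant (tuple_col V) -> condV_pdf md M (tuple_col V) = 0.
Proof.
move=> /existsNP[i /negP]; rewrite -leNgt mxE => Vi.
by rewrite /condV_pdf (bigD1 i)//= /gig_pdf mxE gig_fun_le0// mul0r mul0r.
Qed.

Lemma measurable_condV_pdf M : measurable_fun setT (fun V : n.-tuple R =>
  (condV_pdf md M (tuple_col V))%:E).
Proof.
apply/measurable_EFinP; apply: measurable_prod => i _.
apply: measurable_gig_pdf => //.
by under eq_fun do rewrite mxE; exact: measurable_tnth.
Qed.

Lemma drawV_le_integral M (f g : n.-tuple R -> \bar R) : adm_tuple M ->
  (forall t, 0 <= f t)%E -> measurable_fun setT f ->
  (forall t, 0 <= g t)%E -> measurable_fun setT g ->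
  (forall V, orthant (tuple_col V) -> f V <= g V)%E ->
  (\int[drawV md M]_V f V <= \int[drawV md M]_V g V)%E.
Proof.
move=> aM f0 mf g0 mg fg; rewrite !drawV_integral//.
have c0 V : (0 <= (condV_pdf md (tuple_col M) (tuple_col V))%:E)%E.
  by rewrite lee_fin prodr_ge0// => i _; exact: gig_pdf_ge0.
have mc := measurable_condV_pdf (tuple_col M).
apply: ge0_le_integral => //.
- by move=> V _; rewrite mule_ge0.
- exact: emeasurable_funM.
- exact: emeasurable_funM.
- move=> V _; have [oV|/(condV_pdf_out (tuple_col M)) ->] := pselect (orthant (tuple_col V)).
    by rewrite lee_wpmul2l// fg.
  by rewrite !mul0e.
Qed.

(** The other coordinates integrate to 1. The normalizing mass stands on the left so that no
    division occurs in the extended reals. *)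
Lemma drawV_marginal M i (w : R -> \bar R) : adm_tuple M ->
  (forall x, 0 <= w x)%E -> measurable_fun setT w ->
  (\int[drawV md M]_V w (tnth V i) * gig_mass gq gc (gd (tnth M i)) =
   \int[leb]_x (w x * (gig_fun gq gc (gd (tnth M i)) x)%:E))%E.
Proof.
move=> aM w0 mw; rewrite (drawV_integral (g := fun V => w (tnth V i)))//; last first.
  exact: (measurableT_comp mw (measurable_tnth i)).
have [J J0 JE] := gig_massP (aM i).
under eq_integral do rewrite condV_pdfE.
pose G i := gig_pdf gq gc (gd (tnth M i)).
have G0 j x : 0 <= G j x by exact: gig_pdf_ge0.
have mG j : measurable_fun setT (G j) by exact: measurable_gig_pdf_arg.
suff -> : (\int[lebesgue_tuple]_V ((\prod_j G j (tnth V j))%:E * w (tnth V i)) =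
    \int[leb]_x (w x * (G i x)%:E))%E.
  rewrite JE muleC -ge0_integralZl_EFin ?(ltW J0)//; last 2 first.
  - by move=> x _; rewrite mule_ge0// lee_fin.
  - by apply: emeasurable_funM; [exact: mw|apply/measurable_EFinP; exact: mG].
  apply: eq_integral => x _; rewrite muleCA -EFinM /G /gig_pdf -gig_massE JE/=.
  by rewrite mulrC divfK// gt_eqF.
have G1 j : (\int[leb]_x (G j x)%:E = 1%:E)%E by exact: integral_gig_pdf.
move: G0 mG G1; move: (G) => {G aM J J0 JE}.
case: n M i => [|n'] M i G G0 mG G1; first by have := ltn_ord i.
rewrite (integral_tuple_ins i); last 2 first.
- by move=> t; rewrite mule_ge0// lee_fin prodr_ge0.
- apply: emeasurable_funM => //; last exact: (measurableT_comp mw (measurable_tnth i)).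
  apply/measurable_EFinP; apply: measurable_prod => j _.
  exact: (measurableT_comp (mG j) (measurable_tnth j)).
apply: eq_integral => x _.
have E (t : n'.-tuple R) : (((\prod_j G j (tnth (tuple_ins i x t) j))%:E *
    w (tnth (tuple_ins i x t) i)) =
    (w x * (G i x)%:E) * (\prod_j G (lift i j) (tnth t j))%:E)%E.
  rewrite (bigD1_ord i)//= tnth_tuple_ins EFinM muleAC (muleC _ (w x)).
  congr (_ * (_)%:E)%E; apply: eq_bigr => j _.
  by rewrite tnth_tuple_ins_lift.
under eq_integral do rewrite E.
have mp : measurable_fun setT (fun t : n'.-tuple R => (\prod_j G (lift i j) (tnth t j))%:E).
  apply/measurable_EFinP; apply: measurable_prod => j _.
  exact: (measurableT_comp (mG _) (measurable_tnth j)).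
rewrite ge0_integralZl//.
- rewrite (integral_tuple_prod (f := fun j => G (lift i j)) (c := fun=> 1))//.
  by rewrite big1// mule1.
- by move=> t _; rewrite lee_fin prodr_ge0.
- by rewrite mule_ge0// lee_fin.
Qed.

End drawV.

(** * The posterior and its invariance *)

Section joint.
Context {R : realType} {m n k : nat} (md : llnGm R m n k) (Y : 'cV[R]_m).
Local Notation leb := (@lebesgue_measure R).
Local Notation B := (mdlB md).
Local Notation sigma := (mdl_sigma md).
Local Notation sigma_eps := (mdl_sigma_eps md).
Local Notation mu := (mdl_mu md).
Local Notation p := (mdl_p md).
Local Notation a := (mdl_a md).
Local Notation b := (mdl_b md).
Hypotheses (sigma0 : 0 < sigma) (sigma_eps0 : 0 < sigma_eps).
Local Notation Q := (precision B (rho md)).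

(** The data with all offsets removed: the likelihood depends on [M] through [resid - B M] only. *)
Definition resid : 'cV[R]_m := Y - mdlX md *m mdl_beta md + mu *: (B *m mdl_h md).

Let sigma20 : 0 < sigma ^+ 2. Proof. exact: exprn_gt0. Qed.

Lemma barmE : barm md Y = rho md *: (B^T *m resid) + mu *: const_mx 1.
Proof. by []. Qed.

Lemma sqrtr_prod I (r : seq I) (f : I -> R) : (forall i, 0 <= f i) ->
  Num.sqrt (\prod_(i <- r) f i) = \prod_(i <- r) Num.sqrt (f i).
Proof.
move=> f0; elim: r => [|i r IH]; first by rewrite !big_nil sqrtr1.
by rewrite !big_cons sqrtrM// IH.
Qed.

Lemma lik_pdfE : exists2 l : R, 0 < l & forall M,
  mvnormal_pdf (mdlX md *m mdl_beta md + B *m (M - mu *: mdl_h md)) (sigma_eps ^+ 2)%:M Y =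
  l * expR (- (rho md * dotv (resid - B *m M) (resid - B *m M) / (2 * sigma ^+ 2))).
Proof.
pose D : R := Num.sqrt ((2 * pi) ^+ m * \det ((sigma_eps ^+ 2)%:M : 'M[R]_m)).
have D0 : 0 < D.
  by rewrite sqrtr_gt0 det_scalar mulr_gt0 ?exprn_gt0// mulr_gt0 ?pi_gt0.
exists D^-1 => [|M]; first by rewrite invr_gt0.
rewrite /mvnormal_pdf mulrC; congr (_ * expR (- _)).
have -> : Y - (mdlX md *m mdl_beta md + B *m (M - mu *: mdl_h md)) = resid - B *m M.
  rewrite /resid mulmxBr -scalemxAr !opprD opprK !addrA.
  by rewrite [LHS]addrAC.
move: (resid - B *m M) => v; rewrite invmx_scalar -mulmxA mul_scalar_mx -scalemxAr mxE.
rewrite (dotvE v v) /rho; move: (dotv v v) => x.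
have s1 := lt0r_neq0 sigma0; have s2 := lt0r_neq0 sigma_eps0.
field; rewrite s1 s2.
done.
Qed.

Lemma prior_pdfE (V M : 'cV[R]_n) : orthant V ->
  mvnormal_pdf (mu *: V) (diag_mx (sigma ^+ 2 *: V^T)) M =
  \prod_i ((Num.sqrt (2 * pi * sigma ^+ 2 * V i 0))^-1 *
    expR (- ((M i 0 - mu * V i 0) ^+ 2 / (2 * (sigma ^+ 2 * V i 0))))).
Proof.
move=> V0; rewrite big_split/= -expR_sum sumrN /mvnormal_pdf mulrC.
have VE : sigma ^+ 2 *: V^T = (sigma ^+ 2 *: V)^T by rewrite linearZ.
have oV : orthant (sigma ^+ 2 *: V) by move=> i; rewrite mxE mulr_gt0.
congr (_ * expR (- _)); last first.
  rewrite VE invmx_diag// -mulmxA dotvE mulr_suml; apply: eq_bigr => i _.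
  rewrite mul_diag_mx !mxE; move: (M i 0 - mu * V i 0) => x.
  have Vi := lt0r_neq0 (V0 i); have s1 := lt0r_neq0 sigma20; move: (V i 0) Vi => v vn.
  by move: (sigma ^+ 2) s1 => s s1; field; rewrite vn s1.
rewrite prodfV; congr _^-1; rewrite -sqrtr_prod; last first.
  by move=> i; rewrite !mulr_ge0 ?pi_ge0 ?(ltW (V0 i)) ?ltW.
congr Num.sqrt; rewrite det_diag -[X in _ ^+ X](card_ord n) -prodr_const -big_split/=.
by apply: eq_bigr => i _; rewrite !mxE mulrA.
Qed.

Lemma joint_pdf_out (V M : 'cV[R]_n) : ~ orthant V -> joint_pdf md Y V M = 0.
Proof.
move=> /existsNP[i /negP]; rewrite -leNgt => Vi.
by rewrite /joint_pdf (bigD1 i)//= /gig_pdf gig_fun_le0// mul0r mul0r mulr0.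
Qed.

Lemma complete_square (V M : 'cV[R]_n) : orthant V ->
  rho md * dotv (resid - B *m M) (resid - B *m M) + \sum_i (M i 0 - mu * V i 0) ^+ 2 / V i 0 =
  dotv (M - meanM md Y V) (Q V *m (M - meanM md Y V)) +
  (rho md * dotv resid resid + mu ^+ 2 * \sum_i V i 0 - dotv (meanM md Y V) (barm md Y)).
Proof.
move=> V0; have Qu := precision_unit B (rho_gt0 sigma0 sigma_eps0) V0.
set c := meanM md Y V; have Qc : Q V *m c = barm md Y by rewrite mulKVmx.
have -> : \sum_i (M i 0 - mu * V i 0) ^+ 2 / V i 0 =
    \sum_i M i 0 * M i 0 / V i 0 - 2 * mu * dotv M (const_mx 1) + mu ^+ 2 * \sum_i V i 0.
  rewrite !mulr_sumr -sumrN -!big_split/=; apply: eq_bigr => i _; rewrite mxE.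
  have := lt0r_neq0 (V0 i); move: (V i 0) (M i 0) => v x vn;
  by field.
move: (resid) (barm md Y) (barmE) Qc => w q bE Qc.
rewrite mulmxBr Qc !(dotvDl, dotvDr, dotvNl, dotvNr).
rewrite (dotv_precisionC B _ V c M) Qc dotv_precision.
rewrite bE !(dotvDr, dotvZr) !(dotv_mulmx B^T) trmxK (dotvC w (B *m M)).
by move: (dotv (B *m M) w) (dotv (B *m c) w) (dotv c _) (dotv M _) => *; ring.
Qed.

Lemma joint_gaussM (V : 'cV[R]_n) : orthant V -> gig_adm p a b -> exists2 l : R, 0 < l & forall M,
  joint_pdf md Y V M = l * gauss_tuple (Q V) (meanM md Y V) (sigma ^+ 2) M.
Proof.
move=> V0 adm; have [l l0 lE] := lik_pdfE.
have [J J0 JE] := gig_massP adm.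
pose kap := rho md * dotv resid resid + mu ^+ 2 * \sum_i V i 0 - dotv (meanM md Y V) (barm md Y).
pose D := \prod_i (Num.sqrt (2 * pi * sigma ^+ 2 * V i 0))^-1.
have D0 : 0 < D.
  apply: prodr_gt0 => i _; rewrite invr_gt0 sqrtr_gt0 !mulr_gt0 ?pi_gt0//; exact: V0.
pose G := \prod_i gig_pdf p a b (V i 0).
have G0 : 0 < G.
  apply: prodr_gt0 => i _; rewrite /gig_pdf -gig_massE JE/= divr_gt0//.
  by apply: gig_fun_gt0; exact: V0.
exists (l * D * G * expR (- (kap / (2 * sigma ^+ 2)))) => [|M].
  by rewrite !mulr_gt0// expR_gt0.
rewrite /joint_pdf lE prior_pdfE// big_split/= -/D -/G -expR_sum sumrN.
rewrite /gauss_tuple.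
have -> : \sum_i (M i 0 - mu * V i 0) ^+ 2 / (2 * (sigma ^+ 2 * V i 0)) =
    (\sum_i (M i 0 - mu * V i 0) ^+ 2 / V i 0) / (2 * sigma ^+ 2).
  rewrite mulr_suml; apply: eq_bigr => i _; rewrite -mulrA -invfM; congr (_ / _).
  by rewrite mulrC mulrA [in RHS]mulrC -mulrA mulrCA.
have E : expR (- (rho md * dotv (resid - B *m M) (resid - B *m M) / (2 * sigma ^+ 2))) *
   expR (- ((\sum_i (M i 0 - mu * V i 0) ^+ 2 / V i 0) / (2 * sigma ^+ 2))) =
   expR (- (kap / (2 * sigma ^+ 2))) *
   expR (- (dotv (M - meanM md Y V) (Q V *m (M - meanM md Y V)) / (2 * sigma ^+ 2))).
  have h (u v x y t : R) : u + v = x + y ->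
      expR (- (u / t)) * expR (- (v / t)) = expR (- (x / t)) * expR (- (y / t)).
    by move=> uv; rewrite -!expRD -(opprD (u / t)) -(opprD (x / t)) -(mulrDl u) uv (mulrDl x).
  by apply: h; rewrite complete_square// addrC.
rewrite -[RHS]mulrA -E.
by move: (expR _) (expR _) => x y; ring.
Qed.

(** Expanding [(M_i - mu V_i)^2 / (sigma^2 V_i)] adds [M_i^2 / sigma^2] to the second GIG parameter
    and [mu^2 / sigma^2] to the first, and leaves a cross term free of [V]; the normalization
    [V_i^(-1/2)] of the Gaussian shifts the index to [p - 1/2]. *)
Lemma joint_gigV (M : 'cV[R]_n) : gig_adm p a b -> exists2 e : R, 0 < e & forall V,
  joint_pdf md Y V M = e * \prod_i gig_fun (gq md) (gc md) (gd md (M i 0)) (V i 0).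
Proof.
move=> adm; have [l l0 lE] := lik_pdfE.
have [J J0 JE] := gig_massP adm.
pose L := l * expR (- (rho md * dotv (resid - B *m M) (resid - B *m M) / (2 * sigma ^+ 2))).
pose F i := (Num.sqrt (2 * pi * sigma ^+ 2))^-1 * expR (mu * M i 0 / sigma ^+ 2) / J.
have c0 : 0 < 2 * pi * sigma ^+ 2 :> R by rewrite !mulr_gt0// pi_gt0.
exists (L * \prod_i F i) => [|V].
  rewrite !mulr_gt0 ?expR_gt0//; apply: prodr_gt0 => i _.
  by rewrite !mulr_gt0 ?invr_gt0 ?sqrtr_gt0 ?expR_gt0.
have [V0|nV] := pselect (orthant V); last first.
  rewrite joint_pdf_out//; move/existsNP: nV => [i /negP]; rewrite -leNgt => Vi.
  by rewrite [X in _ * X](bigD1 i)//= gig_fun_le0// mul0r mulr0.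
rewrite /joint_pdf lE prior_pdfE// -/L -(mulrA L) -(mulrA L); congr (_ * _).
rewrite -!big_split/=; apply: eq_bigr => i _.
have Vi : 0 < V i 0 by exact: V0.
rewrite /gig_pdf -gig_massE JE/= (gig_funE _ _ _ Vi) (gig_funE _ _ _ Vi).
have -> : (Num.sqrt (2 * pi * sigma ^+ 2 * V i 0))^-1 =
    (Num.sqrt (2 * pi * sigma ^+ 2))^-1 * V i 0 `^ (- 2^-1).
  by rewrite sqrtrM ?(ltW c0)// invfM powRN powR12_sqrt// ltW.
rewrite /F.
have -> : gq md - 1 = - 2^-1 + (p - 1) by rewrite /gq; ring.
rewrite (@powRD _ (V i 0) (- 2^-1) (p - 1)); last by rewrite (gt_eqF Vi) implybT.
have -> : expR (- ((gc md * V i 0 + gd md (M i 0) / V i 0) / 2)) =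
    expR (- (mu * M i 0 / sigma ^+ 2)) *
    expR (- ((M i 0 - mu * V i 0) ^+ 2 / (2 * (sigma ^+ 2 * V i 0)))) *
    expR (- ((a * V i 0 + b / V i 0) / 2)).
  rewrite -!expRD; congr expR; rewrite /gc /gd.
  have := lt0r_neq0 Vi; have := lt0r_neq0 sigma20; move: (sigma ^+ 2) (V i 0) (M i 0).
  by move=> s v x sn vn; field; rewrite sn vn.
rewrite (expRN (mu * M i 0 / sigma ^+ 2)); have := expR_gt0 (mu * M i 0 / sigma ^+ 2) => /lt0r_neq0.
move: (expR (mu * M i 0 / sigma ^+ 2)) (expR _) (expR _) (V i 0 `^ _) (V i 0 `^ _) (Num.sqrt _)^-1 => x y z s t u xn.
by have Jn := lt0r_neq0 J0; field; rewrite xn Jn.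
Qed.

End joint.

(** * The two disintegrations of the joint density *)

Section invariance.
Context {R : realType} {m n k : nat} (md : llnGm R m n k) (Y : 'cV[R]_m).
Local Notation leb := (@lebesgue_measure R).
Local Notation B := (mdlB md).
Local Notation sigma := (mdl_sigma md).
Local Notation mu := (mdl_mu md).
Local Notation p := (mdl_p md).
Local Notation a := (mdl_a md).
Local Notation b := (mdl_b md).
Hypotheses (sigma0 : 0 < sigma) (sigma_eps0 : 0 < mdl_sigma_eps md).
Hypothesis condM_gt0 : forall V M, orthant V -> 0 < condM_pdf md Y V M.
Hypothesis adm0 : gig_adm p a b.
Hypothesis admd : forall x, x != 0 -> gig_adm (gq md) (gc md) (gd md x).
Local Notation joint V M := ((joint_pdf md Y (tuple_col V) (tuple_col M))%:E).
Local Notation T := (n.-tuple R).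
Local Open Scope ereal_scope.

Let joint0 (V M : T) : 0 <= joint V M.
Proof. by rewrite lee_fin joint_pdf_ge0. Qed.

Let mjoint : measurable_fun [set: T * T] (fun z => joint z.1 z.2).
Proof. by apply/measurable_EFinP; exact: measurable_joint_pdf. Qed.

Let mjointV (V : T) : measurable_fun [set: T] (fun M => joint V M).
Proof. exact: (measurableT_comp mjoint (pair1_measurable V)). Qed.

Let mjointM (M : T) : measurable_fun [set: T] (fun V => joint V M).
Proof. exact: (measurableT_comp mjoint (pair2_measurable M)). Qed.

Lemma marginal_drawM (V : T) (g : T -> \bar R) : (forall t, 0 <= g t) -> measurable_fun setT g ->
  marginal_fun md Y V * \int[drawM md Y V]_M g M =
  \int[lebesgue_tuple]_M (joint V M * g M).
Proof.
move=> g0 mg; have [oV|nV] := pselect (orthant (tuple_col V)); last first.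
  rewrite /marginal_fun; under eq_integral do rewrite joint_pdf_out//.
  by under [RHS]eq_integral do rewrite joint_pdf_out// mul0e; rewrite integral0 mul0e.
have [l l0 lE] := joint_gaussM Y sigma0 sigma_eps0 oV adm0.
have [r r0 rE] := drawM_integral sigma0 sigma_eps0 condM_gt0 oV.
have ln : (0 <= l)%R by exact: ltW.
pose G (M : T) : R := gauss_tuple (precision B (rho md) (tuple_col V)) (meanM md Y (tuple_col V)) (sigma ^+ 2) (tuple_col M).
have G0 M : 0 <= (G M)%:E by rewrite lee_fin expR_ge0.
have mG : measurable_fun setT (fun M => (G M)%:E).
  by apply/measurable_EFinP; apply: measurable_gauss_tuple; exact: mx_measurable_tuple_col.
have key (h : T -> \bar R) : (forall t, 0 <= h t) -> measurable_fun setT h ->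
    \int[lebesgue_tuple]_M (joint V M * h M) = l%:E * \int[lebesgue_tuple]_M (h M * (G M)%:E).
  move=> h0 mh; rewrite -ge0_integralZl_EFin//; last 2 first.
  - by move=> M _; rewrite mule_ge0.
  - exact: emeasurable_funM.
  by apply: eq_integral => M _; rewrite lE EFinM -muleA (muleC (h M)).
have r1 : 1 = r%:E * \int[lebesgue_tuple]_M (G M)%:E.
  have := rE (fun=> 1) (fun=> lee01) (measurable_cst _).
  rewrite integral_cst// mul1e (_ : drawM md Y V setT = 1); last exact: prob_kernel.
  by under eq_integral do rewrite mul1e.
have -> : marginal_fun md Y V = l%:E * \int[lebesgue_tuple]_M (G M)%:E.
  have := key (fun=> 1) (fun=> lee01) (measurable_cst _).
  rewrite (eq_integral (fun M => joint V M)) => [|M _]; last by rewrite mule1.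
  by move=> e; apply: (etrans e); congr (_ * _); apply: eq_integral => M _; rewrite mul1e.
rewrite rE// key// -muleA (muleA _ r%:E) (muleC _ r%:E) -r1 mul1e.
done.
Qed.

Lemma joint_drawV (M : T) (g : T -> \bar R) : adm_tuple md M ->
  (forall t, 0 <= g t) -> measurable_fun setT g ->
  \int[lebesgue_tuple]_V (joint V M * g V) =
  (\int[lebesgue_tuple]_V joint V M) * \int[drawV md M]_V g V.
Proof.
move=> aM g0 mg; have [e e0 eE] := joint_gigV Y sigma0 sigma_eps0 (tuple_col M) adm0.
pose C (V : T) : R := condV_pdf md (tuple_col M) (tuple_col V).
pose D := (\prod_i fine (gig_mass (gq md) (gc md) (gd md (tnth M i))))%R.
have D0 : (0 < D)%R by apply: prodr_gt0 => i _; apply: fine_gig_mass_gt0.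
have jE V : joint V M = (e * D)%:E * (C V)%:E.
  rewrite eE -EFinM -[in RHS]mulrA; congr (_ * _)%:E.
  rewrite /C condV_pdfE /D -big_split/=; apply: eq_bigr => i _; rewrite !mxE /gig_pdf -gig_massE.
  by rewrite mulrC divfK// gt_eqF// fine_gig_mass_gt0.
have eD : (0 <= e * D)%R by rewrite mulr_ge0// ltW.
have C0 V : 0 <= (C V)%:E by rewrite lee_fin prodr_ge0// => i _; exact: gig_pdf_ge0.
have mC : measurable_fun setT (fun V => (C V)%:E) by exact: measurable_condV_pdf.
have key (h : T -> \bar R) : (forall t, 0 <= h t) -> measurable_fun setT h ->
    \int[lebesgue_tuple]_V (joint V M * h V) = (e * D)%:E * \int[drawV md M]_V h V.
  move=> h0 mh; rewrite drawV_integral// -ge0_integralZl_EFin//; last 2 first.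
  - by move=> V _; apply: mule_ge0; [exact: C0|exact: h0].
  - exact: (emeasurable_funM mC mh).
  by apply: eq_integral => V _; rewrite jE muleA.
rewrite key//; congr (_ * _).
have := key (fun=> 1) (fun=> lee01) (measurable_cst _).
rewrite integral_cst// mul1e (_ : drawV md M setT = 1); last exact: prob_kernel.
rewrite mule1 => E; rewrite -E; apply: eq_integral => V _; exact: mule1.
Qed.

Lemma hyperplane_null (i : 'I_n) : @lebesgue_tuple R n [set t | tnth t i = 0%R] = 0.
Proof.
have mS : measurable [set t : T | tnth t i = 0%R].
  rewrite -[X in measurable X]setTI.
  exact: (measurable_tnth i _ (measurable_set1 (0%R : R))).
transitivity (\int[@lebesgue_tuple R n]_t (\1_[set t : T | tnth t i = 0%R] t)%:E).
  by rewrite integral_indic// setIT.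
case: n i mS => [|n'] i mS; first by have := ltn_ord i.
rewrite (integral_tuple_ins i)//; last first.
  by apply/measurable_EFinP; exact: measurable_indic.
transitivity (\int[leb]_x ((\1_[set (0%R : R)] x)%:E * @lebesgue_tuple R n' setT)).
  apply: eq_integral => x _; rewrite -integral_cst//.
  apply: eq_integral => t _; rewrite /cst/= !indicE; congr (_%:E); congr (nat_of_bool _)%:R.
  by apply/idP/idP; rewrite !inE/= tnth_tuple_ins.
rewrite ge0_integralZr//; last first.
  by apply/measurable_EFinP; apply: measurable_indic; exact: measurable_set1.
rewrite integral_indic ?setIT//; transitivity (0 * @lebesgue_tuple R n' setT); last by rewrite mul0e.
congr (_ * _); exact: lebesgue_measure_set1.
Qed.

(** Inadmissible parameters can occur only at a zero coordinate, and coordinate hyperplanes are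
    null. *)
Lemma ae_adm_tuple : {ae @lebesgue_tuple R n, forall M, adm_tuple md M}.
Proof.
have : {ae @lebesgue_tuple R n, forall M, forall i, (tnth M i != 0)%R}.
  apply: filter_forall => i; exists [set t | tnth t i = 0%R]; split.
  - rewrite -[X in measurable X]setTI.
    exact: (measurable_tnth i _ (measurable_set1 (0%R : R))).
  - exact: hyperplane_null.
  - by move=> t /= /negP; rewrite negbK => /eqP.
by apply: filterS => M nz i; apply: admd; exact: nz.
Qed.

End invariance.

(** * Finiteness of the posterior mass and stationarity *)

Section posterior.
Context {R : realType} {m n k : nat} (md : llnGm R m n k) (Y : 'cV[R]_m).
Local Notation leb := (@lebesgue_measure R).
Local Notation sigma := (mdl_sigma md).
Local Notation mu := (mdl_mu md).
Local Notation p := (mdl_p md).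
Local Notation a := (mdl_a md).
Local Notation b := (mdl_b md).
Hypotheses (sigma0 : 0 < sigma) (sigma_eps0 : 0 < mdl_sigma_eps md).
Hypothesis condM_gt0 : forall V M, orthant V -> 0 < condM_pdf md Y V M.
Hypothesis adm0 : gig_adm p a b.
Hypothesis admd : forall x, x != 0 -> gig_adm (gq md) (gc md) (gd md x).
Local Notation joint V M := ((joint_pdf md Y (tuple_col V) (tuple_col M))%:E).
Local Notation T := (n.-tuple R).
Local Open Scope ereal_scope.

Let G (V : T) : R := (\prod_i gig_pdf p a b (tnth V i))%R.

Let G0 V : (0 <= G V)%R. Proof. by apply: prodr_ge0 => i _; exact: gig_pdf_ge0. Qed.

Let mG : measurable_fun setT (fun V => (G V)%:E).
Proof.
apply/measurable_EFinP; apply: measurable_prod => i _.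
exact: (measurableT_comp (measurable_gig_pdf_arg p a b) (measurable_tnth i)).
Qed.

Let G1 : \int[lebesgue_tuple]_V (G V)%:E = 1.
Proof.
rewrite (integral_tuple_prod (f := fun=> gig_pdf p a b) (c := fun=> 1%R)) ?big1//.
- by move=> i x; exact: gig_pdf_ge0.
- by move=> i; exact: measurable_gig_pdf_arg.
- by move=> i; exact: integral_gig_pdf.
Qed.

Let orthantG : [set V : T | orthant (tuple_col V)] = [set V | (0 < G V)%R].
Proof.
have [J J0 JE] := gig_massP adm0.
apply/seteqP; split => V /= h.
  apply: prodr_gt0 => i _; rewrite /gig_pdf -gig_massE JE/= divr_gt0//.
  by apply: gig_fun_gt0; have := h i; rewrite mxE.
move=> i; rewrite mxE ltNge; apply/negP => Vi.
by move: h; rewrite /G (bigD1 i)//= {1}/gig_pdf gig_fun_le0// !mul0r ltxx.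
Qed.

Lemma measurable_orthant : measurable [set V : T | orthant (tuple_col V)].
Proof.
rewrite orthantG -[X in measurable X]setTI.
have -> : [set V | (0 < G V)%R] = (fun V => (G V)%:E) @^-1` `]0, +oo[%classic.
  by apply/seteqP; split => V /=; rewrite in_itv/= lte_fin ?andbT// => /andP[].
by apply: mG => //; exact: emeasurable_itv.
Qed.

Lemma marginal_out (V : T) : ~ orthant (tuple_col V) -> marginal_fun md Y V = 0.
Proof.
move=> nV; rewrite /marginal_fun; under eq_integral do rewrite joint_pdf_out//.
exact: integral0.
Qed.

Lemma marginal_gt0 (V : T) : orthant (tuple_col V) -> 0 < marginal_fun md Y V.
Proof.
move=> oV; have [l l0 lE] := joint_gaussM Y sigma0 sigma_eps0 oV adm0.
apply: (@ge0_integral_gt0 _ _ _ _ _ setT) => //.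
- apply/measurable_EFinP.
  exact: (measurableT_comp (measurable_joint_pdf md Y) (pair1_measurable V)).
- by move=> M; rewrite lee_fin joint_pdf_ge0.
- exact: lebesgue_tuple_gt0.
- by move=> M _; rewrite lte_fin lE mulr_gt0// expR_gt0.
Qed.

(** The likelihood is bounded, so integrating out [M] leaves at most a multiple of the prior density
    of [V], which is integrable. *)
Lemma marginal_le : exists2 C : R, (0 <= C)%R & forall V : T,
  marginal_fun md Y V <= (C * G V)%:E.
Proof.
have [l l0 lE] := lik_pdfE Y sigma0 sigma_eps0.
have g0 : (0 < fine (@gauss_moment R 0))%R by apply: fine_gauss_moment_gt0; rewrite ltrN10.
have gK : (fine (@gauss_moment R 0))%:E = gauss_moment 0 by apply: gauss_momentK; rewrite ltrN10.
(* The total mass of one normal density, kept as a symbol. *)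
pose h := (fine (@gauss_moment R 0) / Num.sqrt (2 * pi))%R.
have h0 : (0 < h)%R by rewrite divr_gt0// sqrtr_gt0 mulr_gt0// pi_gt0.
exists (l * \prod_(i < n) h)%R => [|V].
  by rewrite mulr_ge0 ?(ltW l0)// prodr_ge0// => i _; exact: ltW.
have [oV|nV] := pselect (orthant (tuple_col V)); last first.
  by rewrite marginal_out// lee_fin mulr_ge0// mulr_ge0 ?(ltW l0)// prodr_ge0// => i _; exact: ltW.
pose f (i : 'I_n) (x : R) : R := ((Num.sqrt (2 * pi * sigma ^+ 2 * tnth V i))^-1 *
    expR (- ((x - mu * tnth V i) ^+ 2 / (2 * (sigma ^+ 2 * tnth V i)))))%R.
have f0 i x : (0 <= f i x)%R by rewrite mulr_ge0 ?invr_ge0 ?sqrtr_ge0 ?expR_ge0.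
have mf i : measurable_fun setT (f i).
  apply: measurable_funM => //; apply: measurableT_comp => //; apply: measurable_funN.
  by apply: measurable_funM => //; apply: measurable_funX; exact: measurable_funB.
have s2 : (0 < sigma ^+ 2)%R by exact: exprn_gt0.
have fi i : \int[leb]_x (f i x)%:E = h%:E.
  have Vi : (0 < tnth V i)%R by have := oV i; rewrite mxE.
  pose xi := Num.sqrt (sigma ^+ 2 * tnth V i).
  have xi0 : (0 < xi)%R by rewrite sqrtr_gt0 mulr_gt0.
  have xi2 : (xi ^+ 2 = sigma ^+ 2 * tnth V i)%R by rewrite sqr_sqrtr// ltW// mulr_gt0.
  transitivity (((Num.sqrt (2 * pi * sigma ^+ 2 * tnth V i))^-1)%:E *
     \int[leb]_x (expR (- ((x - mu * tnth V i) ^+ 2 / (2 * xi ^+ 2))))%:E).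
    have h0' x : 0 <= (expR (- ((x - mu * tnth V i) ^+ 2 / (2 * xi ^+ 2))))%:E.
      by rewrite lee_fin expR_ge0.
    have mh : measurable_fun setT (fun x : R => (expR (- ((x - mu * tnth V i) ^+ 2 / (2 * xi ^+ 2))))%:E).
      apply/measurable_EFinP; apply: measurableT_comp => //; apply: measurable_funN.
      by apply: measurable_funM => //; apply: measurable_funX; exact: measurable_funB.
    have k0 : 0 <= ((Num.sqrt (2 * pi * sigma ^+ 2 * tnth V i))^-1)%:E.
      by rewrite lee_fin invr_ge0 sqrtr_ge0.
    rewrite -(ge0_integralZl leb measurableT mh (fun x _ => h0' x) k0).
    by apply: eq_integral => x _; rewrite xi2.
  rewrite gauss_kernel_int// -gK -!EFinM; congr (_%:E).
  rewrite -(mulrA (2 * pi)%R) sqrtrM; last by rewrite mulr_ge0// pi_ge0.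
  rewrite -/xi invfM -mulrA mulKf ?gt_eqF// mulrC //.
have fprod : \int[lebesgue_tuple]_M (\prod_i f i (tnth M i))%:E = (\prod_(i < n) h)%:E.
  exact: (integral_tuple_prod f0 mf fi).
have lG : (0 <= l * G V)%R by rewrite mulr_ge0// ltW.
apply: (@le_trans _ _ (\int[lebesgue_tuple]_M ((l * G V)%:E * (\prod_i f i (tnth M i))%:E))).
  apply: ge0_le_integral => //.
  - by move=> M _; rewrite lee_fin joint_pdf_ge0.
  - apply/measurable_EFinP.
    exact: (measurableT_comp (measurable_joint_pdf md Y) (pair1_measurable V)).
  - apply: measurable_funeM; apply/measurable_EFinP; apply: measurable_prod => i _.
    exact: (measurableT_comp (mf i) (measurable_tnth i)).
  - move=> M _; rewrite -EFinM lee_fin /joint_pdf prior_pdfE// lE.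
    have -> : (\prod_(i < n) gig_pdf p a b (tuple_col V i ord0) = G V)%R.
      by apply: eq_bigr => i _; rewrite mxE.
    have -> : (\prod_i ((Num.sqrt (2 * pi * sigma ^+ 2 * tuple_col V i 0))^-1 *
       expR (- ((tuple_col M i 0 - mu * tuple_col V i 0) ^+ 2 / (2 * (sigma ^+ 2 * tuple_col V i 0))))) =
       \prod_i f i (tnth M i))%R.
      by apply: eq_bigr => i _; rewrite !mxE.
    rewrite mulrAC ler_wpM2r ?prodr_ge0// ler_wpM2r// ler_piMr ?(ltW l0)//.
    rewrite -[leRHS]expR0 ler_expR oppr_le0 divr_ge0//; last by rewrite mulr_ge0// ltW.
    by rewrite mulr_ge0 ?dotvv_ge0// ltW// rho_gt0.
rewrite ge0_integralZl_EFin//; last 2 first.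
- by move=> M _; rewrite lee_fin prodr_ge0.
- apply/measurable_EFinP; apply: measurable_prod => i _.
  exact: (measurableT_comp (mf i) (measurable_tnth i)).
by rewrite fprod -EFinM lee_fin mulrAC.
Qed.

Lemma posterior_mass : exists2 Z : R, (0 < Z)%R &
  \int[lebesgue_tuple]_V marginal_fun md Y V = Z%:E.
Proof.
have mM := measurable_marginal_fun md Y.
have M0 := marginal_fun_ge0 md Y.
have Zlt : \int[lebesgue_tuple]_V marginal_fun md Y V < +oo.
  have [C C0 CE] := marginal_le.
  apply: (@le_lt_trans _ _ (\int[lebesgue_tuple]_V (C%:E * (G V)%:E))).
    by apply: ge0_le_integral => //; exact: measurable_funeM.
  rewrite ge0_integralZl_EFin//; first by rewrite G1 mule1 ltry.
  by move=> V _; rewrite lee_fin.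
have Zgt : 0 < \int[lebesgue_tuple]_V marginal_fun md Y V.
  apply: (@ge0_integral_gt0 _ _ _ _ _ [set V : T | orthant (tuple_col V)]) => //.
  - exact: measurable_orthant.
  (* The orthant is not null, since the prior density vanishes off it and integrates to 1. *)
  - rewrite lt_neqAle measure_ge0 andbT; apply/eqP => l0.
    have : \int[@lebesgue_tuple R n]_V (G V)%:E = \int[@lebesgue_tuple R n]_V (cst 0 V).
      apply: ge0_ae_eq_integral => //; first by move=> V _; rewrite lee_fin.
      exists [set V : T | orthant (tuple_col V)]; split => //; first exact: measurable_orthant.
      move=> V /= h; have := orthantG => /seteqP[_ /(_ V)]; apply => /=.
      rewrite lt_neqAle G0 andbT; apply/eqP => G0'; apply: h => _.
      by rewrite -G0'.
    by rewrite G1 integral0 => /eqP; rewrite onee_eq0.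
  - by move=> V; exact: marginal_gt0.
exists (fine (\int[lebesgue_tuple]_V marginal_fun md Y V)); first by rewrite fine_gt0// Zgt.
by rewrite fineK// ge0_fin_numE// ltW.
Qed.

Lemma posterior_integral : exists2 Z : R, (0 < Z)%R & forall g : T -> \bar R,
  (forall t, 0 <= g t) -> measurable_fun setT g ->
  \int[posterior md Y]_V g V = Z^-1%:E * \int[lebesgue_tuple]_V (marginal_fun md Y V * g V).
Proof.
have [Z Z0 ZE] := posterior_mass.
exists Z => // g g0 mg.
exact: (integral_mnormalize_density _ _ _ Z0 ZE g0 mg).
Qed.

Lemma posterior_orthant : {ae posterior md Y, forall V, orthant (tuple_col V)}.
Proof.
exists (~` [set V : T | orthant (tuple_col V)]); split => //.
  by apply: measurableC; exact: measurable_orthant.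
have mC : measurable (~` [set V : T | orthant (tuple_col V)]).
  by apply: measurableC; exact: measurable_orthant.
have [Z Z0 ZE] := posterior_integral.
have := ZE (fun V => (\1_(~` [set V : T | orthant (tuple_col V)]) V)%:E).
rewrite integral_indic// setIT => ->//; last first.
  by apply/measurable_EFinP; exact: measurable_indic.
rewrite integral0_eq ?mule0// => V _; rewrite indicE.
have [oV|nV] := pselect (orthant (tuple_col V)); last by rewrite marginal_out// mul0e.
by rewrite memNset ?mule0//= => nV; exact: nV.
Qed.

(** Both sides are the same double integral of the joint density: [marginal_drawM] produces it,
    Tonelli's theorem exchanges the order, and [joint_drawV] recombines it for almost every [M]. *)
Lemma gibbs_invariant A : measurable A ->
  \int[posterior md Y]_V gibbs md Y V A = posterior md Y A.
Proof.
move=> mA; have [Z Z0 ZE] := posterior_integral.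
have g0 M : 0 <= drawV md M A by exact: measure_ge0.
have mg : measurable_fun setT (fun M => drawV md M A) by exact: measurable_kernel.
have mjoint : measurable_fun [set: T * T] (fun z => joint z.1 z.2).
  by apply/measurable_EFinP; exact: measurable_joint_pdf.
have j0 V M : 0 <= joint V M by rewrite lee_fin joint_pdf_ge0.
have i0 V : 0 <= (\1_A V)%:E :> \bar R by rewrite lee_fin.
have mi : measurable_fun setT (fun V : T => (\1_A V)%:E : \bar R).
  by apply/measurable_EFinP; exact: measurable_indic.
have -> : posterior md Y A = \int[posterior md Y]_V (\1_A V)%:E.
  by rewrite integral_indic// setIT.
rewrite !ZE//; last exact: measurable_kernel.
congr (_ * _).
transitivity (\int[lebesgue_tuple]_V \int[lebesgue_tuple]_M (joint V M * drawV md M A)).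
  apply: eq_integral => V _.
  by rewrite -(marginal_drawM sigma0 sigma_eps0 condM_gt0 adm0 V g0 mg).
have mjg : measurable_fun [set: T * T] (fun z => joint z.1 z.2 * drawV md z.2 A).
  by apply: emeasurable_funM => //; exact: (measurableT_comp mg measurable_snd).
have mji : measurable_fun [set: T * T] (fun z => joint z.1 z.2 * (\1_A z.1)%:E).
  by apply: emeasurable_funM => //; exact: (measurableT_comp mi measurable_fst).
rewrite (fubini_tonelli (fun z : T * T => joint z.1 z.2 * drawV md z.2 A))//; last first.
  by move=> z; rewrite mule_ge0.
transitivity (\int[lebesgue_tuple]_M \int[lebesgue_tuple]_V (joint V M * (\1_A V)%:E)); last first.
  rewrite -(fubini_tonelli (fun z : T * T => joint z.1 z.2 * (\1_A z.1)%:E))//; last first.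
    by move=> z; rewrite mule_ge0.
  apply: eq_integral => V _; rewrite /fubini_F/= ge0_integralZr//.
  exact: (measurableT_comp mjoint (pair1_measurable V)).
apply: ge0_ae_eq_integral => //.
- by apply: (measurable_fun_fubini_tonelli_G (m1 := @lebesgue_tuple R n) _ mjg) => z; rewrite mule_ge0.
- by apply: (measurable_fun_fubini_tonelli_G (m1 := @lebesgue_tuple R n) _ mji) => z; rewrite mule_ge0.
- by move=> M _; apply: integral_ge0 => V _; rewrite mule_ge0.
- by move=> M _; apply: integral_ge0 => V _; rewrite mule_ge0.
apply: filterS (ae_adm_tuple admd) => M aM _ /=.
rewrite (joint_drawV Y sigma0 sigma_eps0 adm0 aM i0 mi) integral_indic// setIT.
rewrite /fubini_G/= ge0_integralZr//.
exact: (measurableT_comp mjoint (pair2_measurable M)).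
Qed.

End posterior.

(** * Drift criterion *)

Section drift_criterion.
Context {R : realType} {m n k : nat} (md : llnGm R m n k) (Y : 'cV[R]_m).
Local Notation leb := (@lebesgue_measure R).
Local Notation q := (gq md).
Local Notation c := (gc md).
Local Notation T := (n.-tuple R).
Hypotheses (sigma0 : 0 < mdl_sigma md) (sigma_eps0 : 0 < mdl_sigma_eps md).
Hypothesis condM_gt0 : forall V M, orthant V -> 0 < condM_pdf md Y V M.
Hypothesis adm0 : gig_adm (mdl_p md) (mdl_a md) (mdl_b md).
Hypothesis admd : forall x, x != 0 -> gig_adm q c (gd md x).
Local Open Scope ereal_scope.

Lemma gig_adm_le s d d1 : (d <= d1)%R -> gig_adm s c d -> gig_adm s c d1.
Proof.
move=> dd [c0 d0 h1 h2]; split => //; first exact: le_trans dd.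
by case: h2 => h; [left; exact: lt_le_trans dd|right].
Qed.

Variables (f w : R -> \bar R) (lam C C' : R).
Hypotheses (f0 : forall x, 0 <= f x) (w0 : forall x, 0 <= w x).
Hypotheses (mf : measurable_fun setT f) (mw : measurable_fun setT w).
Hypotheses (lam0 : (0 < lam)%R) (lam1 : (lam < 1)%R) (C0 : (0 <= C)%R) (C'0 : (0 <= C')%R).
Hypothesis w_lty : forall x, (0 < x)%R -> w x < +oo.
Hypothesis drift_M : forall V : T, orthant (tuple_col V) ->
  \sum_i \int[drawM md Y V]_M f (tnth M i) <= \sum_i w (tnth V i) + C%:E.
Hypothesis drift_V : forall t, f t < +oo -> gig_adm q c (gd md t) /\
  \int[leb]_x (w x * (gig_fun q c (gd md t) x)%:E) <=
  (lam%:E * f t + C'%:E) * gig_mass q c (gd md t).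
Hypothesis small_f : forall S : R, (0 <= S)%R -> exists S1 d0 : R, [/\ (0 <= S1)%R, gig_adm q c d0 &
  forall t, f t <= S%:E -> (`|t| <= S1)%R /\ (d0 <= gd md t)%R].

Let g (M : T) : \bar R := \sum_i f (tnth M i).

Let mfi (i : 'I_n) : measurable_fun setT (fun M : T => f (tnth M i)).
Proof. exact: (measurableT_comp mf (measurable_tnth i)). Qed.

Let mwi (i : 'I_n) : measurable_fun setT (fun M : T => w (tnth M i)).
Proof. exact: (measurableT_comp mw (measurable_tnth i)). Qed.

Let g0 M : 0 <= g M. Proof. exact: sume_ge0. Qed.

Let mg : measurable_fun setT g.
Proof. by apply: emeasurable_sum => i; exact: mfi. Qed.

Let fg (M : T) i : f (tnth M i) <= g M.
Proof. by rewrite /g (bigD1 i)//= leeDl// sume_ge0. Qed.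

Let drawM_g (V : T) : \int[drawM md Y V]_M g M = \sum_i \int[drawM md Y V]_M f (tnth M i).
Proof. by rewrite /g ge0_integral_sum. Qed.

Lemma gd_le (s t : R) : (`|t| <= s)%R -> (gd md t <= gd md s)%R.
Proof.
move=> ts; rewrite /gd lerD2l ler_wpM2r ?invr_ge0 ?exprn_ge0 ?(ltW sigma0)//.
by rewrite -[(t ^+ 2)%R]real_normK ?num_real// lerXn2r ?nnegrE// (le_trans _ ts).
Qed.

Let drift M : \int[drawV md M]_V \int[drawM md Y V]_M' g M' <=
  lam%:E * g M + (C'  *+ n + C)%:E.
Proof.
have [gM|] := ltP (g M) +oo; last first.
  rewrite leye_eq => /eqP ->; rewrite gt0_muley ?lte_fin// addye ?leey//.
have aM : adm_tuple md M.
  by move=> i; have [] := drift_V (le_lt_trans (fg M i) gM).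
have mI : measurable_fun setT (fun V => \int[drawM md Y V]_M' g M').
  apply: measurable_fun_integral_kernel => //.
  by move=> U mU; exact: measurable_kernel.
have mS : measurable_fun setT (fun V : T => \sum_i w (tnth V i)) by apply: emeasurable_sum.
apply: (@le_trans _ _ (\int[drawV md M]_V (\sum_i w (tnth V i) + C%:E))).
  apply: drawV_le_integral => //.
  - by move=> V; exact: integral_ge0.
  - by move=> V; rewrite adde_ge0// ?lee_fin// sume_ge0.
  - exact: emeasurable_funD.
  - by move=> V oV; rewrite drawM_g drift_M.
rewrite ge0_integralD//; last by move=> V _; exact: sume_ge0.
rewrite integral_cst// (_ : drawV md M setT = 1); last exact: prob_kernel.
rewrite mule1 EFinD addeA leeD2r// ge0_integral_sum//.
have -> : (C' *+ n)%:E = \sum_(i < n) C'%:E.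
  by rewrite sumEFin sumr_const card_ord.
rewrite ge0_sume_distrr; last by move=> i _; exact: f0.
rewrite -big_split/=; apply: lee_sum => i _.
have [_ h] := drift_V (le_lt_trans (fg M i) gM).
have := drawV_marginal i aM w0 mw => E.
have [J J0 JE] := gig_massP (aM i).
by move: h; rewrite -E JE lee_pmul2r// lte_fin.
Qed.

(** On [g M <= S] every coordinate has [d0 <= gd M_i <= gd S1]. The GIG weight decreases in its last
    parameter, so it is at least the weight at [gd S1], while the normalizing mass is at most the
    mass at [d0]. Each coordinate thus dominates [J1 / J0] times the law at [gd S1]. *)
Let minorization (S : R) : (0 <= S)%R -> exists (eps : R) (eta : {measure set T -> \bar R}),
  [/\ (0 < eps)%R, eta setT = 1 &
    forall M A, measurable A -> g M <= S%:E -> eps%:E * eta A <= drawV md M A].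
Proof.
move=> S0; have [S1 [d0 [S10 ad0 h]]] := small_f S0.
have gMf (M : T) i : g M <= S%:E -> f (tnth M i) <= S%:E by exact: le_trans (fg M i).
(* Without coordinates there is a single [M]. *)
have [n0|n0] := posnP n.
  exists 1%R, (drawV md (nseq_tuple n S1)); split => //; first exact: prob_kernel.
  move=> M A mA _; rewrite mul1e (_ : M = nseq_tuple n S1)//.
  by apply: eq_from_tnth => i; have := ltn_ord i; rewrite {2}n0.
(* The claim is vacuous on an empty sublevel set; otherwise one of its elements shows that the
   reference parameter [gd S1] is admissible. *)
have [[M0 M0S]|noM] := pselect (exists M : T, g M <= S%:E); last first.
  exists 1%R, (drawV md (nseq_tuple n S1)); split => //; first exact: prob_kernel.
  by move=> M A mA gM; case: noM; exists M.
have ad1 : gig_adm q c (gd md S1).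
  have [tS dt] := h _ (gMf M0 (Ordinal n0) M0S).
  by apply: gig_adm_le ad0; apply: (le_trans dt); exact: gd_le.
have aM1 : adm_tuple md (nseq_tuple n S1) by move=> i; rewrite tnth_nseq.
have [J0 J00 J0E] := gig_massP ad0; have [J1 J10 J1E] := gig_massP ad1.
pose eps : R := (J1 / J0)%R; have eps0 : (0 < eps)%R by exact: divr_gt0.
exists (\prod_(i < n) eps)%R, (drawV md (nseq_tuple n S1)); split.
- exact: prodr_gt0.
- exact: prob_kernel.
move=> M A mA gM.
have aM : adm_tuple md M.
  by move=> i; have [_] := h _ (gMf M i gM) => /gig_adm_le; exact.
have mi : measurable_fun setT (fun V : T => (\1_A V)%:E : \bar R).
  by apply/measurable_EFinP; exact: measurable_indic.
have i0 V : 0 <= (\1_A V)%:E :> \bar R by rewrite lee_fin.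
have dA M' : drawV md M' A = \int[drawV md M']_V (\1_A V)%:E.
  by rewrite integral_indic// setIT.
have e0 := etrans (dA M) (drawV_integral aM i0 mi).
have e1 := etrans (dA (nseq_tuple n S1)) (drawV_integral aM1 i0 mi).
refine (eq_ind_r (fun z : \bar R => (\prod_(i < n) eps)%:E * drawV md (nseq_tuple n S1) A <= z) _ e0).
refine (eq_ind_r (fun z : \bar R => (\prod_(i < n) eps)%:E * z <= _) _ e1).
clear e0 e1 dA.
have c0 M' V : (0 <= condV_pdf md (tuple_col M') (tuple_col V))%R.
  by rewrite prodr_ge0// => i _; exact: gig_pdf_ge0.
rewrite -ge0_integralZl_EFin//; last 3 first.
- by move=> V _; rewrite mule_ge0// lee_fin.
- by apply: emeasurable_funM => //; exact: measurable_condV_pdf.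
- by rewrite prodr_ge0// => i _; exact: ltW.
apply: ge0_le_integral => //.
- move=> V _; rewrite mule_ge0//; last by rewrite mule_ge0// lee_fin.
  by rewrite lee_fin prodr_ge0// => i _; exact: ltW.
- by apply: measurable_funeM; apply: emeasurable_funM => //; exact: measurable_condV_pdf.
- by apply: emeasurable_funM => //; exact: measurable_condV_pdf.
move=> V _; rewrite muleA lee_wpmul2r// -EFinM lee_fin !condV_pdfE -big_split/=.
apply: ler_prod => i _; rewrite mulr_ge0 ?gig_pdf_ge0 ?(ltW eps0)//=.
have [tS dt] := h _ (gMf M i gM).
have [J JJ JE] := gig_massP (aM i).
rewrite tnth_nseq /gig_pdf -!gig_massE J1E JE/= /eps.
have JJ0 : (J <= J0)%R by rewrite -lee_fin -JE -J0E; exact: gig_mass_le.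
rewrite mulrC [X in (X <= _)%R](_ : _ = gig_fun q c (gd md S1) (tnth V i) / J0)%R; last first.
  by rewrite mulrA divfK// gt_eqF.
apply: ler_pM; rewrite ?gig_fun_ge0 ?invr_ge0 ?(ltW J00)//.
  by apply: gig_fun_le => //; exact: gd_le.
by rewrite lef_pV2 ?posrE.
Qed.

(** [w] is the intermediate Lyapunov function on the scale of [V]: the step to [M] bounds the sum of
    the [f] by that of the [w], and the step back to [V] returns each [w] to [f] with factor [lam].
    Infinite values of [f] mark the coordinates where the GIG parameters may be inadmissible. *)
Theorem drift_geometrically_ergodic : geometrically_ergodic (gibbs md Y) (posterior md Y).
Proof.
apply: (@two_stage_geometrically_ergodic _ _ _ _ _ (drawM md Y) (drawV md) (gibbs md Y)
  (posterior md Y) _ g lam (C' *+ n + C)%R) => //.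
- by move=> A mA; apply: (gibbs_invariant sigma0 sigma_eps0 condM_gt0 adm0 admd).
- exact: ltW.
- by rewrite addr_ge0// mulrn_wge0.
- move: (posterior_orthant Y sigma0 sigma_eps0 adm0); apply: filterS => V oV.
  rewrite drawM_g (le_lt_trans (drift_M oV))// lte_add_pinfty ?ltry//.
  by apply: lte_sum_pinfty => i _; apply: w_lty; have := oV i; rewrite mxE.
Qed.

End drift_criterion.

(** * The parameter regimes *)

Section real_bounds.
Context {R : realType}.
Implicit Types x y e : R.

Lemma sqr_sum_le x y e : 0 < e -> (x + y) ^+ 2 <= (1 + e) * x ^+ 2 + (1 + e^-1) * y ^+ 2.
Proof.
move=> e0; rewrite -subr_ge0 (_ : _ - _ = e * (x - e^-1 * y) ^+ 2).
  by rewrite mulr_ge0 ?sqr_ge0// ltW.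
by have := lt0r_neq0 e0; clear => h; field.
Qed.

Lemma linear_le_sqr (k x e : R) : 0 < e -> k * x <= e * x ^+ 2 + k ^+ 2 / (4 * e).
Proof.
move=> e0; rewrite -subr_ge0 (_ : _ - _ = e * (x - k / (2 * e)) ^+ 2).
  by rewrite mulr_ge0 ?sqr_ge0// ltW.
by have := lt0r_neq0 e0; clear => h; field.
Qed.

Lemma sqrtr_le_linear (k x e : R) : 0 <= x -> 0 < e ->
  k * Num.sqrt x <= e * x + k ^+ 2 / (4 * e).
Proof. by move=> x0 e0; have := linear_le_sqr k (Num.sqrt x) e0; rewrite sqr_sqrtr. Qed.

Lemma sqrtr_add_le x y : 0 <= x -> 0 <= y -> Num.sqrt (x + y) <= Num.sqrt x + Num.sqrt y.
Proof.
move=> x0 y0; rewrite -[leRHS]ger0_norm ?addr_ge0 ?sqrtr_ge0// -sqrtr_sqr ler_wsqrtr//.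
rewrite sqrrD !sqr_sqrtr// addrAC lerDl mulrn_wge0// mulr_ge0// sqrtr_ge0.
Qed.

Lemma powR_sqrt x (r : R) : 0 <= x -> Num.sqrt x `^ r = x `^ (r / 2).
Proof. by move=> x0; rewrite -powR12_sqrt// -powRrM mulrC. Qed.

Lemma powR_sqr x (r : R) : (x ^+ 2) `^ (r / 2) = `|x| `^ r.
Proof. by rewrite -powR_sqrt ?sqr_ge0// sqrtr_sqr. Qed.

Lemma le_powR_inv x y (r : R) : 0 < r -> 0 <= x -> x `^ r <= y -> x <= y `^ r^-1.
Proof.
move=> r0 x0 h; have -> : x = (x `^ r) `^ r^-1.
  by rewrite -powRrM divff ?powRr1// gt_eqF.
by apply: ge0_ler_powR; rewrite ?nnegrE ?powR_ge0 ?invr_ge0 ?(ltW r0)// (le_trans _ h) ?powR_ge0.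
Qed.

End real_bounds.

Section gig_integrals.
Context {R : realType}.
Local Notation leb := (@lebesgue_measure R).

Lemma integral_gig_powers (q c d k1 s1 k2 s2 k3 : R) : 0 <= k1 -> 0 <= k2 -> 0 <= k3 ->
  (\int[leb]_x ((k1 * x `^ s1 + k2 * x `^ s2 + k3)%:E * (gig_fun q c d x)%:E) =
   k1%:E * gig_mass (q + s1) c d + k2%:E * gig_mass (q + s2) c d + k3%:E * gig_mass q c d)%E.
Proof.
move=> k10 k20 k30.
have mg (s : R) : measurable_fun [set: R] (fun x => (x `^ s * gig_fun q c d x)%:E).
  apply/measurable_EFinP; apply: measurable_funM; first exact: measurable_powR.
  exact: measurable_gig_fun_arg.
have g0 s (x : R) : (0 <= (x `^ s * gig_fun q c d x)%:E)%E.
  by rewrite lee_fin mulr_ge0 ?powR_ge0 ?gig_fun_ge0.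
have z0 (x : R) : (0 <= (gig_fun q c d x)%:E)%E by rewrite lee_fin gig_fun_ge0.
have mz : measurable_fun [set: R] (fun x => (gig_fun q c d x)%:E) by exact: measurable_gig_EFin.
have Z k (h : R -> \bar R) : 0 <= k -> (forall x, 0 <= h x)%E -> measurable_fun [set: R] h ->
    (k%:E * \int[leb]_x h x = \int[leb]_x (k%:E * h x))%E.
  by move=> k0 h0 mh; rewrite ge0_integralZl_EFin.
have P k (h : R -> \bar R) : 0 <= k -> (forall x, 0 <= h x)%E ->
    (forall x, [set: R] x -> 0 <= k%:E * h x)%E.
  by move=> k0 h0 x _; rewrite mule_ge0.
rewrite -!gig_moment gig_massE !Z//.
have M k (h : R -> \bar R) : measurable_fun [set: R] h ->
    measurable_fun [set: R] (fun x => k%:E * h x)%E by exact: measurable_funeM.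
rewrite -(ge0_integralD leb measurableT (P _ _ k10 (g0 s1)) (M _ _ (mg s1)) (P _ _ k20 (g0 s2)) (M _ _ (mg s2))).
rewrite -(ge0_integralD leb measurableT _ _ (P _ _ k30 z0) (M _ _ mz)); last 2 first.
- by move=> x _; apply: adde_ge0; rewrite mule_ge0.
- by apply: emeasurable_funD; exact: M.
apply: eq_integral => x _; rewrite -!EFinM -!EFinD; congr (_%:E).
by move: (gig_fun _ _ _ _) => z; ring.
Qed.

(** At index 0, scaling leaves the mass unchanged when the second parameter is halved, while the
    integrand increases strictly; a finite mass would be smaller than itself. *)
Lemma gig_mass_log_infinite : gig_mass 0 0 (1 : R) = +oo%E.
Proof.
have e : gig_mass 0 0 (1 : R) = gig_mass 0 0 (2^-1 : R).
  by rewrite (@gig_mass_scale R 0 0 1 2)// powRr0 mul1e mul0r div1r.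
apply/eqP; rewrite -leye_eq leNgt; apply/negP => fin.
have lt x : 0 < x -> gig_fun 0 0 1 x < gig_fun 0 0 (2^-1 : R) x.
  move=> x0; rewrite !gig_funE// ltr_pM2l ?powR_gt0// ltr_expR.
  by rewrite !mul0r !add0r ltrN2 ltr_pM2r// ltr_pM2r ?invr_gt0// invf_lt1// ltr1n.
have le x : gig_fun 0 0 1 x <= gig_fun 0 0 (2^-1 : R) x.
  by apply: gig_fun_le => //; rewrite invf_le1// ler1n.
pose D x := gig_fun 0 0 (2^-1 : R) x - gig_fun 0 0 1 x.
have mD : measurable_fun [set: R] (fun x => (D x)%:E).
  by apply/measurable_EFinP; apply: measurable_funB; exact: measurable_gig_fun_arg.
have : (0 < \int[leb]_x (D x)%:E)%E.
  have m1 : (0 < leb `]0%R, 1%R]%classic)%E.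
    by rewrite lebesgue_measure_itv/= lte_fin ltr01 oppr0 adde0 lte_fin ltr01.
  apply: (@ge0_integral_gt0 _ _ _ leb (fun x => (D x)%:E) `](0 : R), (1 : R)]%classic) => //.
  - by move=> x; rewrite lee_fin subr_ge0.
  - by move=> x /=; rewrite in_itv/= => /andP[x0 _]; rewrite lte_fin subr_gt0 lt.
have : (\int[leb]_x (D x)%:E + gig_mass 0 0 (1 : R) = gig_mass 0 0 (2^-1 : R))%E.
  rewrite !gig_massE -ge0_integralD//.
  - by apply: eq_integral => x _; rewrite -EFinD subrK.
  - by move=> x _; rewrite lee_fin subr_ge0.
  - by move=> x _; rewrite lee_fin gig_fun_ge0.
  - exact: measurable_gig_EFin.
rewrite -e; have := gig_mass_gt0 0 0 (1 : R).
move: fin; case: (gig_mass 0 0 1) => [r| |]//.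
case: (\int[leb]_x (D x)%:E)%E => [x| |]// _ _.
rewrite -EFinD => -[h]; rewrite lte_fin => x0; move: h x0 => /eqP.
by rewrite -[X in _ == X]add0r (inj_eq (addIr r)) => /eqP ->; rewrite ltxx.
Qed.

End gig_integrals.

(** * Moments after the step from V to M *)

Section moment_bounds.
Context {R : realType} {m n k : nat} (md : llnGm R m n k) (Y : 'cV[R]_m).
Local Notation B := (mdlB md).
Local Notation sigma := (mdl_sigma md).
Local Notation mu := (mdl_mu md).
Local Notation Q := (precision B (rho md)).
Local Notation T := (n.-tuple R).
Local Notation c V := (meanM md Y (tuple_col V)).
Hypotheses (sigma0 : 0 < sigma) (sigma_eps0 : 0 < mdl_sigma_eps md).

Let rho0 : 0 < rho md. Proof. exact: rho_gt0. Qed.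
Let s20 : 0 < sigma ^+ 2. Proof. exact: exprn_gt0. Qed.

Lemma meanM_split : exists2 C : R, 0 <= C & forall V, orthant V -> exists x y : 'cV[R]_n,
  [/\ meanM md Y V = x + mu *: y, Q V *m y = const_mx 1 & \sum_i `|x i 0| <= C].
Proof.
have [C C0 H] := mean_shift_bounded B rho0 (resid md Y).
exists C => // V V0; have Qu := precision_unit B rho0 V0.
exists (invmx (Q V) *m (rho md *: (B^T *m resid md Y))), (invmx (Q V) *m const_mx 1); split.
- by rewrite /meanM barmE mulmxDr -!scalemxAr.
- by rewrite mulKVmx.
- by apply: H V0 _; rewrite mulKVmx.
Qed.

Lemma meanM_abs : exists2 C : R, 0 <= C & forall V : T, orthant (tuple_col V) ->
  \sum_i `|c V i 0| <= C + `|mu| * \sum_i tnth V i.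
Proof.
have [C C0 H] := meanM_split; exists C => // V V0.
have [x [y [-> Qy xC]]] := H _ V0; have yV := mean_unit_bound rho0 V0 Qy.
have -> : \sum_i tnth V i = \sum_i tuple_col V i 0 by apply: eq_bigr => i _; rewrite mxE.
apply: (@le_trans _ _ (\sum_i (`|x i 0| + `|mu| * `|y i 0|))).
  by apply: ler_sum => i _; rewrite !mxE -normrM ler_normD.
by rewrite big_split/= -mulr_sumr lerD// ler_wpM2l.
Qed.

Lemma meanM_sqr (p : 'cV[R]_n) (lam : 'cV[R]_m) (e : R) : 0 < e ->
  const_mx 1 = p + B^T *m lam -> exists2 C : R, 0 <= C & forall V : T, orthant (tuple_col V) ->
  \sum_i (c V i 0) ^+ 2 <= (1 + e) * (mu ^+ 2 * (dotv p p + e)) * \sum_i (tnth V i) ^+ 2 + C.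
Proof.
move=> e0 pl; have [C C0 H] := meanM_split.
have [D D0 HD] := mean_unit_sqr_bound rho0 pl.
pose K := D ^+ 2 / (4 * e); pose th := dotv p p.
have K0 : 0 <= K by rewrite divr_ge0 ?sqr_ge0// mulr_ge0// ltW.
have th0 : 0 <= th by exact: dotvv_ge0.
exists ((1 + e) * (mu ^+ 2 * (th + e + K)) + (1 + e^-1) * C ^+ 2).
  by rewrite addr_ge0// mulr_ge0 ?addr_ge0 ?invr_ge0 ?sqr_ge0 ?(ltW e0)// mulr_ge0 ?sqr_ge0// !addr_ge0// ltW.
move=> V V0; have [x [y [-> Qy xC]]] := H _ V0.
pose S := \sum_i (tnth V i) ^+ 2.
have S0 : 0 <= S by apply: sumr_ge0 => i _; rewrite sqr_ge0.
(* The l^2 norm bounds every coordinate of [V]; adding 1 keeps [v] positive and costs a constant. *)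
pose v := Num.sqrt (S + 1).
have v2 : v ^+ 2 = S + 1 by rewrite sqr_sqrtr// addr_ge0.
have v0 : 0 < v by rewrite sqrtr_gt0 ltr_wpDl.
have Vv i : tuple_col V i 0 <= v.
  have Vi := ltW (V0 i); rewrite -[leLHS]ger0_norm// -sqrtr_sqr ler_wsqrtr//.
  rewrite mxE /S (bigD1 i)//= -addrA lerDl addr_ge0//.
  by apply: sumr_ge0 => j _; rewrite sqr_ge0.
have yy := HD _ _ _ V0 Qy v0 Vv.
have Dv := linear_le_sqr D v e0.
have xx : \sum_i (x i 0) ^+ 2 <= C ^+ 2.
  apply: (@le_trans _ _ ((\sum_i `|x i 0|) ^+ 2)); last first.
    by rewrite lerXn2r ?nnegrE// sumr_ge0.
  rewrite [leRHS]expr2 mulr_suml; apply: ler_sum => i _.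
  rewrite -[leLHS]real_normK ?num_real// expr2 ler_wpM2l// (bigD1 i)//= lerDl.
  by apply: sumr_ge0 => j _.
apply: (@le_trans _ _ (\sum_i ((1 + e) * (mu ^+ 2 * (y i 0 * y i 0)) + (1 + e^-1) * (x i 0) ^+ 2))).
  apply: ler_sum => i _; rewrite !mxE addrC; apply: (le_trans (sqr_sum_le _ _ e0)).
  by rewrite exprMn -(expr2 (y i 0)).
rewrite big_split/= -!mulr_sumr -/(dotv y y) -/S.
have e1 : 0 <= 1 + e by rewrite addr_ge0// ltW.
have ei1 : 0 <= 1 + e^-1 by rewrite addr_ge0// invr_ge0 ltW.
apply: (@le_trans _ _ ((1 + e) * (mu ^+ 2 * ((S + 1) * th + (e * (S + 1) + K))) + (1 + e^-1) * C ^+ 2)).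
  apply: lerD; last exact: ler_wpM2l.
  apply: ler_wpM2l => //; apply: ler_wpM2l; first exact: sqr_ge0.
  by rewrite -v2; apply: (le_trans yy); apply: lerD.
rewrite le_eqVlt; apply/orP; left; apply/eqP.
by rewrite -/th; move: (S) (K) (th) (e^-1) (mu ^+ 2) => *; ring.
Qed.

Hypothesis condM_gt0 : forall V M, orthant V -> 0 < condM_pdf md Y V M.

Lemma gauss_moment0E : exists2 N : R, 0 < N & gauss_moment 0 = N%:E.
Proof.
have m1 : (-1 : R) < 0 by rewrite ltrN10.
by exists (fine (@gauss_moment R 0)); [exact: fine_gauss_moment_gt0|rewrite gauss_momentK].
Qed.

Let scale_le (V : T) (i : 'I_n) (s : R) : orthant (tuple_col V) -> (tnth V i)^-1 <= s ->
  [/\ 0 < s, 0 < tnth V i, 0 < Num.sqrt (sigma ^+ 2 / s) & sigma ^+ 2 / s <= sigma ^+ 2 * tnth V i].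
Proof.
move=> V0 h; have Vi : 0 < tnth V i by have := V0 i; rewrite mxE.
have sp : 0 < s by apply: lt_le_trans h; rewrite invr_gt0.
split => //; first by rewrite sqrtr_gt0 divr_gt0.
by rewrite ler_pM2l// -[leRHS]invrK lef_pV2// posrE ?invr_gt0.
Qed.

Let cancel_mass (X : \bar R) (K : R) : (X * gauss_moment 0 <= K%:E * gauss_moment 0)%E -> (X <= K%:E)%E.
Proof. by have [N N0 ->] := gauss_moment0E; rewrite lee_pmul2r// lte_fin. Qed.

Let mpow (r : R) : measurable_fun [set: R] (fun x : R => (`|x| `^ r)%:E).
Proof. by apply/measurable_EFinP; exact: measurable_norm_powR. Qed.

Let pow0 (r x : R) : (0 <= (`|x| `^ r)%:E)%E.
Proof. by rewrite lee_fin powR_ge0. Qed.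

Lemma drawM_powR (r : R) (V : T) (i : 'I_n) : 0 < r -> r <= 1 -> orthant (tuple_col V) ->
  (\int[drawM md Y V]_M (`|tnth M i| `^ r)%:E <=
   (`|c V i 0| `^ r + (sigma ^+ 2 * tnth V i) `^ (r / 2) * gauss_mean r)%:E)%E.
Proof.
move=> r0 r1 V0; have [s [s1 s2 E]] := drawM_marginal sigma0 sigma_eps0 condM_gt0 i V0.
have [sp Vi xi0 xiV] := scale_le V0 s1.
have rm : -1 < r by apply: lt_trans r0; rewrite ltrN10.
apply: cancel_mass; rewrite (E (fun x => (`|x| `^ r)%:E) (pow0 r) (mpow r)).
apply: (le_trans (gauss_int_powR_le _ r0 r1 xi0)).
rewrite lee_wpmul2r//; first by rewrite ltW// gauss_moment_gt0.
rewrite lee_fin lerD2l ler_wpM2r ?gauss_mean_ge0// powR_sqrt; last by rewrite divr_ge0 ?ltW.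
have h1 : 0 <= sigma ^+ 2 / s by rewrite divr_ge0// ltW.
by apply: ge0_ler_powR => //; [rewrite divr_ge0// ltW|rewrite nnegrE (le_trans h1)].
Qed.

Lemma drawM_sqr (e : R) (V : T) (i : 'I_n) : 0 < e -> orthant (tuple_col V) ->
  (\int[drawM md Y V]_M ((tnth M i) ^+ 2)%:E <=
   ((1 + e) * (c V i 0) ^+ 2 + (1 + e^-1) * gauss_mean 2 * (sigma ^+ 2 * tnth V i))%:E)%E.
Proof.
move=> e0 V0; have [s [s1 s2 E]] := drawM_marginal sigma0 sigma_eps0 condM_gt0 i V0.
have [sp Vi xi0 xiV] := scale_le V0 s1.
have rm : -1 < (2 : R) by apply: (@lt_trans _ _ 0); rewrite ?ltrN10.
have mf : measurable_fun [set: R] (fun x : R => (x ^+ 2)%:E).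
  by apply/measurable_EFinP; exact: measurable_funX.
have f0 (x : R) : (0 <= (x ^+ 2)%:E)%E by rewrite lee_fin sqr_ge0.
apply: cancel_mass; rewrite (E (fun x => (x ^+ 2)%:E) f0 mf).
apply: (le_trans (gauss_int_sqr_le _ e0 xi0)).
rewrite lee_wpmul2r//; first by rewrite ltW// gauss_moment_gt0.
rewrite lee_fin lerD2l mulrAC sqr_sqrtr; last by rewrite divr_ge0 ?ltW.
by rewrite ler_wpM2l// mulr_ge0 ?gauss_mean_ge0// addr_ge0// invr_ge0 ltW.
Qed.

(** The mean drops out by rearrangement. The upper bound on [s] keeps the variance of coordinate [i]
    from degenerating faster than [V_i], and subadditivity separates the contribution of [1 / V_i]
    from a constant. *)
Lemma drawM_negpowR (r : R) (i : 'I_n) : 0 < r -> r < 1 -> exists2 C : R, 0 <= C &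
  forall V : T, orthant (tuple_col V) ->
  (\int[drawM md Y V]_M (`|tnth M i| `^ (- r))%:E <=
   (gauss_mean (- r) * (sigma ^+ 2) `^ (- (r / 2)) * tnth V i `^ (- (r / 2)) + C)%:E)%E.
Proof.
move=> r0 r1; have rm : -1 < - r by rewrite ltrN2.
have gm0 := gauss_mean_ge0 rm.
have u0 : 0 < r / 2 by rewrite divr_gt0.
have u1 : r / 2 <= 1 by rewrite ler_pdivrMr// mul1r (le_trans (ltW r1))// ler1n.
pose b := rho md * dotv (col i B) (col i B).
have b0 : 0 <= b by rewrite mulr_ge0 ?dotvv_ge0// ltW.
exists (gauss_mean (- r) * (b / sigma ^+ 2) `^ (r / 2)) => [|V V0].
  by rewrite mulr_ge0// powR_ge0.
have [s [s1 s2 E]] := drawM_marginal sigma0 sigma_eps0 condM_gt0 i V0.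
have [sp Vi xi0 xiV] := scale_le V0 s1.
apply: cancel_mass; rewrite (E (fun x => (`|x| `^ (- r))%:E) (pow0 _) (mpow _)).
apply: (le_trans (gauss_int_negpowR_le _ r0 r1 xi0)).
rewrite lee_wpmul2r//; first by rewrite ltW// gauss_moment_gt0.
rewrite lee_fin [leLHS]mulrC -mulrA -mulrDr ler_wpM2l//.
have -> : Num.sqrt (sigma ^+ 2 / s) `^ (- r) = (s / sigma ^+ 2) `^ (r / 2).
  rewrite powR_sqrt; last by rewrite divr_ge0 ?ltW.
  have h1 : 0 <= sigma ^+ 2 / s by rewrite divr_ge0// ltW.
  have -> : s / sigma ^+ 2 = (sigma ^+ 2 / s) `^ (-1) by rewrite powR_inv1// invf_div.
  by rewrite -powRrM mulN1r mulNr.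
apply: (@le_trans _ _ (((tnth V i)^-1 / sigma ^+ 2 + b / sigma ^+ 2) `^ (r / 2))).
  have h1 : 0 <= s / sigma ^+ 2 by rewrite divr_ge0// ltW.
  have h2 : s / sigma ^+ 2 <= (tnth V i)^-1 / sigma ^+ 2 + b / sigma ^+ 2.
    by rewrite -mulrDl ler_wpM2r// invr_ge0 ltW.
  by apply: ge0_ler_powR => //; [exact: ltW|rewrite nnegrE (le_trans h1)].
have h3 : 0 <= (tnth V i)^-1 / sigma ^+ 2 by rewrite divr_ge0 ?invr_ge0 ?ltW.
have h4 : 0 <= b / sigma ^+ 2 by rewrite divr_ge0// ltW.
apply: (le_trans (powR_subadditive u0 u1 h3 h4)); rewrite lerD2r -invfM.
have h5 : 0 <= tnth V i * sigma ^+ 2 by rewrite mulr_ge0// ltW.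
rewrite -(powR_inv1 h5).
by rewrite -powRrM mulN1r powRM ?(ltW s20) ?(ltW Vi)// mulrC.
Qed.

End moment_bounds.

(** * Contraction rates *)

Section rates.
Context {R : realType}.

Lemma abs_rate (mu D : R) : mu ^+ 2 < D -> exists kap theta : R,
  [/\ `|mu| < kap, 1 < theta & kap * Num.sqrt (theta / D) < 1].
Proof.
move=> muD; have D0 : 0 < D by apply: le_lt_trans muD; exact: sqr_ge0.
have mu0 := sqr_ge0 mu.
(* [kap^2] is the midpoint of [mu^2] and [D], and [theta] is such that [kap^2 theta] is the midpoint
   of [kap^2] and [D]. *)
pose K := (mu ^+ 2 + D) / 2.
have K0 : 0 < K by rewrite divr_gt0// ltr_wpDl.
have KD : K < D by rewrite /K ltr_pdivrMr// mulr_natr mulr2n ltrD2r.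
have muK : mu ^+ 2 < K by rewrite /K ltr_pdivlMr// mulr_natr mulr2n ltrD2l.
pose th := (D / K + 1) / 2.
have DK : 1 < D / K by rewrite ltr_pdivlMr// mul1r.
exists (Num.sqrt K), th; split.
- by rewrite -sqrtr_sqr ltr_sqrt.
- by rewrite /th ltr_pdivlMr// mul1r -[2]/(1 + 1) ltrD2r.
- rewrite -sqrtrM ?(ltW K0)// -[ltRHS]sqrtr1 ltr_sqrt// mulrA ltr_pdivrMr// mul1r.
  have -> : K * th = (D + K) / 2 by rewrite /th; field; rewrite gt_eqF.
  by rewrite ltr_pdivrMr// mulr_natr mulr2n ltrD2l.
Qed.

Lemma sqr_rate (th : R) : 0 <= th -> th < 1 -> exists e : R,
  [/\ 0 < e, 0 < ((1 + e) * ((1 + e) * (th + e)) + e) * (1 + e) &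
    ((1 + e) * ((1 + e) * (th + e)) + e) * (1 + e) < 1].
Proof.
(* The product tends to [th] as [e] vanishes; for this [e] its distance to 1 is [e] times a
   polynomial with positive coefficients. *)
move=> th0 th1; pose e := (1 - th) / 8.
have e0 : 0 < e by rewrite divr_gt0// subr_gt0.
have -> : th = 1 - 8 * e by rewrite /e; field.
exists e; split => //.
  have t0 : 0 <= 1 - 8 * e + e.
    by rewrite -[X in _ <= X + _](_ : th = _) ?addr_ge0 ?(ltW e0)// /e; field.
  have e1 : 0 < 1 + e by rewrite addr_gt0.
  apply: mulr_gt0 => //; apply: ltr_wpDl => //.
  by apply: mulr_ge0; [exact: ltW|apply: mulr_ge0 => //; exact: ltW].
rewrite -subr_gt0 (_ : _ - _ = e * (3 + 17 * e + 20 * e ^+ 2 + 7 * e ^+ 3)); last by ring.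
have e2 := exprn_gt0 2 e0; have e3 := exprn_gt0 3 e0.
apply: mulr_gt0 => //; move: e0 e2 e3; move: (e) => x x0 x2 x3; lra.
Qed.

Local Notation j s := (fine (gig_mass s 0 (1 : R))).

Lemma adm_inv_gamma (s : R) : s < 0 -> gig_adm s 0 (1 : R).
Proof. by move=> s0; split => //; [right|left]. Qed.

Lemma gauss_mean_gig (r : R) : gauss_mean r = j (- 2^-1 - r / 2) / j (- 2^-1).
Proof. by rewrite /gauss_mean !gauss_momentE mul0r subr0. Qed.

Let div_mul_lt1 (x y z w : R) : 0 < y -> 0 < w -> z * x < w * y -> x / y * (z / w) < 1.
Proof. by move=> y0 w0 h; rewrite mulf_div ltr_pdivrMr ?mulr_gt0// mul1r mulrC (mulrC y). Qed.

(** [gauss_mean (2 * u)] is the ratio of the masses at [-1/2 - u] and [-1/2]. Of the four indices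
    [q], [q + u], [-1/2 - u], [-1/2], the outer and the inner pair have the same sum, which is the
    setting of strict log-convexity. *)
Lemma gauss_mean_pow_rate (q u : R) : 0 < u -> q + u < - 2^-1 ->
  gauss_mean (2 * u) * (j (q + u) / j q) < 1.
Proof.
move=> u0 qu; have h2 : (- 2^-1 : R) < 0 by rewrite oppr_lt0 invr_gt0.
have q0 : q < 0 by apply: lt_trans h2; apply: lt_trans qu; rewrite ltrDl.
have := @gig_mass_strict_log_convex R q u (- 2^-1 - u - q) u0.
have -> : q + (- 2^-1 - u - q) = - 2^-1 - u by ring.
have -> : q + u + (- 2^-1 - u - q) = - 2^-1 by ring.
move=> h; have {}h := h _ h2.
rewrite gauss_mean_gig (_ : 2 * u / 2 = u); last by rewrite mulrAC divff ?mul1r.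
have j1 := fine_gig_mass_gt0 (adm_inv_gamma h2); have j2 := fine_gig_mass_gt0 (adm_inv_gamma q0).
apply: div_mul_lt1 => //; apply: h.
by rewrite -addrA -opprD (addrC u) subr_gt0.
Qed.

Let div_mul_lt (x y z : R) : 0 < y -> x * x < y * z -> x / y * x < z.
Proof. by move=> y0 h; rewrite mulrAC ltr_pdivrMr// (mulrC z). Qed.

(** The indices [-1/2], [(p - 1) / 2] and [p - 1/2] are equally spaced, and [gauss_mean (- p)] is
    the ratio of the masses at the second and the first: strict log-convexity again. At [p = 1/2]
    the mass at the third index is infinite, hence the extended real form. *)
Lemma gauss_mean_negpow_rate (p : R) : 0 < p -> p <= 2^-1 ->
  ((gauss_mean (- p))%:E * gig_mass (p - 2^-1 - p / 2) 0 (1 : R) < gig_mass (p - 2^-1) 0 (1 : R))%E.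
Proof.
move=> p0 p1; have h2 : (- 2^-1 : R) < 0 by rewrite oppr_lt0 invr_gt0.
have u0 : 0 < p / 2 by rewrite divr_gt0.
have up : p / 2 < 2^-1 by rewrite ltr_pdivrMr// mulVf// (le_lt_trans p1)// invf_lt1// ltr1n.
have e1 : p - 2^-1 - p / 2 = - 2^-1 + p / 2 by field.
have a1 : - 2^-1 + p / 2 < 0 by rewrite addrC subr_lt0.
have j1 := fine_gig_mass_gt0 (adm_inv_gamma h2); have j2 := fine_gig_mass_gt0 (adm_inv_gamma a1).
rewrite e1 -(gig_massK (adm_inv_gamma a1)) -EFinM.
rewrite le_eqVlt in p1; case/orP: p1 => [/eqP ->|p1].
  by rewrite subrr gig_mass_log_infinite ltry.
have a2 : p - 2^-1 < 0 by rewrite subr_lt0.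
rewrite -(gig_massK (adm_inv_gamma a2)) lte_fin gauss_mean_gig mulNr opprK.
have := @gig_mass_strict_log_convex R (- 2^-1) (p / 2) (p / 2) u0 u0.
have -> : - 2^-1 + p / 2 + p / 2 = p - 2^-1 by field.
move=> /(_ a2); exact: div_mul_lt.
Qed.

End rates.

(** * Ergodicity in each parameter range *)

Section regimes.
Context {R : realType} {m n k : nat} (md : llnGm R m n k) (Y : 'cV[R]_m).
Local Notation leb := (@lebesgue_measure R).
Local Notation sigma := (mdl_sigma md).
Local Notation mu := (mdl_mu md).
Local Notation p := (mdl_p md).
Local Notation a := (mdl_a md).
Local Notation b := (mdl_b md).
Local Notation q := (gq md).
Local Notation c := (gc md).
Local Notation T := (n.-tuple R).
Local Notation gm q c d := (fine (gig_mass q c d)).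
Hypotheses (sigma0 : 0 < sigma) (sigma_eps0 : 0 < mdl_sigma_eps md).
Hypothesis condM_gt0 : forall V M, orthant V -> 0 < condM_pdf md Y V M.

Let s20 : 0 < sigma ^+ 2. Proof. exact: exprn_gt0. Qed.

Lemma gd_ge (t : R) : b <= gd md t.
Proof. by rewrite /gd lerDl divr_ge0 ?sqr_ge0// ltW. Qed.

Lemma gc_gt0 : 0 < a -> 0 < c.
Proof. by move=> a0; rewrite /gc ltr_wpDr// divr_ge0 ?sqr_ge0// ltW. Qed.

Let mpow (s : R) : measurable_fun [set: R] (fun x : R => (`|x| `^ s)%:E).
Proof. by apply/measurable_EFinP; exact: measurable_norm_powR. Qed.

Let pow0 (s x : R) : (0 <= (`|x| `^ s)%:E)%E.
Proof. by rewrite lee_fin powR_ge0. Qed.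

(** One shape of [w] for all regimes; a regime with a single power takes the coefficient
    [k2 = 0]. *)
Definition power_weight (k1 s1 k2 s2 k3 x : R) : \bar R :=
  (k1 * x `^ s1 + k2 * x `^ s2 + k3)%:E.

Lemma measurable_power_weight k1 s1 k2 s2 k3 :
  measurable_fun [set: R] (power_weight k1 s1 k2 s2 k3).
Proof.
apply/measurable_EFinP; apply: measurable_funD => //.
by apply: measurable_funD; apply: measurable_funM => //; exact: measurable_powR.
Qed.

Lemma power_weight_ge0 k1 s1 k2 s2 k3 x : 0 <= k1 -> 0 <= k2 -> 0 <= k3 ->
  (0 <= power_weight k1 s1 k2 s2 k3 x)%E.
Proof. by move=> *; rewrite lee_fin !addr_ge0// mulr_ge0// powR_ge0. Qed.

Lemma power_weight_lty k1 s1 k2 s2 k3 x : (power_weight k1 s1 k2 s2 k3 x < +oo)%E.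
Proof. exact: ltry. Qed.

(** The means contribute at most [|mu|] times the sum of the [V_i], and the Gaussian fluctuation, of
    order [sqrt V_i], is absorbed by [(kap - |mu|) V_i] at the price of [K]. Given [M], the mean of
    [V_i] is at most [sqrt (theta / (c sigma^2)) |M_i|] plus a constant, and
    [c sigma^2 = a sigma^2 + mu^2 > mu^2] leaves room for both [kap] and [theta]. *)
Lemma abs_drift : 0 < a -> exists kap K C lam C' : R,
  [/\ [/\ 0 <= kap, 0 <= K, 0 <= C & 0 <= C'], 0 < lam < 1,
    forall V : T, orthant (tuple_col V) ->
      (\sum_i \int[drawM md Y V]_M (`|tnth M i| `^ 1)%:E <=
       (\sum_i (kap * tnth V i + K) + C)%:E)%E &
    forall t, gig_adm q c (gd md t) ->
      kap * gm (q + 1) c (gd md t) + K * gm q c (gd md t) <= (lam * `|t| + C') * gm q c (gd md t)].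
Proof.
move=> a0; have c0 := gc_gt0 a0.
have cE : c * sigma ^+ 2 = a * sigma ^+ 2 + mu ^+ 2.
  by rewrite /gc mulrDl divfK// gt_eqF.
have [kap [theta [kmu th1 rate]]] : exists kap theta : R,
  [/\ `|mu| < kap, 1 < theta & kap * Num.sqrt (theta / (c * sigma ^+ 2)) < 1].
  by apply: abs_rate; rewrite cE ltrDr mulr_gt0.
have [C C0 HC] := meanM_abs Y sigma0 sigma_eps0.
have [C1 C10 HG] := gig_first_moment q c0 th1.
have kap0 : 0 < kap by exact: le_lt_trans kmu.
have th0 : 0 < theta by exact: lt_trans th1.
pose e := (kap - `|mu|) / sigma ^+ 2.
have e0 : 0 < e by rewrite divr_gt0// subr_gt0.
pose K := gauss_mean 1 ^+ 2 / (4 * e) : R.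
have K0 : 0 <= K by rewrite divr_ge0 ?sqr_ge0// mulr_ge0// ltW.
exists kap, K, C, (kap * Num.sqrt (theta / (c * sigma ^+ 2))), (kap * Num.sqrt `|theta * (b / c) + C1| + K).
split.
- by split => //; [exact: ltW|rewrite addr_ge0// mulr_ge0 ?sqrtr_ge0// ltW].
- by rewrite rate andbT mulr_gt0// sqrtr_gt0 divr_gt0// mulr_gt0.
- move=> V V0; apply: (@le_trans _ _ (\sum_i (`|meanM md Y (tuple_col V) i 0| + ((kap - `|mu|) * tnth V i + K))%:E)%E).
    apply: lee_sum => i _; have Vi : 0 < tnth V i by have := V0 i; rewrite mxE.
    apply: (le_trans (drawM_powR sigma0 sigma_eps0 condM_gt0 i ltr01 (lexx _) V0)).
    rewrite lee_fin powRr1// lerD2l.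
    have h := @sqrtr_le_linear R (gauss_mean 1) (sigma ^+ 2 * tnth V i) e.
    rewrite mulrC -powR_sqrt ?powRr1 ?sqrtr_ge0//; last by rewrite mulr_ge0 ?ltW.
    apply: (le_trans (h _ e0)); first by rewrite mulr_ge0 ?ltW.
    by rewrite mulrA /e divfK// gt_eqF.
  rewrite sumEFin lee_fin big_split/=; have := HC V V0.
  rewrite [X in _ -> _ + X <= _]big_split/= [X in _ -> _ <= X + _]big_split/= -!mulr_sumr.
  by move: (\sum_i `|_|) (\sum_i tnth V i) (\sum_(i < n) K) => x y z; lra.
- move=> t ad; have := HG _ ad; have m0 := fine_gig_mass_gt0 ad.
  move: (gm (q + 1) c (gd md t)) (gm q c (gd md t)) m0 => m1 m0 m00 h.
  apply: (@le_trans _ _ (kap * (Num.sqrt (theta * (gd md t / c) + C1) * m0) + K * m0)).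
    by rewrite lerD2r ler_wpM2l// ltW.
  rewrite (mulrA kap _ m0) -(mulrDl _ K m0) ler_wpM2r ?(ltW m00)// addrA lerD2r.
  rewrite -(mulrA kap _ `|t|) -(mulrDr kap) ler_wpM2l ?(ltW kap0)//.
  have -> : theta * (gd md t / c) + C1 = theta / (c * sigma ^+ 2) * t ^+ 2 + (theta * (b / c) + C1).
    by rewrite /gd; have := lt0r_neq0 c0; have := lt0r_neq0 sigma0; move: (c) => c' s1 s2; field; rewrite s1 s2.
  have h1 : 0 <= theta / (c * sigma ^+ 2) * t ^+ 2.
    by apply: mulr_ge0 (sqr_ge0 t); apply: divr_ge0 (ltW th0) _; exact: ltW (mulr_gt0 c0 s20).
  (* The constant term may be negative, as [b] is arbitrary here. *)
  apply: (@le_trans _ _ (Num.sqrt (theta / (c * sigma ^+ 2) * t ^+ 2 + `|theta * (b / c) + C1|))).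
    by rewrite ler_wsqrtr// lerD2l ler_norm.
  apply: (le_trans (sqrtr_add_le h1 (normr_ge0 _))).
  rewrite lerD2r sqrtrM ?sqrtr_sqr//; apply: divr_ge0 (ltW th0) _; exact: ltW (mulr_gt0 c0 s20).
Qed.

(** Admissibility at [d = b] gives all the [gd] a common admissible lower bound, so large values of
    [|t|] are all that [f] has to control. *)
Theorem ergodic_abs : 0 < a -> gig_adm p a b -> gig_adm q c b ->
  geometrically_ergodic (gibbs md Y) (posterior md Y).
Proof.
move=> a0 ad0 adb; have [kap [K [C [lam [C' [[k0 K0 C0 C'0] /andP[l0 l1] dM dV]]]]]] := abs_drift a0.
have c0 := gc_gt0 a0.
have adm t : gig_adm q c (gd md t) by apply: gig_adm_le adb; exact: gd_ge.
apply: (@drift_geometrically_ergodic _ _ _ _ md Y sigma0 sigma_eps0 condM_gt0 ad0 (fun t _ => adm t)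
  (fun t => (`|t| `^ 1)%:E) (power_weight kap 1 0 1 K) lam C C') => //.
- by move=> x; apply: power_weight_ge0.
- exact: measurable_power_weight.
- by move=> x _; exact: power_weight_lty.
- move=> V V0; apply: (le_trans (dM V V0)).
  rewrite EFinD leeD2r// -sumEFin; apply: lee_sum => i _.
  have Vi : 0 < tnth V i by have := V0 i; rewrite mxE.
  by rewrite lee_fin mul0r addr0 powRr1// ltW.
- move=> t _; split => //; rewrite integral_gig_powers// mul0e adde0.
  have ad1 : gig_adm (q + 1) c (gd md t) by exact: gig_adm_up.
  rewrite -(gig_massK (adm t)) -(gig_massK ad1) -!EFinM -!EFinD -?EFinM lee_fin powRr1//.
  exact: dV.
- move=> S S0; exists S, b; split => // t; rewrite lee_fin powRr1// => tS; split => //.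
  exact: gd_ge.
Qed.

(** [f] may be infinite at 0, where the real power takes a conventional value; the two sides differ
    only on the null event [M_i = 0]. *)
Lemma drawM_abs_negpow (r : R) (V : T) (i : 'I_n) (f : R -> \bar R) : orthant (tuple_col V) ->
  (forall x, 0 <= f x)%E -> measurable_fun setT f ->
  (forall x : R, x != 0 -> f x = ((`|x| `^ 1)%:E + (`|x| `^ (- r))%:E)%E) ->
  (\int[drawM md Y V]_M f (tnth M i) = \int[drawM md Y V]_M (`|tnth M i| `^ 1)%:E +
   \int[drawM md Y V]_M (`|tnth M i| `^ (- r))%:E)%E.
Proof.
move=> V0 f0 mf fE; have [s [s1 s2 E]] := drawM_marginal sigma0 sigma_eps0 condM_gt0 i V0.
have Vi : 0 < tnth V i by have := V0 i; rewrite mxE.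
have sp : 0 < s by apply: lt_le_trans s1; rewrite invr_gt0.
have xi0 : 0 < Num.sqrt (sigma ^+ 2 / s) by rewrite sqrtr_gt0 divr_gt0.
have [N N0 NE] := @gauss_moment0E R.
have canc (x y : \bar R) : (x * gauss_moment 0 = y * gauss_moment 0 -> x = y)%E.
  move=> h; have : (x * gauss_moment 0 * (N^-1)%:E = y * gauss_moment 0 * (N^-1)%:E)%E by rewrite h.
  by rewrite NE -!muleA -!EFinM divff ?gt_eqF// !mule1.
apply: canc; rewrite E// ge0_muleDl; last 2 first.
- by apply: integral_ge0.
- by apply: integral_ge0.
rewrite (E (fun x => (`|x| `^ 1)%:E) (pow0 1) (mpow 1)) (E (fun x => (`|x| `^ (- r))%:E) (pow0 _) (mpow _)).
rewrite -(gauss_intD _ _ (pow0 1) (mpow 1) (pow0 (- r)) (mpow (- r))).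
apply: gauss_int_ae => //; first by move=> x; rewrite adde_ge0.
exact: emeasurable_funD.
Qed.

Theorem ergodic_abs_negpow : 0 < a -> b = 0 -> 0 < p -> p <= 2^-1 ->
  geometrically_ergodic (gibbs md Y) (posterior md Y).
Proof.
move=> a0 b0 p0 p1; have [kap [K [C [lam [C' [[k0 K0 C0 C'0] /andP[l0 l1] dM dV]]]]]] := abs_drift a0.
have c0 := gc_gt0 a0.
have ad0 : gig_adm p a b by rewrite b0; split => //; [exact: ltW|left|right].
have gdE t : gd md t = t ^+ 2 / sigma ^+ 2 by rewrite /gd b0 add0r.
have gd0 t : t != 0 -> 0 < gd md t.
  by move=> t0; rewrite gdE divr_gt0// lt_def sqr_ge0 sqrf_eq0 t0.
have adm t : t != 0 -> gig_adm q c (gd md t).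
  by move=> t0; split; [exact: ltW|exact: ltW (gd0 t t0)|left|left; exact: gd0].
pose u := p / 2; have u0 : 0 < u by rewrite divr_gt0.
have p1' : p < 1 by rewrite (le_lt_trans p1)// invf_lt1// ltr1n.
have gmp : 0 <= gauss_mean (- p) by apply: gauss_mean_ge0; rewrite ltrN2.
have u1 : u <= 1 by rewrite ler_pdivrMr// mul1r (le_trans (ltW p1'))// ler1n.
have qu : q - u < 0.
  by rewrite /gq subr_lt0 (@le_lt_trans _ _ 0)// subr_le0.
have [lam2 [C2 [l20 l21 C20 HN]]] := gig_neg_moment c0 u0 u1 qu gmp (gauss_mean_negpow_rate p0 p1).
pose D (i : 'I_n) := projT1 (cid2 (drawM_negpowR (Y := Y) sigma0 sigma_eps0 condM_gt0 i p0 p1')).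
have D0 i : 0 <= D i by rewrite /D; case: cid2.
have HD i (V : T) : orthant (tuple_col V) ->
    (\int[drawM md Y V]_M (`|tnth M i| `^ (- p))%:E <=
     (gauss_mean (- p) * (sigma ^+ 2) `^ (- u) * tnth V i `^ (- u) + D i)%:E)%E.
  by rewrite /D; case: cid2 => x /= _; exact.
pose k2 := gauss_mean (- p) * (sigma ^+ 2) `^ (- u).
have k20 : 0 <= k2 by rewrite mulr_ge0// powR_ge0.
(* Infinite at 0, so that a finite value certifies that the GIG parameters are admissible although
   [b = 0]. *)
pose f (t : R) : \bar R := if t == 0 then +oo%E else ((`|t| `^ 1)%:E + (`|t| `^ (- p))%:E)%E.
have f0 t : (0 <= f t)%E by rewrite /f; case: ifP => // _; rewrite adde_ge0.
have mf : measurable_fun [set: R] f.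
  apply: measurable_fun_ifT => //; first by apply: measurable_fun_eqr.
  exact: emeasurable_funD.
have fE t : t != 0 -> f t = ((`|t| `^ 1)%:E + (`|t| `^ (- p))%:E)%E by rewrite /f => /negPf ->.
have SD0 : 0 <= \sum_i D i by exact: sumr_ge0.
pose lm := Num.max lam lam2.
have lm0 : 0 < lm by rewrite lt_max l0.
have lm1 : lm < 1 by rewrite gt_max l1.
apply: (@drift_geometrically_ergodic _ _ _ _ md Y sigma0 sigma_eps0 condM_gt0 ad0 adm
  f (power_weight kap 1 k2 (- u) K) lm (C + \sum_i D i) (C' + (sigma ^+ 2) `^ (- u) * C2)) => //.
- by move=> x; apply: power_weight_ge0.
- exact: measurable_power_weight.
- exact: addr_ge0.
- by rewrite addr_ge0// mulr_ge0// powR_ge0.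
- by move=> x _; exact: power_weight_lty.
- move=> V V0.
  have -> : (\sum_i \int[drawM md Y V]_M f (tnth M i) = \sum_i \int[drawM md Y V]_M (`|tnth M i| `^ 1)%:E +
      \sum_i \int[drawM md Y V]_M (`|tnth M i| `^ (- p))%:E)%E.
    by rewrite -big_split/=; apply: eq_bigr => i _; exact: drawM_abs_negpow.
  apply: (@le_trans _ _ ((\sum_i (kap * tnth V i + K) + C)%:E + \sum_i (k2 * tnth V i `^ (- u) + D i)%:E)%E).
    by apply: leeD; [exact: dM|apply: lee_sum => i _; exact: HD].
  rewrite !sumEFin -!EFinD lee_fin !big_split/= .
  have -> : \sum_i kap * tnth V i = \sum_i kap * tnth V i `^ 1.
    by apply: eq_bigr => i _; rewrite powRr1//; have := V0 i; rewrite mxE => /ltW.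
  by rewrite le_eqVlt; apply/orP; left; apply/eqP; ring.
- move=> t ft; have t0 : t != 0 by apply/negP => /eqP t0; move: ft; rewrite /f t0 eqxx.
  split; first exact: adm.
  have adt := adm t t0; have adu : gig_adm (q - u) c (gd md t).
    by case: adt => h1 h2 h3 _; split => //; left => //; exact: gd0.
  have adu1 : gig_adm (q + 1) c (gd md t) by exact: gig_adm_up.
  rewrite integral_gig_powers// fE// -(gig_massK adt) -(gig_massK adu) -(gig_massK adu1).
  rewrite -!EFinM -!EFinD -?EFinM lee_fin powRr1//.
  have h1 := dV t adt; have h2 := HN _ (gd0 t t0).
  (* As [b = 0], the second GIG parameter is exactly [t^2 / sigma^2], and the power of [sigma]
     cancels against the one in [k2]. *)
  have e1 : (sigma ^+ 2) `^ (- u) * gd md t `^ (- u) = `|t| `^ (- p).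
    rewrite -powRM ?(ltW s20) ?(ltW (gd0 t t0))// gdE mulrC divfK ?gt_eqF//.
    by rewrite /u -mulNr powR_sqr.
  have s2u : 0 <= (sigma ^+ 2) `^ (- u) by exact: powR_ge0.
  have h3 : k2 * gm (q - u) c (gd md t) <= (lam2 * `|t| `^ (- p) + (sigma ^+ 2) `^ (- u) * C2) * gm q c (gd md t).
    rewrite -e1 /k2 mulrAC mulrC.
    rewrite [leRHS](_ : _ = (sigma ^+ 2) `^ (- u) * ((lam2 * gd md t `^ (- u) + C2) * gm q c (gd md t))).
      exact: ler_wpM2l.
    by move: (_ `^ _) (_ `^ _) (gm q c _) => *; ring.
  have ll : lam * `|t| <= lm * `|t| by rewrite ler_wpM2r// /lm le_max lexx.
  have ll2 : lam2 * `|t| `^ (- p) <= lm * `|t| `^ (- p) by rewrite ler_wpM2r ?powR_ge0// /lm le_max lexx orbT.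
  have m0 := fine_gig_mass_gt0 adt.
  apply: (@le_trans _ _ ((lam * `|t| + C') * gm q c (gd md t) +
     (lam2 * `|t| `^ (- p) + (sigma ^+ 2) `^ (- u) * C2) * gm q c (gd md t))).
    by rewrite addrAC; exact: lerD.
  rewrite -mulrDl ler_wpM2r ?(ltW m0)// mulrDr.
  rewrite [leLHS](_ : _ = (lam * `|t| + lam2 * `|t| `^ (- p)) + (C' + (sigma ^+ 2) `^ (- u) * C2)); last first.
    by move: (lam * _) (lam2 * _) (_ * C2) => *; ring.
  by rewrite lerD2r lerD.
- move=> S S0; have S1 : 0 < S + 1 by rewrite ltr_wpDl.
  (* [|t|^(- p) <= S + 1] forces [|t| >= del]. *)
  pose del := (S + 1) `^ (- p^-1); have del0 : 0 < del by exact: powR_gt0.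
  exists S, (gd md del); split => //; first by apply: adm; rewrite gt_eqF.
  move=> t; rewrite /f; case: eqVneq => // t0; rewrite -EFinD lee_fin powRr1// => tS.
  have n0 : 0 < `|t| by rewrite normr_gt0.
  split; first by apply: le_trans tS; rewrite lerDl powR_ge0.
  rewrite -[gd md t]/(b + t ^+ 2 / sigma ^+ 2) -[t ^+ 2]real_normK ?num_real//.
  rewrite -[leRHS]/(gd md `|t|); apply: gd_le => //; rewrite gtr0_norm//.
  have h : `|t| `^ (- p) <= S + 1.
    by apply: le_trans (le_trans tS _); rewrite ?lerDr ?lerDl.
  rewrite /del powRN -[leRHS]invrK lef_pV2 ?posrE ?invr_gt0 ?powR_gt0//.
  apply: le_powR_inv => //.
  by rewrite -(powR_inv1 (ltW n0)) -powRrM mulN1r.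
Qed.

Theorem ergodic_pow : a = 0 -> 0 < b -> p < 0 -> mu = 0 ->
  geometrically_ergodic (gibbs md Y) (posterior md Y).
Proof.
move=> a0 b0 p0 mu0; have cE : c = 0 by rewrite /gc a0 mu0 expr0n/= mul0r addr0.
have q0 : q < 0 by rewrite /gq subr_lt0 (lt_trans p0)// invr_gt0.
have gd0 t : 0 < gd md t by apply: lt_le_trans (gd_ge t).
have adm t : gig_adm q c (gd md t) by rewrite cE; split => //; [exact: ltW|right|left].
have admb : gig_adm q c b by rewrite cE; split => //; [exact: ltW|right|left].
have ad0 : gig_adm p a b by rewrite a0; split => //; [exact: ltW|right|left].
(* [u <= 1/2] makes [r = 2 u] at most 1, as subadditivity of the power requires; [u < - p] means
   [q + u < -1/2], as the rate requires. *)
pose u := Num.min 2^-1 (- p / 2) : R.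
have u0 : 0 < u by rewrite lt_min invr_gt0 ltr0n/= divr_gt0// oppr_gt0.
have u1 : u <= 2^-1 by rewrite ge_min lexx.
have up : u < - p.
  rewrite gt_min; apply/orP; right; rewrite ltr_pdivrMr// mulr_natr mulr2n ltrDl oppr_gt0.
  exact: p0.
have qu : q + u < - 2^-1 by rewrite /gq addrAC gtrDr addrC -ltrBrDr sub0r.
have quneg : q + u < 0 by apply: lt_trans qu _; rewrite oppr_lt0 invr_gt0.
pose r := 2 * u; have r0 : 0 < r by rewrite mulr_gt0.
have r1 : r <= 1 by rewrite /r -ler_pdivlMl// mulr1.
have ru : r / 2 = u by rewrite /r mulrAC divff ?mul1r.
have rate := gauss_mean_pow_rate u0 qu; rewrite -/r in rate.
have gm0 : 0 < gauss_mean r.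
  have m1 : (-1 : R) < 0 by rewrite ltrN10.
  by apply: divr_gt0; apply: fine_gauss_moment_gt0 => //; exact: lt_trans r0.
pose j (s : R) := gm s 0 (1 : R).
have j1 : 0 < j q by exact: fine_gig_mass_gt0 (adm_inv_gamma q0).
have j2 : 0 < j (q + u) by exact: fine_gig_mass_gt0 (adm_inv_gamma quneg).
pose lam := gauss_mean r * (j (q + u) / j q).
have lam0 : 0 < lam by rewrite mulr_gt0// divr_gt0.
have [C C0 HC] := meanM_abs Y sigma0 sigma_eps0.
pose k1 := gauss_mean r * (sigma ^+ 2) `^ u.
have k10 : 0 <= k1 by rewrite mulr_ge0 ?powR_ge0// ltW.
pose C' := C `^ r + lam * (sigma ^+ 2) `^ u * b `^ u.
have C'0 : 0 <= C'.
  by rewrite addr_ge0 ?powR_ge0// mulr_ge0 ?powR_ge0// mulr_ge0 ?powR_ge0// ltW.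
apply: (@drift_geometrically_ergodic _ _ _ _ md Y sigma0 sigma_eps0 condM_gt0 ad0 (fun t _ => adm t)
  (fun t => (`|t| `^ r)%:E) (power_weight k1 u 0 u (C `^ r)) lam 0 C') => //.
- by move=> x; apply: power_weight_ge0 => //; exact: powR_ge0.
- exact: measurable_power_weight.
- by move=> x _; exact: power_weight_lty.
- move=> V V0; rewrite adde0; apply: lee_sum => i _.
  have Vi : 0 < tnth V i by have := V0 i; rewrite mxE.
  apply: (le_trans (drawM_powR sigma0 sigma_eps0 condM_gt0 i r0 r1 V0)).
  rewrite lee_fin mul0r addr0 addrC ru powRM ?(ltW s20) ?(ltW Vi)//.
  apply: lerD; first by rewrite /k1 mulrC mulrA.
  apply: ge0_ler_powR; rewrite ?nnegrE ?(ltW r0)//.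
  have := HC V V0; rewrite mu0 normr0 mul0r addr0; apply: le_trans.
  by rewrite (bigD1 i)//= lerDl; apply: sumr_ge0 => l _.
- move=> t _; split => //; rewrite integral_gig_powers//; last exact: powR_ge0.
  rewrite mul0e adde0 cE !(gig_mass_inv_gamma _ (gd0 t)).
  rewrite -(gig_massK (adm_inv_gamma q0)) -(gig_massK (adm_inv_gamma quneg)).
  rewrite -!EFinM -!EFinD -?EFinM lee_fin -/(j q) -/(j (q + u)).
  rewrite powRD; last by rewrite (gt_eqF (gd0 t)) implybT.
  have dq := powR_gt0 q (gd0 t); have du := powR_gt0 u (gd0 t).
  have h : (sigma ^+ 2) `^ u * gd md t `^ u <= (sigma ^+ 2) `^ u * b `^ u + `|t| `^ r.
    have t2 : 0 <= t ^+ 2 / sigma ^+ 2 by rewrite divr_ge0 ?sqr_ge0// ltW.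
    have := powR_subadditive u0 (le_trans u1 (ltW (_ : 2^-1 < 1))) (ltW b0) t2.
    move=> h; apply: (@le_trans _ _ ((sigma ^+ 2) `^ u * (b `^ u + (t ^+ 2 / sigma ^+ 2) `^ u))).
      by rewrite ler_wpM2l ?powR_ge0// h// invf_lt1// ltr1n.
    rewrite mulrDr lerD2l -powRM ?(ltW s20)// mulrC divfK ?gt_eqF// -ru powR_sqr.
    exact: lexx.
  have -> : k1 * (gd md t `^ q * gd md t `^ u * j (q + u)) =
      lam * ((sigma ^+ 2) `^ u * gd md t `^ u) * (gd md t `^ q * j q).
    rewrite /k1 /lam; have := lt0r_neq0 j1; move: (j q) (j (q + u)) (_ `^ _) (_ `^ _) (_ `^ _).
    by move=> x y z w v xn; field.
  rewrite -(mulrDl _ (C `^ r)) ler_wpM2r ?mulr_ge0 ?(ltW dq) ?(ltW j1)//.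
  rewrite [leRHS](_ : _ = lam * ((sigma ^+ 2) `^ u * b `^ u + `|t| `^ r) + C `^ r).
    by rewrite lerD2r ler_wpM2l// ltW.
  by rewrite /C'; move: (lam) (_ `^ _) (_ `^ _) (_ `^ _) (_ `^ _) => *; ring.
- move=> S S0; exists (S `^ r^-1), b; split => //; first exact: powR_ge0.
  move=> t; rewrite lee_fin => tS; split; last exact: gd_ge.
  exact: le_powR_inv.
Qed.

Theorem ergodic_sqr (v : 'cV[R]_n) (l : 'cV[R]_m) : a = 0 -> 0 < b -> p < 0 -> mu != 0 ->
  const_mx 1 = v + (mdlB md)^T *m l -> dotv v v < 1 ->
  geometrically_ergodic (gibbs md Y) (posterior md Y).
Proof.
move=> a0 b0 p0 mu0 dec vv1.
have mu20 : 0 < mu ^+ 2 by rewrite lt_def sqr_ge0 sqrf_eq0 mu0.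
have cE : c = mu ^+ 2 / sigma ^+ 2 by rewrite /gc a0 add0r.
have c0 : 0 < c by rewrite cE divr_gt0.
have gd0 t : 0 < gd md t by apply: lt_le_trans (gd_ge t).
have adm t : gig_adm q c (gd md t) by split; [exact: ltW|exact: ltW|left|left].
have admb : gig_adm q c b by split; [exact: ltW|exact: ltW|left|left].
have ad0 : gig_adm p a b by rewrite a0; split => //; [exact: ltW|right|left].
have [e [e0 rate0 rate1]] := sqr_rate (dotvv_ge0 v) vv1.
have [C C0 HC] := meanM_sqr Y sigma0 sigma_eps0 e0 dec.
have e1 : 0 < 1 + e by rewrite addr_gt0.
have theta1 : 1 < 1 + e by rewrite ltrDl.
have [C1 C10 HG] := gig_second_moment q c0 theta1.
pose kx := (1 + e^-1) * gauss_mean 2 * sigma ^+ 2.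
pose e' := mu ^+ 2 * e; have e'0 : 0 < e' by rewrite mulr_gt0.
pose K := kx ^+ 2 / (4 * e').
have K0 : 0 <= K by rewrite divr_ge0 ?sqr_ge0// mulr_ge0// ltW.
(* [mu^2 A] is the factor [1 + e] of [drawM_sqr] times the coefficient in [meanM_sqr], plus [mu^2 e]
   for the Gaussian variance, which is linear in [V_i]. The second GIG moment brings
   [(1 + e) / (c sigma^2) = (1 + e) / mu^2], so the rate is [A (1 + e)], which tends to [|v|^2] as
   [e] vanishes. *)
pose A := (1 + e) * ((1 + e) * (dotv v v + e)) + e.
have A0 : 0 < A by move: rate0; rewrite pmulr_lgt0.
pose kap := mu ^+ 2 * A.
have kap0 : 0 < kap by rewrite mulr_gt0.
pose C' := kap * ((1 + e) * (b / c) + C1) + K.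
have C'0 : 0 <= C'.
  apply: addr_ge0 => //; apply: mulr_ge0; first exact: ltW.
  by apply: addr_ge0; [apply: mulr_ge0; [exact: ltW|apply: divr_ge0; exact: ltW]|exact: ltW].
have mf : measurable_fun [set: R] (fun x : R => (x ^+ 2)%:E).
  by apply/measurable_EFinP; exact: measurable_funX.
apply: (@drift_geometrically_ergodic _ _ _ _ md Y sigma0 sigma_eps0 condM_gt0 ad0 (fun t _ => adm t)
  (fun t => (t ^+ 2)%:E) (power_weight kap 2 0 2 K) (A * (1 + e)) ((1 + e) * C) C') => //.
- by move=> x; rewrite lee_fin sqr_ge0.
- by move=> x; apply: power_weight_ge0 => //; exact: ltW.
- exact: measurable_power_weight.
- by rewrite mulr_ge0// ltW.
- by move=> x _; exact: power_weight_lty.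
- move=> V V0; apply: (@le_trans _ _ (\sum_i ((1 + e) * (meanM md Y (tuple_col V) i 0) ^+ 2 + (e' * tnth V i ^+ 2 + K))%:E)%E).
    apply: lee_sum => i _; apply: (le_trans (drawM_sqr sigma0 sigma_eps0 condM_gt0 i e0 V0)).
    by rewrite lee_fin lerD2l mulrA; exact: linear_le_sqr.
  have -> : (\sum_i power_weight kap 2 0 2 K (tnth V i) = \sum_i (kap * tnth V i ^+ 2 + K)%:E)%E.
    apply: eq_bigr => i _; have Vi : 0 < tnth V i by have := V0 i; rewrite mxE.
    by rewrite /power_weight mul0r addr0 powR_mulrn// ltW.
  rewrite !sumEFin -EFinD lee_fin !big_split/= -!mulr_sumr.
  have h := HC V V0; have {}h : (1 + e) * \sum_i meanM md Y (tuple_col V) i 0 ^+ 2 <=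
     (1 + e) * ((1 + e) * (mu ^+ 2 * (dotv v v + e)) * \sum_i (tnth V i) ^+ 2 + C).
    by rewrite ler_wpM2l// ltW.
  apply: (@le_trans _ _ _ _ _ (lerD h (lexx _))).
  rewrite le_eqVlt; apply/orP; left; apply/eqP; rewrite /kap /A /e'.
  by move: (dotv v v) (\sum_i tnth V i ^+ 2) (\sum_(i < n) K) (mu ^+ 2) => *; ring.
- move=> t _; split => //; rewrite integral_gig_powers ?(ltW kap0)// mul0e adde0.
  have ad2 : gig_adm (q + 2) c (gd md t) by exact: gig_adm_up.
  rewrite -(gig_massK ad2) -(gig_massK (adm t)) -!EFinM -!EFinD -?EFinM lee_fin.
  have m0 := fine_gig_mass_gt0 (adm t).
  apply: (@le_trans _ _ (kap * (((1 + e) * (gd md t / c) + C1) * gm q c (gd md t)) + K * gm q c (gd md t))).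
    by rewrite lerD2r ler_wpM2l ?(ltW kap0)// HG.
  rewrite (mulrA kap) -(mulrDl _ K) ler_wpM2r ?(ltW m0)//.
  rewrite le_eqVlt; apply/orP; left; apply/eqP; rewrite /C' /kap /gd cE.
  have h1 := lt0r_neq0 mu20; have h2 := lt0r_neq0 s20; move: (mu ^+ 2) (sigma ^+ 2) h1 h2 => x y xn yn.
  by move: (A) (b) (C1) (K) => A' b' C1' K'; field; rewrite xn yn.
- move=> S S0; exists (S `^ 2^-1), b; split => //; first exact: powR_ge0.
  move=> t; rewrite lee_fin => tS; split; last exact: gd_ge.
  by apply: le_powR_inv; rewrite ?powR_mulrn// real_normK ?num_real.
Qed.

End regimes.

Unset Implicit Arguments.
Set Strict Implicit.
Set Printing Implicit Defensive.

Theorem theorem2p2 (R : realType) (m n k : nat) (A : 'M[R]_(m, n))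
    (K : 'M[R]_n) (X : 'M[R]_(m, k)) (beta : 'cV[R]_k) (h : 'cV[R]_n)
    (mu sigma sigma_eps p a b : R) (Y : 'cV[R]_m) :
  let md := LLnGm A K X beta h mu sigma sigma_eps p a b in
  K \in unitmx -> 0 < sigma -> 0 < sigma_eps ->
  (forall V M : 'cV[R]_n, orthant V -> 0 < condM_pdf md Y V M) ->
  (forall M : 'cV[R]_n,
    {within @orthant R n, continuous (fun V => condM_pdf md Y V M)}) ->
  [/\ 0 < a -> 0 < b -> geometrically_ergodic (gibbs md Y) (posterior md Y),
      0 < a -> b = 0 -> 2^-1 < p ->
        geometrically_ergodic (gibbs md Y) (posterior md Y),
      0 < a -> b = 0 -> 0 < p -> p <= 2^-1 -> null_small md ->
        geometrically_ergodic (gibbs md Y) (posterior md Y),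
      a = 0 -> 0 < b -> p < 0 -> mu = 0 ->
        geometrically_ergodic (gibbs md Y) (posterior md Y) &
      a = 0 -> 0 < b -> p < 0 -> mu != 0 -> null_small md ->
        geometrically_ergodic (gibbs md Y) (posterior md Y)].
Proof.
move=> md Ku sigma0 sigma_eps0 condM_gt0 _.
have c0 : 0 < a -> 0 < gc md by move=> a0; exact: (@gc_gt0 _ _ _ _ md a0).
split.
- move=> a0 b0; apply: ergodic_abs => //; split => //; try exact: ltW; try by left.
  by apply: ltW; exact: c0.
  by left; exact: c0.
- move=> a0 b0 p0; apply: ergodic_abs => //.
    by rewrite /= b0; split => //; [exact: ltW|left|right; apply: lt_trans p0; rewrite invr_gt0].
  rewrite /= b0; split => //; [by apply: ltW; exact: c0|by left; exact: c0|right].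
  by rewrite /gq subr_gt0.
- by move=> a0 b0 p0 p1 _; exact: ergodic_abs_negpow.
- by move=> a0 b0 p0 mu0; exact: ergodic_pow.
- move=> a0 b0 p0 mu0 small.
  by have [v [l [dec vv1]]] := @null_small_decomposition _ _ _ _ md Ku a0 mu0 small; exact: (@ergodic_sqr _ _ _ _ md Y sigma0 sigma_eps0 condM_gt0 v l a0 b0 p0 mu0 dec vv1).
Qed.
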